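(* Let $G$ be a compact metrizable Abelian group with normalized Haar measure $\mu$ and dual group $\widehat G$, and let $\{\Gamma_N\}$ be a sequence of finite (nonempty) subsets of $\widehat G$ satisfying the Følner condition $$\frac{|(\gamma\Gamma_N)\triangle\Gamma_N|}{|\Gamma_N|}\longrightarrow0\quad(N\to\infty)\qquad\text{for every }\gamma\in\widehat G.$$ Let $\mathcal K_N=\operatorname{span}\Gamma_N\subset L^2(G)$ and let $\sigma\in L^1(G)$ be real-valued and non-negative. Let $T_\sigma^N:\mathcal K_N\to\mathcal K_N$ be the Toeplitz operator $T_\sigma^Nf=P_N(\sigma f)$, $f\in\mathcal K_N$, where $P_N:L^2(G)\to\mathcal K_N$ is the orthogonal projection. Then, for any continuous function $\psi:[0,\infty)\to\mathbb R$ such that $\psi(x)/x$ has a finite limit as $x\to\infty$, $$\lim_{N\to\infty}\frac1{|\Gamma_N|}\operatorname{Tr}\psi(T_\sigma^N)=\int_G\psi(\sigma(x))\,d\mu(x).$$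
   Context: $\widehat G$ is the (discrete, multiplicatively written) group of continuous characters of $G$; characters are regarded as elements of $L^2(G,\mu)$. Since $\sigma f$ need only lie in $L^1(G)$, $P_N$ is understood on $L^1(G)$ by the formula $P_Nh=\sum_{\xi\in\Gamma_N}\left(\int_Gh\overline\xi\,d\mu\right)\xi$, which extends the orthogonal projection. $\psi(T_\sigma^N)$ is defined by functional calculus of the positive semidefinite operator $T_\sigma^N$ on the finite-dimensional space $\mathcal K_N$. *)

(* Defs.v *)
From HB Require Import structures.
From mathcomp Require Import all_boot all_order all_algebra finmap.
From mathcomp Require Import complex ring.
From mathcomp Require Import all_classical all_reals all_analysis.

Set Implicit Arguments.
Unset Strict Implicit.
Unset Printing Implicit Defensive.

Import Order.TTheory GRing.Theory Num.Theory.
Import numFieldNormedType.Exports.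

Local Open Scope classical_set_scope.
Local Open Scope complex_scope.
Local Open Scope ring_scope.

Definition metrizable (R : realType) (T : topologicalType) : Prop :=
  exists d : T -> T -> R,
    [/\ forall x, d x x = 0,
        forall x y, d x y = 0 -> x = y,
        forall x y, d x y = d y x,
        forall y x z, d x z <= d x y + d y z
      & forall x, nbhs x =
          filter_from [set e : R | 0 < e] (fun e => [set y | d x y < e])].

(* [measurableType]s are pointed: the carrier is pointed by the neutral
   element. *)
Definition zero_pointed (G : topologicalZmodType) : Type := G.

HB.instance Definition _ (G : topologicalZmodType) :=
  Choice.on (zero_pointed G).
HB.instance Definition _ (G : topologicalZmodType) :=
  isPointed.Build (zero_pointed G) (0 : G).

Definition borel (G : topologicalZmodType) : Type :=
  g_sigma_algebraType (@open G : set (set (zero_pointed G))).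

HB.instance Definition _ (G : topologicalZmodType) := Measurable.on (borel G).

(* On a compact metrizable group every Borel probability measure is regular,
   so that the invariant one is the normalized Haar measure. *)
Definition translation_invariant (R : realType) (G : topologicalZmodType)
    (mu : probability (borel G) R) : Prop :=
  forall (x : G) (A : set (borel G)), measurable A ->
    mu [set (x + y : G) | y in A] = mu A.

Section Cintegral.
Variables (d : measure_display) (T : measurableType d) (R : realType).
Variable mu : {measure set T -> \bar R}.

Definition Cintegral (h : T -> R[i]) : R[i] :=
  (\int[mu]_x complex.Re (h x)) +i* (\int[mu]_x complex.Im (h x)).

Definition Cintegrable (h : T -> R[i]) : Prop :=
  mu.-integrable setT (EFin \o (complex.Re (R:=R) \o h)) /\
  mu.-integrable setT (EFin \o (complex.Im (R:=R) \o h)).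

Lemma CintegralD f g : Cintegrable f -> Cintegrable g ->
  Cintegral (fun x => f x + g x) = Cintegral f + Cintegral g.
Proof.
move=> [fr fi] [gr gi]; rewrite /Cintegral.
have E (a b : R[i]) : complex.Re (a + b) = complex.Re a + complex.Re b.
  by case: a b => ? ? [].
have E' (a b : R[i]) : complex.Im (a + b) = complex.Im a + complex.Im b.
  by case: a b => ? ? [].
under eq_Rintegral do rewrite E.
under [in X in _ +i* X]eq_Rintegral do rewrite E'.
by rewrite !RintegralD.
Qed.

Lemma CintegralZ a f : Cintegrable f ->
  Cintegral (fun x => a * f x) = a * Cintegral f.
Proof.
case: a => a b [fr fi]; rewrite /Cintegral.
have E (z : R[i]) : 
    complex.Re ((a +i* b) * z) = a * complex.Re z - b * complex.Im z.
  by case: z.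
have E' (z : R[i]) : 
    complex.Im ((a +i* b) * z) = a * complex.Im z + b * complex.Re z.
  by case: z.
under eq_Rintegral do rewrite E.
under [in X in _ +i* X]eq_Rintegral do rewrite E'.
have iZ (k : R) (h : T -> R) : mu.-integrable setT (EFin \o h) ->
    mu.-integrable setT (EFin \o (fun x => k * h x)).
  by move=> ih; have := integrableZl measurableT k ih.
rewrite RintegralB//=; try exact: iZ.
rewrite RintegralD//=; try exact: iZ.
by rewrite !RintegralZl.
Qed.

End Cintegral.

Record dual (R : realType) (G : topologicalZmodType) : Type := Character {
  char_fun :> G -> R[i]^o ;
  char_continuous : continuous char_fun ;
  char_norm : forall x, `|char_fun x| = 1 ;
  charD : forall x y, char_fun (x + y) = char_fun x * char_fun y }.

Section dual_group.
Variables (R : realType) (G : topologicalZmodType).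
Implicit Types chi xi : dual R G.

Lemma char_ext chi xi : (forall x, chi x = xi x) -> chi = xi.
Proof.
case: chi xi => [f fc fn fD] [g gc gn gD] /= fg.
have {}fg : f = g by exact/funext.
rewrite {}fg in fc fn fD *.
by congr Character; exact: Prop_irrelevance.
Qed.

Lemma char_neq0 chi x : chi x != 0.
Proof. by rewrite -normr_eq0 char_norm oner_neq0. Qed.

Lemma char0 chi : chi 0 = 1.
Proof. by apply: (mulfI (char_neq0 chi 0)); rewrite -charD addr0 mulr1. Qed.

Fact char_one_continuous : continuous (fun _ : G => 1 : R[i]^o).
Proof. by move=> x; exact: cvg_cst. Qed.

Fact char_one_norm (x : G) : `|1 : R[i]^o| = 1.
Proof. by rewrite normr1. Qed.

Fact char_oneD (x y : G) : (1 : R[i]^o) = 1 * 1.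
Proof. by rewrite mulr1. Qed.

Definition char_one : dual R G :=
  Character char_one_continuous char_one_norm char_oneD.

Fact char_mul_continuous chi xi : continuous (fun x => chi x * xi x).
Proof. by move=> x; apply: cvgM; exact: char_continuous. Qed.

Fact char_mul_norm chi xi x : `|chi x * xi x| = 1.
Proof. by rewrite normrM !char_norm mulr1. Qed.

Fact char_mulD chi xi x y :
  chi (x + y) * xi (x + y) = (chi x * xi x) * (chi y * xi y).
Proof. by rewrite !charD mulrACA. Qed.

Definition char_mul chi xi : dual R G :=
  Character (@char_mul_continuous chi xi) (@char_mul_norm chi xi)
    (@char_mulD chi xi).

Fact char_inv_continuous chi : continuous (fun x => chi (- x)).
Proof.
move=> x; apply: continuous_comp; first exact: opp_continuous.
exact: char_continuous.
Qed.

Fact char_inv_norm chi x : `|chi (- x)| = 1. Proof. exact: char_norm. Qed.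

Fact char_invD chi x y : chi (- (x + y)) = chi (- x) * chi (- y).
Proof. by rewrite opprD charD. Qed.

Definition char_inv chi : dual R G :=
  Character (@char_inv_continuous chi) (@char_inv_norm chi) (@char_invD chi).

Fact char_mulA : associative char_mul.
Proof. by move=> a b c; apply: char_ext => x /=; rewrite mulrA. Qed.

Fact char_mul1 : left_id char_one char_mul.
Proof. by move=> a; apply: char_ext => x /=; rewrite mul1r. Qed.

Fact char_mulr1 : right_id char_one char_mul.
Proof. by move=> a; apply: char_ext => x /=; rewrite mulr1. Qed.

Fact char_mulV : left_inverse char_one char_inv char_mul.
Proof. by move=> a; apply: char_ext => x /=; rewrite -charD addNr char0. Qed.

Fact char_mulrV : right_inverse char_one char_inv char_mul.
Proof. by move=> a; apply: char_ext => x /=; rewrite -charD subrr char0. Qed.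

HB.instance Definition _ := gen_eqMixin (dual R G).
HB.instance Definition _ := gen_choiceMixin (dual R G).
HB.instance Definition _ := isGroup.Build (dual R G)
  char_mulA char_mul1 char_mulr1 char_mulV char_mulrV.

Lemma char_free (s : seq (dual R G)) (c : dual R G -> R[i]) : uniq s ->
  (forall x, \sum_(xi <- s) c xi * xi x = 0) -> {in s, forall xi, c xi = 0}.
Proof.
elim: s c => [|eta s IHs] c //= /andP[etas us] sc0.
have cs0 : {in s, forall xi, c xi = 0}.
  move=> xi xis; apply: contrapT => /eqP cxi0.
  have : eta = xi.
    apply: char_ext => y; apply/esym/eqP; rewrite -subr_eq0.
    suff /(IHs _ us)/(_ xi xis)/eqP : forall x,
        \sum_(zeta <- s) (c zeta * (zeta y - eta y)) * zeta x = 0.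
      by rewrite mulf_eq0 (negPf cxi0).
    move=> x; have := sc0 (x + y); have := sc0 x; rewrite !big_cons => E1 E2.
    have {E1 E2} : eta y * (c eta * eta x + \sum_(zeta <- s) c zeta * zeta x) =
        c eta * eta (x + y) + \sum_(zeta <- s) c zeta * zeta (x + y).
      by rewrite E1 E2 mulr0.
    rewrite charD mulrDr mulrA [eta y * (c eta)]mulrC -mulrA.
    rewrite [eta y * eta x]mulrC => /addrI/esym/eqP.
    rewrite -subr_eq0 mulr_sumr -sumrB => /eqP E; rewrite -[RHS]E.
    by apply: eq_bigr => zeta _; rewrite charD; ring.
  by move=> E; rewrite E xis in etas.
move=> xi; rewrite inE => /predU1P[->|/cs0//].
have := sc0 0; rewrite big_cons char0 mulr1 big_seq big1 ?addr0//.
by move=> zeta /cs0 ->; rewrite mul0r.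
Qed.

End dual_group.

(* [K_Gamma], as the space of complex combinations of the functions in
   [Gamma]: characters are continuous and Haar measure has full support, so it
   embeds in [L^2]. *)
Section char_span.
Variables (R : realType) (G : topologicalZmodType) (Gamma : {fset dual R G}).

Definition in_char_span : {pred G -> R[i]^o} := fun f =>
  `[< exists c : dual R G -> R[i],
        f = \sum_(xi <- Gamma) c xi *: char_fun xi >].

Fact in_char_span_submod : submod_closed in_char_span.
Proof.
split=> [|a f g /asboolP[c ->] /asboolP[e ->]]; apply/asboolP.
  by exists (fun=> 0); rewrite big1// => xi _; rewrite scale0r.
exists (fun xi => a * c xi + e xi); rewrite scaler_sumr -big_split/=.
by apply: eq_bigr => xi _; rewrite scalerDl scalerA.
Qed.

HB.instance Definition _ := GRing.isSubmodClosed.Build R[i] (G -> R[i]^o)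
  in_char_span in_char_span_submod.

Record char_span := CharSpan {
  char_span_fun :> G -> R[i]^o ; _ : char_span_fun \in in_char_span }.

HB.instance Definition _ := [isSub for char_span_fun].
HB.instance Definition _ := [Choice of char_span by <:].
HB.instance Definition _ := [SubChoice_isSubLmodule of char_span by <:].

Fact in_char_span_char (xi : Gamma) : char_fun (val xi) \in in_char_span.
Proof.
apply/asboolP; exists (fun zeta => (zeta == val xi)%:R).
rewrite (big_fsetD1 (val xi))/= ?(valP xi)// eqxx scale1r big1_fset ?addr0//.
by move=> zeta; rewrite !inE => /andP[/negPf -> _] _; rewrite scale0r.
Qed.

Definition char_in (xi : Gamma) : char_span := CharSpan (in_char_span_char xi).

Definition char_comb (u : 'rV[R[i]]_#|{: Gamma}|) : char_span :=
  \sum_(i < #|{: Gamma}|) u 0 i *: char_in (enum_val i).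

Lemma char_combE u x :
  char_comb u x = \sum_(xi : Gamma) u 0 (enum_rank xi) * val xi x.
Proof.
rewrite [char_span_fun _](raddf_sum (val : char_span -> G -> R[i]^o)).
rewrite fct_sumE (reindex_onto enum_rank enum_val) => [|i _]; last first.
  exact: enum_valK.
by apply: eq_big => [xi|xi _]; rewrite enum_rankK ?eqxx.
Qed.

Fact char_comb_is_linear : linear char_comb.
Proof.
move=> a u v; rewrite /char_comb scaler_sumr -big_split/=.
by apply: eq_bigr => i _; rewrite !mxE scalerDl scalerA.
Qed.

Fact char_comb_inj : injective char_comb.
Proof.
move=> u v uv; apply/rowP => i; rewrite -(enum_valK i); set xi := enum_val i.
pose c zeta := if insub zeta is Some z then
  u 0 (@enum_rank Gamma z) - v 0 (enum_rank z) else 0.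
have cE (z : Gamma) : c (val z) = u 0 (enum_rank z) - v 0 (enum_rank z).
  by rewrite /c valK.
apply/eqP; rewrite -subr_eq0 -cE; apply/eqP.
apply: (char_free (fset_uniq Gamma)) (valP xi) => x.
rewrite big_seq_fsetE/=.
under eq_bigr do rewrite cE mulrBl.
by rewrite sumrB -2!char_combE uv subrr.
Qed.

Fact char_comb_surj (f : char_span) : exists u, char_comb u = f.
Proof.
case: f => f ff; have /asboolP[c fE] := ff.
exists (\row_i c (val (enum_val i))); apply: val_inj; apply/funext => x /=.
rewrite char_combE fE fct_sumE big_seq_fsetE/=.
by apply: eq_bigr => xi _; rewrite mxE enum_rankK.
Qed.

Fact char_span_vector : Vector.axiom #|{: Gamma}| char_span.
Proof.
pose h f := sval (cid (char_comb_surj f)).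
have hK : cancel h char_comb by move=> f; rewrite /h; case: cid.
have Kh : cancel char_comb h by move=> u; apply: char_comb_inj; rewrite hK.
exists h; last by exists char_comb.
by move=> a f g; apply: char_comb_inj; rewrite char_comb_is_linear !hK.
Qed.

HB.instance Definition _ := Lmodule_hasFinDim.Build R[i] char_span
  char_span_vector.

End char_span.

Section toeplitz.
Variables (R : realType) (G : topologicalZmodType).
Variables (mu : probability (borel G) R) (Gamma : {fset dual R G}).

(* The formula for the orthogonal projection makes sense on [L^1]. *)
Definition char_proj (h : G -> R[i]) : char_span Gamma :=
  \sum_(xi : Gamma) Cintegral mu (fun x => h x * (val xi x)^*) *: char_in xi.

(* [linfun] only agrees with the function it is applied to when the latter is
   linear; this is the case for integrable sigma, see [toeplitzE]. *)
Definition toeplitz (sigma : G -> R) : 'End(char_span Gamma) :=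
  linfun (fun f : char_span Gamma => char_proj (fun x => (sigma x)%:C * f x)).

Lemma continuous_borel_measurable (f : G -> R) :
  continuous f -> measurable_fun [set: borel G] f.
Proof.
move=> /continuousP cf.
apply: (measurability _ (measurable_realfun.RGenOpens.measurableE R)).
move=> _ [_ [a [b ->] <-]]; rewrite setTI; apply: sub_sigma_algebra.
exact/cf/interval_open.
Qed.

Lemma continuous_Re : continuous (complex.Re (R:=R) : R[i]^o -> R).
Proof.
move=> z; apply/(@cvgrPdist_lt _ R^o _ _ (nbhs_filter (z : R[i]^o))) => e e0.
exists e%:C => /=; first by rewrite ltcR.
move=> w /= zw; rewrite -ltcR; apply: le_lt_trans zw.
have -> : complex.Re z - complex.Re w = complex.Re (z - w).
  by case: z (w) => ? ? [].
exact: normc_ge_Re.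
Qed.

Lemma continuous_Im : continuous (complex.Im (R:=R) : R[i]^o -> R).
Proof.
have -> : (complex.Im (R:=R) : R[i]^o -> R) =
    (complex.Re (R:=R) \o *%R (-'i)).
  by apply/funext => -[a b] /=; ring.
move=> x; apply: continuous_comp; last exact: continuous_Re.
by apply: (@cvgM _ _ (nbhs x) _ (fun=> - 'i : R[i]^o) id);
  [exact: cvg_cst|exact: cvg_id].
Qed.

Lemma Cintegrable_mul_continuous (sigma : G -> R) (f : G -> R[i]^o) (M : R) :
  mu.-integrable [set: borel G] (EFin \o sigma) -> continuous f ->
  (forall x, `|f x| <= M%:C) ->
  Cintegrable mu (fun x : borel G => (sigma x)%:C * f x).
Proof.
move=> si fc fM.
have H (p : R[i] -> R) : continuous (p : R[i]^o -> R) ->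
    (forall z, `|p z|%:C <= `|z|) ->
    (forall (a : R) z, p (a%:C * z) = a * p z) ->
    mu.-integrable [set: borel G]
      (EFin \o (p \o (fun x : borel G => (sigma x)%:C * f x))).
  move=> pc pn pZ.
  have -> : EFin \o (p \o (fun x : borel G => (sigma x)%:C * f x)) =
      ((EFin \o sigma) \* (EFin \o (p \o f)))%E.
    by apply/funext => x /=; rewrite pZ.
  apply: integrableMl => //.
    apply: continuous_borel_measurable => x.
    by apply: continuous_comp; [exact: fc|exact: pc].
  exists M; split; first exact: num_real.
  move=> y My x _ /=; apply: le_trans (ltW My).
  by rewrite -lecR; apply: le_trans (fM x); exact: pn.
split; apply: H.
- exact: continuous_Re.
- exact: normc_ge_Re.
- by move=> a [b c] /=; ring.
- exact: continuous_Im.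
- move=> [a b]; have := normc_ge_Re ((a +i* b) * (-'i)).
  have -> : `|(a +i* b) * (-'i)| = `|a +i* b|.
    rewrite normrM normrN [X in _ * X]normc_def/= expr0n add0r expr1n.
    by rewrite sqrtr1 mulr1.
  congr (`|_|%:C <= _) => /=; ring.
- by move=> a [b c] /=; ring.
Qed.

Lemma char_sum_continuous (c : dual R G -> R[i]) s :
  continuous (fun x : G => \sum_(xi <- s) c xi * char_fun xi x : R[i]^o).
Proof.
move=> x; elim: s => [|z s IH].
  have -> : (fun x : G => \sum_(xi <- [::]) c xi * char_fun xi x : R[i]^o) =
      fun=> 0.
    by apply/funext => y; rewrite big_nil.
  exact: cvg_cst.
have -> : (fun x : G => \sum_(xi <- z :: s) c xi * char_fun xi x : R[i]^o) =
    fun x => c z * char_fun z x + \sum_(xi <- s) c xi * char_fun xi x.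
  by apply/funext => y; rewrite big_cons.
apply: cvgD IH; apply: cvgM; [exact: cvg_cst|exact: char_continuous].
Qed.

Lemma toeplitzE sigma (f : char_span Gamma) :
  mu.-integrable [set: borel G] (EFin \o sigma) ->
  toeplitz sigma f = char_proj (fun x => (sigma x)%:C * f x).
Proof.
move=> si.
have ci (xi : Gamma) (h : char_span Gamma) :
    Cintegrable mu (fun x : borel G => ((sigma x)%:C * h x) * (val xi x)^*).
  have [c ->] : exists c : dual R G -> R[i],
      char_span_fun h = \sum_(xi <- Gamma) c xi *: char_fun xi.
    by apply/asboolP; exact: (valP h).
  pose M : R[i] := \sum_(xi <- Gamma) `|c xi|.
  have ME : M = (complex.Re M)%:C.
    by apply/esym/RRe_real; apply: ger0_real; apply: sumr_ge0.
  pose g : G -> R[i]^o := fun x =>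
    (\sum_(xi <- Gamma) c xi * char_fun xi x) * char_inv (val xi) x.
  have -> : (fun x : borel G => ((sigma x)%:C *
      (\sum_(zeta <- Gamma) c zeta *: char_fun zeta) x) * (val xi x)^*) =
      (fun x => (sigma x)%:C * g x).
    apply/funext => x; rewrite fct_sumE -mulrA; congr (_ * (_ * _)).
    apply: (mulIf (char_neq0 (val xi) x)).
    by rewrite /= -charD addNr char0 mulrC -[LHS]sqr_normc char_norm expr1n.
  apply: (Cintegrable_mul_continuous (M := complex.Re M)) => //.
    move=> x; apply: cvgM; last exact: char_continuous.
    exact: char_sum_continuous.
  move=> x; rewrite -ME /g normrM char_norm mulr1.
  apply: le_trans (ler_norm_sum _ _ _) _; apply: ler_sum => z _.
  by rewrite normrM char_norm mulr1.
have L : linear (fun f : char_span Gamma =>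
    char_proj (fun x => (sigma x)%:C * f x)).
  move=> a g h; rewrite /char_proj scaler_sumr -big_split/=.
  apply: eq_bigr => xi _; rewrite scalerA -scalerDl; congr (_ *: _).
  have E1 x : (a *: g : char_span Gamma) x = a * g x by [].
  have E2 x : (a *: g + h : char_span Gamma) x = a * g x + h x by [].
  rewrite -CintegralZ//.
  have := ci xi (a *: g); under eq_fun do rewrite E1 mulrCA -mulrA.
  move=> K; rewrite -CintegralD//.
  congr (Cintegral mu _); apply/funext => x.
  transitivity (((sigma x)%:C * (a * g x + h x)) * (val xi x)^*); [by []|ring].
- exact: ci.
- exact: ci.
set F0 := fun f => _ in L.
pose LM := GRing.isLinear.Build _ _ _ _ F0 L.
pose F : {linear _ -> _} := HB.pack F0 LM.
by rewrite /toeplitz (lfunE F).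
Qed.

End toeplitz.

Section operators.
Variables (F : fieldType) (V : vectType F).

Definition lfun_trace (T : 'End(V)) : F :=
  \tr (passmx.mxof (vbasis {:V}) (vbasis {:V}) T).

(* The projection onto ker (T - a) along im (T - a).  When T is self-adjoint
   for some inner product, and a is real, these are orthogonal complements:
   this is then the orthogonal projection onto the eigenspace. *)
Definition spectral_proj (T : 'End(V)) (a : F) : 'End(V) :=
  daddv_pi (passmx.leigenspace T a) (limg (T - a *: \1%VF)).

(* For diagonalizable T this is the operator acting as psi a on each eigenspace
   ker (T - a), see [fun_calculus_eigenvector]. *)
Definition fun_calculus (psi : F -> F) (T : 'End(V)) : 'End(V) :=
  \sum_(a \in [set a | passmx.leigenvalue T a]) psi a *: spectral_proj T a.

End operators.

Section functional_calculus.
Import passmx.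
Variables (F : closedFieldType) (V : vectType F).
Implicit Type T : 'End(V).

Lemma finite_spectrum T : finite_set [set a | leigenvalue T a].
Proof.
pose M := mxof (vbasis {:V}) (vbasis {:V}) T.
have [s sP] := closed_field_poly_normal (char_poly M).
apply: (@sub_finite_set _ _ [set` s]); last exact: finite_seq.
move=> a /=; rewrite /leigenvalue (leigenspaceE (vbasisP _)) vsof_eq0 ?vbasisP//.
rewrite -/(eigenvalue M a) eigenvalue_root_char -/M sP rootZ ?root_prod_XsubC//.
by rewrite lead_coef_eq0 monic_neq0// char_poly_monic.
Qed.

Lemma fun_calculus_eigenvector (psi : F -> F) T a v :
  (forall b, leigenspace T b :&: limg (T - b *: \1%VF) = 0)%VS ->
  T v = a *: v -> fun_calculus psi T v = psi a *: v.
Proof.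
move=> H Tv.
have [->|v0] := eqVneq v 0; first by rewrite linear0 scaler0.
have va : v \in leigenspace T a.
  by rewrite memv_ker add_lfunE opp_lfunE scale_lfunE id_lfunE Tv subrr.
have ea : leigenvalue T a.
  by apply: contra v0 => /eqP E; rewrite E memv0 in va.
rewrite /fun_calculus fsbig_finite/=; last exact: finite_spectrum.
rewrite sum_lfunE (big_fsetD1 a)/=; last first.
  by rewrite in_fset_set ?inE//; exact: finite_spectrum.
have E : spectral_proj T a v = v by rewrite /spectral_proj daddv_pi_id.
rewrite scale_lfunE E big1_fset ?addr0// => b.
rewrite !inE => /andP[ba _] _; rewrite scale_lfunE /spectral_proj.
have vb : v \in limg (T - b *: \1%VF).
  apply/memv_imgP; exists ((a - b)^-1 *: v); first exact: memvf.
  rewrite linearZ/= add_lfunE opp_lfunE scale_lfunE id_lfunE Tv.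
  by rewrite -scalerBl scalerA mulVf ?scale1r// subr_eq0 eq_sym.
have := daddv_pi_add (H b) (subvP (addvSr (leigenspace T b) _) _ vb).
have HC := H b; rewrite capvC in HC.
rewrite (daddv_pi_id HC vb) => /eqP; rewrite -subr_eq0 addrK => /eqP ->.
by rewrite scaler0.
Qed.

End functional_calculus.

(* The eigenvalues of a self-adjoint operator are real elements of [R[i]]. *)
Definition on_real_part (R : realType) (psi : R -> R) : R[i] -> R[i] :=
  fun z => (psi (complex.Re z))%:C.

Definition translate (R : realType) (G : topologicalZmodType)
    (gamma : dual R G) (A : {fset dual R G}) : {fset dual R G} :=
  [fset (gamma * xi)%g | xi in A]%fset.

Definition symdiff (K : choiceType) (A B : {fset K}) : {fset K} :=
  ((A `\` B) `|` (B `\` A))%fset.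

Definition Folner (R : realType) (G : topologicalZmodType)
    (Gamma : nat -> {fset dual R G}) : Prop :=
  forall gamma : dual R G,
    (#|` symdiff (translate gamma (Gamma N)) (Gamma N)|%:R
       / #|` Gamma N|%:R : R) @[N --> \oo] --> (0 : R).

(* Main.v *)
(** The operator [T] of multiplication by [sigma] compressed to the span of
    [Gamma_N] has an orthonormal eigenbasis [e_j] with eigenvalues [lam_j >= 0].
    The weights [w_j = |e_j|^2 / |Gamma_N|] couple the eigenvalue distribution
    with [mu]: they sum to [1] pointwise, have integral [1 / |Gamma_N|], and
    [lam_j] is the mean of [sigma] against [|e_j|^2], while
    [sum_j lam_j w_j] is the convolution of [sigma] with the Fejer kernel
    [|sum_(xi in Gamma_N) xi|^2 / |Gamma_N|].  Under the Folner condition this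
    convolution tends to [sigma] in [L^1], because it does so for trigonometric
    polynomials.  Writing [psi x = (1 + x) q(1 / (1 + x))] with [q] uniformly
    continuous and using the strictly convex function [1 / (1 + x)], the
    difference between the normalized trace and the integral is bounded by the
    [L^1] distance between [sigma] and its smoothing.

    The density of trigonometric polynomials is proved by applying power
    iteration to convolution operators: the normalized convolution powers of a
    hermitian function converge uniformly to an idempotent of the convolution
    algebra, and a minimal idempotent is a multiple of a character. *)

Require Import Defs.
From HB Require Import structures.
From mathcomp Require Import all_boot all_order all_algebra finmap.
From mathcomp Require Import complex ring lra zify.
From mathcomp Require Import all_classical all_reals all_analysis.
From mathcomp Require Import measurable_realfun.

Set Implicit Arguments.
Unset Strict Implicit.
Unset Printing Implicit Defensive.

Import Order.TTheory GRing.Theory Num.Theory.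
Import numFieldNormedType.Exports.

Local Open Scope classical_set_scope.
Local Open Scope complex_scope.
Local Open Scope ring_scope.

(** * Continuous functions on compact groups *)

(** Since [sigma] is only integrable, its powers may have infinite integral, so [psi] cannot be
    replaced by polynomials and the traces compared power by power. The coupling relies on first
    moments alone, through two Jensen inequalities for [phi x = 1 / (1 + x)]. As [lam_j] is a mean
    of [sigma], the normalized sum of the [phi lam_j] is at most the integral of [phi sigma]; as
    [sum_j lam_j w_j] is at each point a mean of the [lam_j], the same sum is at least the integral
    of [phi] of the smoothed symbol. The two ends merge in the limit, and strict convexity then
    forces [lam_j] to be close, on average, to [sigma] where [w_j] carries mass. This settles every
    admissible [psi], convex or not. The smoothing is positive and preserves integrals, hence
    contracts [L^1]; this is what extends its convergence from trigonometric polynomials to [sigma].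
    Characters are built inside the convolution algebra of continuous functions: convolution turns
    [L^2] convergence into uniform convergence, and the value at [0] serves as a trace that is at
    least [1] on nonzero idempotents, so that splitting them terminates. *)

Section continuous_complex.
Variables (R : realType) (T : topologicalType).
Implicit Types f g : T -> R[i]^o.

Lemma continuous_cst (a : R[i]) : continuous (fun _ : T => a : R[i]^o).
Proof. by move=> x; exact: cvg_cst. Qed.

Lemma continuousCD f g : continuous f -> continuous g ->
  continuous (fun x => f x + g x).
Proof. by move=> cf cg x; apply: cvgD; [exact: cf|exact: cg]. Qed.

Lemma continuousCM f g : continuous f -> continuous g ->
  continuous (fun x => f x * g x).
Proof. by move=> cf cg x; apply: cvgM; [exact: cf|exact: cg]. Qed.

Lemma continuousCJ f : continuous f -> continuous (fun x => (f x)^*).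
Proof.
move=> cf x.
apply/(@cvgrPdist_lt _ R[i]^o) => e e0.
have := cf x; move/(@cvgrPdist_lt _ R[i]^o _ _ _ _ (f x)) => /(_ _ e0).
apply: filterS => y /=.
have -> : (f x)^* - (f y)^* = (f x - f y)^* by rewrite rmorphB.
by rewrite norm_conjC.
Qed.

End continuous_complex.

Section continuous_group.
Variables (R : realType) (G : topologicalZmodType).
Implicit Types f g : G -> R[i]^o.

Lemma continuous_opp_arg f : continuous f -> continuous (fun x => f (- x)).
Proof.
move=> cf x; apply: continuous_comp; [exact: opp_continuous|exact: cf].
Qed.

Lemma continuous_shift (a : G) f : continuous f ->
  continuous (fun x => f (a + x)).
Proof.
move=> cf x.
apply: (@continuous_comp _ _ _ (fun x => a + x)); last exact: cf.
apply: (@continuous_comp _ _ _ (fun x => (a, x)) (fun x : G * G => x.1 + x.2)).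
  by apply: cvg_pair => /=; [exact: cvg_cst|exact: cvg_id].
exact: add_continuous.
Qed.

Lemma continuous_flip (a : G) f : continuous f ->
  continuous (fun x => f (a - x)).
Proof.
move=> cf; apply: (@continuous_opp_arg (fun x => f (a + x))).
exact: continuous_shift.
Qed.

Lemma continuous_diff f : continuous f ->
  continuous (fun z : G * G => f (z.1 - z.2)).
Proof.
move=> cf x; apply: (@continuous_comp _ _ _ (fun z : G * G => z.1 - z.2)).
  exact: sub_continuous.
exact: cf.
Qed.

Lemma continuousC_fst f : continuous f -> continuous (fun z : G * G => f z.1).
Proof. by move=> cf x; apply: continuous_comp; [exact: cvg_fst|exact: cf]. Qed.

Lemma continuousC_snd f : continuous f -> continuous (fun z : G * G => f z.2).
Proof. by move=> cf x; apply: continuous_comp; [exact: cvg_snd|exact: cf]. Qed.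

Lemma continuousC_partial (F : G * G -> R[i]^o) x : continuous F ->
  continuous (fun y => F (x, y)).
Proof.
move=> cF y; apply: (@continuous_comp _ _ _ (fun y => (x, y))); last exact: cF.
by apply: cvg_pair => /=; [exact: cvg_cst|exact: cvg_id].
Qed.

End continuous_group.

Section compact_space.
Variables (R : realType) (T : topologicalType).
Hypothesis T_compact : compact [set: T].

Lemma compact_continuous_bounded (f : T -> R[i]^o) : continuous f ->
  exists2 M : R, 0 <= M & forall x, `|f x| <= M%:C.
Proof.
move=> cf.
have /compact_near_coveringP/(_ R (pinfty_nbhs R)) := T_compact.
move=> /(_ (fun M x => `|f x| <= M%:C) _) H.
have {}H : \forall M \near +oo%R, [set: T] `<=` (fun x => `|f x| <= M%:C).
  apply: H => x _.
  have H1 : \forall y \near x, `|f x - f y| < 1.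
    by have := cf x; move/(@cvgrPdist_lt _ R[i]^o _ _ _ _ (f x)); exact.
  have H2 : \forall M \near +oo%R, complex.Re `|f x| + 1 <= M.
    by apply: nbhs_pinfty_ge; rewrite num_real.
  exists ([set y | `|f x - f y| < 1], [set M | complex.Re `|f x| + 1 <= M]) => //=.
  move=> [y M] /= [Hy HM].
  apply: (@le_trans _ _ (`|f x| + 1)).
    have -> : f y = f x - (f x - f y) by rewrite subKr.
    by apply: le_trans (ler_normB _ _) _; rewrite lerD2l ltW.
  have -> : `|f x| = (complex.Re `|f x|)%:C.
    by apply/esym/RRe_real/ger0_real/normr_ge0.
  by rewrite -[1]/(1%:C) -rmorphD lecR.
have H0 : \forall M \near +oo%R, 0 <= M :> R by exact: nbhs_pinfty_ge.
have [M [HM M0]] := filter_ex (filterI H H0).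
by exists M => // x; exact: HM.
Qed.

(** The tube lemma: each [t] has a neighbourhood that works with some neighbourhood of [s0], and
    compactness leaves a single neighbourhood of [s0] serving all [t]. *)
Lemma compact_near_uniform (S : topologicalType) (F : S * T -> R[i]^o) (s0 : S)
    (e : R[i]) : continuous F -> 0 < e ->
  \forall s \near s0, forall t, `|F (s, t) - F (s0, t)| < e.
Proof.
move=> cF e0.
have /compact_near_coveringP/(_ S (nbhs s0)) := T_compact.
move=> /(_ (fun s t => `|F (s, t) - F (s0, t)| < e) _) H.
suff : \forall s \near s0, [set: T] `<=` (fun t => `|F (s, t) - F (s0, t)| < e).
  by apply: filterS => s Hs t; exact: Hs.
apply: H => t _.
have e2 : 0 < e / 2 by rewrite divr_gt0.
have H : \forall z \near (s0, t), `|F (s0, t) - F z| < e / 2.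
  by have := cF (s0, t); move/(@cvgrPdist_lt _ R[i]^o) => /(_ _ e2).
have [[A B] /= [As Bt] AB] := H.
exists (B, A) => //= -[t' s] [/= Bt' As'].
have -> : F (s, t') - F (s0, t') = (F (s0, t) - F (s0, t')) - (F (s0, t) - F (s, t')).
  by rewrite opprB [RHS]addrC addrA subrK.
apply: le_lt_trans (ler_normB _ _) _.
rewrite [e]splitr; apply: ltrD; apply: AB => //; split => //=.
exact: nbhs_singleton.
Qed.

End compact_space.

(** Compactness in its near-covering form, for the filter of finite lists ordered by inclusion: a
    point covered by one list remains covered by all larger ones. *)
Lemma compact_finite_cover (T : topologicalType) (U : T -> set T) :
  compact [set: T] -> (forall x, nbhs x (U x)) ->
  exists s : seq T, forall y, exists2 x, x \in s & U x y.
Proof.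
move=> cT Unbhs.
pose F : set_system (seq T) :=
  filter_from [set: seq T] (fun s => [set s' : seq T | {subset s <= s'}]).
have FF : Filter F.
  apply: filter_from_filter; first by exists [::].
  move=> s t _ _; exists (s ++ t) => // r /= H; split=> x xs; apply: H;
    by rewrite mem_cat xs ?orbT.
have /compact_near_coveringP/(_ _ F (fun s y => exists2 x, x \in s & U x y) FF) := cT.
move=> H; have [x _|s _ Hs] := H.
  exists (U x, [set s : seq T | {subset [:: x] <= s}]) => /=.
    by split; [exact: Unbhs|exists [:: x]].
  by move=> [y s] /= [Uy Hs]; exists x => //; apply: Hs; rewrite inE.
by exists s => y; exact: (Hs s).
Qed.

(** * Invariance of the Haar integral *)

Section Cintegral_theory.
Variables (d : measure_display) (T : measurableType d) (R : realType).
Variable mu : {measure set T -> \bar R}.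
Implicit Types f g : T -> R[i].

Lemma Re_add (a b : R[i]) :
  complex.Re (a + b) = complex.Re a + complex.Re b.
Proof. by case: a b => ? ? []. Qed.

Lemma Im_add (a b : R[i]) :
  complex.Im (a + b) = complex.Im a + complex.Im b.
Proof. by case: a b => ? ? []. Qed.

Lemma Re_sub (a b : R[i]) :
  complex.Re (a - b) = complex.Re a - complex.Re b.
Proof. by case: a b => ? ? []. Qed.

Lemma CintegrableD f g : Cintegrable mu f -> Cintegrable mu g ->
  Cintegrable mu (fun x => f x + g x).
Proof.
move=> [fr fi] [gr gi]; split.
  have := integrableD measurableT fr gr; apply: eq_integrable => //.
  by move=> x _ /=; rewrite Re_add.
have := integrableD measurableT fi gi; apply: eq_integrable => //.
by move=> x _ /=; rewrite Im_add.
Qed.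

Lemma CintegrableZ a f : Cintegrable mu f -> Cintegrable mu (fun x => a * f x).
Proof.
case: a => a b [fr fi].
have iZ (k : R) (h : T -> R) : mu.-integrable setT (EFin \o h) ->
    mu.-integrable setT (EFin \o (fun x => k * h x)).
  by move=> ih; have := integrableZl measurableT k ih.
split.
  have := integrableB measurableT (iZ a _ fr) (iZ b _ fi).
  by apply: eq_integrable => // x _ /=; case: (f x).
have := integrableD measurableT (iZ a _ fi) (iZ b _ fr).
by apply: eq_integrable => // x _ /=; case: (f x).
Qed.

Lemma Cintegral_conj f : Cintegrable mu f ->
  Cintegral mu (fun x => (f x)^*) = (Cintegral mu f)^*.
Proof.
move=> [fr fi]; rewrite /Cintegral.
transitivity ((\int[mu]_x complex.Re (f x)) -i* (\int[mu]_x complex.Im (f x))).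
  congr (_ +i* _); first by apply: eq_Rintegral => x _; case: (f x).
  rewrite -mulN1r -RintegralZl//; apply: eq_Rintegral => x _.
  by rewrite mulN1r; case: (f x).
by [].
Qed.

Lemma Cintegral_ge0 f : (forall x, 0 <= f x) -> 0 <= Cintegral mu f.
Proof.
move=> f0; rewrite /Cintegral.
have H x : complex.Im (f x) = 0 /\ 0 <= complex.Re (f x).
  by have := f0 x; rewrite lecE => /andP[/eqP].
rewrite lecE/= (_ : \int[mu]_x complex.Im (f x) = 0) ?eqxx/=.
  by apply: Rintegral_ge0 => x _; have [] := H x.
under eq_Rintegral do rewrite (proj1 (H _)).
by rewrite Rintegral_cst// mul0r.
Qed.

Lemma Cintegrable_sum (I : Type) (s : seq I) (F : I -> T -> R[i]) :
  (forall i, Cintegrable mu (F i)) -> Cintegrable mu (fun x => \sum_(i <- s) F i x).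
Proof.
move=> iF; elim: s => [|i s IH].
  have -> : (fun x => \sum_(i <- [::]) F i x) = (fun=> 0).
    by apply/funext => x; rewrite big_nil.
  by split; apply: eq_integrable (integrable0 _ _).
have -> : (fun x => \sum_(j <- i :: s) F j x) =
    fun x => F i x + \sum_(j <- s) F j x.
  by apply/funext => x; rewrite big_cons.
exact: CintegrableD.
Qed.

Lemma Cintegral_sum (I : Type) (s : seq I) (F : I -> T -> R[i]) :
  (forall i, Cintegrable mu (F i)) ->
  Cintegral mu (fun x => \sum_(i <- s) F i x) = \sum_(i <- s) Cintegral mu (F i).
Proof.
move=> iF; elim: s => [|i s IH].
  rewrite big_nil /Cintegral.
  under eq_Rintegral do rewrite big_nil.
  under [in X in _ +i* X]eq_Rintegral do rewrite big_nil.
  by rewrite /= Rintegral_cst// mul0r.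
have -> : (fun x => \sum_(j <- i :: s) F j x) =
    fun x => F i x + \sum_(j <- s) F j x.
  by apply/funext => x; rewrite big_cons.
by rewrite CintegralD ?IH ?big_cons//; exact: Cintegrable_sum.
Qed.

End Cintegral_theory.

Section Haar_integral.
Variables (R : realType) (G : topologicalZmodType).
Hypothesis G_compact : compact [set: G].
Variable mu : probability (borel G) R.
Hypothesis mu_haar : translation_invariant mu.
Implicit Types f g : G -> R[i]^o.

Lemma Cintegrable_continuous f : continuous f ->
  Cintegrable mu (f : borel G -> R[i]).
Proof.
move=> cf; have [M M0 fM] := compact_continuous_bounded G_compact cf.
have := @Cintegrable_mul_continuous R G mu (fun=> 1) f M _ cf fM.
rewrite (_ : (fun x : borel G => 1%:C * f x) = f); last first.
  by apply/funext => x; rewrite mul1r.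
by apply; exact: finite_measure_integrable_cst.
Qed.

Lemma Cintegral_cst a : Cintegral mu (fun _ : borel G => a) = a.
Proof.
rewrite /Cintegral !Rintegral_cst//; set m := fine _.
have -> : m = 1 by exact: (congr1 fine (probability_setT mu)).
by rewrite !mulr1; case: a.
Qed.

Lemma measurable_open (A : set G) : open A -> measurable (A : set (borel G)).
Proof. by move=> oA; apply: sub_sigma_algebra. Qed.

Lemma measurable_add (a : G) :
  measurable_fun [set: borel G] (fun x : borel G => (a + x : G) : borel G).
Proof.
apply: (@measurability _ _ (borel G) (borel G) _ _
  (@open G : set (set (borel G)))) => //.
move=> _ [B oB <-]; rewrite setTI; apply: measurable_open.
have H : continuous (fun x : G => a + x).
  move=> x.
  apply: (@continuous_comp _ _ _ (fun x => (a, x)) (fun x : G * G => x.1 + x.2)).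
    by apply: cvg_pair => /=; [exact: cvg_cst|exact: cvg_id].
  exact: add_continuous.
by move/continuousP : H; exact.
Qed.

Lemma Rintegral_shift (h : G -> R) (a : G) :
  mu.-integrable [set: borel G] (EFin \o (fun x => h (a + x))) ->
  measurable_fun [set: borel G] h ->
  \int[mu]_x h (a + x) = \int[mu]_x h x.
Proof.
move=> ih mh; rewrite /Rintegral; congr fine.
transitivity (\int[pushforward mu (fun x : borel G => (a + x)%R : borel G)]_y
    (h y)%:E)%E.
  have /(_ R mu setT (EFin \o h)) := integral_pushforward (measurable_add a).
  rewrite preimage_setT => ->//; exact/measurable_EFinP.
apply: (eq_measure_integral mu) => [|? A mA _]; first exact: measurable_add.
have mB : measurable ((fun x : borel G => (a + x : G) : borel G) @^-1` A).
  by rewrite -[X in measurable X]setTI; exact: measurable_add.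
(* Invariance is stated for images of sets, so it is applied to the preimage of [A], whose translate
   by [a] is [A]. *)
apply: (etrans (esym (mu_haar a mB))).
congr (mu _); apply/seteqP; split => [y /= [x Ax <-]//|y Ay].
by exists (- a + y : G) => //=; rewrite addrA subrr add0r.
Qed.

Lemma Cintegral_shift f a : continuous f ->
  Cintegral mu (fun x : borel G => f (a + x)) = Cintegral mu f.
Proof.
move=> cf; have [ir ii] := Cintegrable_continuous (continuous_shift (a := a) cf).
rewrite /Cintegral; congr (_ +i* _).
  apply: (@Rintegral_shift (fun x => complex.Re (f x)) a) => //.
  apply: continuous_borel_measurable => x.
  by apply: continuous_comp; [exact: cf|exact: continuous_Re].
apply: (@Rintegral_shift (fun x => complex.Im (f x)) a) => //.
apply: continuous_borel_measurable => x.
by apply: continuous_comp; [exact: cf|exact: continuous_Im].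
Qed.

(* Second countability is not needed: by compactness, [{p o F > a}] is a
   countable union of measurable rectangles. *)
Lemma measurable_continuous_prod (F : G * G -> R[i]^o) (p : R[i] -> R) : continuous F ->
  continuous (p : R[i]^o -> R) -> (forall z, `|p z|%:C <= `|z|) ->
  (forall y z, p (y - z) = p y - p z) ->
  measurable_fun [set: borel G * borel G] (p \o F).
Proof.
move=> cF cp pn pB.
apply: (@measurability _ _ _ _ _ _ (@RGenOInfty.G R)).
  exact: RGenOInfty.measurableE.
move=> _ [_ [a ->] <-]; rewrite setTI.
pose e n : R := n.+1%:R^-1.
have e0 n : 0 < e n by rewrite invr_gt0 ltr0n.
have eC n : 0 < (e n)%:C by rewrite ltcR.
pose U n x := [set x' : G | forall y, `|F (x', y) - F (x, y)| < (e n)%:C].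
have nU n x : nbhs x (U n x).
  exact: (compact_near_uniform G_compact x cF (eC n)).
have /choice[s Hs] n := compact_finite_cover G_compact
  (fun x => nbhs_interior (nU n x)).
have -> : (p \o F) @^-1` `]a, +oo[ = \bigcup_n \bigcup_(x in [set` s n])
    ((U n x)^° `*` [set y | a + e n < p (F (x, y))]).
  apply/seteqP; split => [[x y]|[x y] [n _ [x0 x0s [/= /interior_subset Ux]]]].
    rewrite /= in_itv/= andbT => aF.
    (* The margin is halved because one [e n] is lost in moving [x] to the net point [x0], and
       another is the slack [a + e n] that makes the rectangles lie inside the preimage. *)
    have [n] : exists n, e n < (p (F (x, y)) - a) / 2.
      have h2 : 0 < (p (F (x, y)) - a) / 2 by rewrite divr_gt0// subr_gt0.
      have := near_infty_natSinv_lt (PosNum h2).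
      by move=> /filter_ex [n /= ?]; exists n.
    move=> en; exists n => //.
    have [x0 x0s /= Ux] := Hs n x.
    exists x0 => //; split => //=.
    have /interior_subset/(_ y) := Ux.
    move=> /(le_lt_trans (pn _)).
    rewrite ltcR pB ltr_norml => /andP[_ h].
    by move: en h; lra.
  move=> h; rewrite /= in_itv/= andbT.
  have := Ux y; move=> /(le_lt_trans (pn _)).
  rewrite ltcR pB ltr_norml => /andP[h1 _].
  by move: h h1; lra.
apply: bigcup_measurable => n _; apply: fin_bigcup_measurable.
  exact: finite_seq.
move=> x _; apply: measurableX.
  by apply: measurable_open; exact: open_interior.
apply: measurable_open.
have H : continuous (fun y => p (F (x, y))).
  move=> y; apply: continuous_comp; last exact: cp.
  exact: continuousC_partial.
rewrite (_ : [set _ | _] = (fun y => p (F (x, y))) @^-1` `]a + e n, +oo[).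
  by move/continuousP : H; apply; exact: interval_open.
by apply/seteqP; split=> y /=; rewrite in_itv/= andbT.
Qed.

(** The functional [p] stands for both the real and the imaginary part, so that the complex
    statement follows from a single argument. *)
Let Fubini_part (F : G * G -> R[i]^o) (p : R[i] -> R) : continuous F ->
  continuous (p : R[i]^o -> R) -> (forall z, `|p z|%:C <= `|z|) ->
  (forall y z, p (y - z) = p y - p z) ->
  (forall f : G -> R[i]^o, continuous f ->
    mu.-integrable [set: borel G] (EFin \o (p \o f))) ->
  \int[mu]_x \int[mu]_y p (F (x, y)) = \int[mu]_y \int[mu]_x p (F (x, y)).
Proof.
move=> cF cp pn pB ip.
have iF : (mu \x mu)%E.-integrable [set: borel G * borel G] (EFin \o (p \o F)).
  apply: measurable_bounded_integrable => //.
  - apply: (@le_lt_trans _ _ 1%E); last exact: ltry.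
    by rewrite -(probability_setT (mu \x mu)%E).
  - exact: measurable_continuous_prod.
  have cGG : compact [set: G * G] by rewrite -setXTT; exact: compact_setX.
  have [M _ FM] := compact_continuous_bounded cGG cF.
  exists M; split; first exact: num_real.
  move=> y My [x x'] _ /=; apply: le_trans (ltW My).
  by rewrite -lecR; apply: le_trans (FM (x, x')); exact: pn.
have := Fubini iF => /= E.
have c1 x : continuous (fun y => F (x, y)) by exact: continuousC_partial.
have c2 y : continuous (fun x => F (x, y)).
  move=> x; apply: (@continuous_comp _ _ _ (fun x => (x, y))); last exact: cF.
  by apply: cvg_pair => /=; [exact: cvg_id|exact: cvg_cst].
rewrite /Rintegral; congr fine; etransitivity; last (etransitivity; first exact: E).
  apply: eq_integral => x _ /=.
  by rewrite fineK//; apply: integrable_fin_num => //; exact: (ip _ (c1 x)).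
apply: eq_integral => y _ /=.
by rewrite fineK//; apply: integrable_fin_num => //; exact: (ip _ (c2 y)).
Qed.

Lemma normc_ge_Im (z : R[i]) : `|complex.Im z|%:C <= `|z|.
Proof.
case: z => a b; have := normc_ge_Re ((a +i* b) * (-'i)).
have -> : `|(a +i* b) * (-'i)| = `|a +i* b|.
  rewrite normrM normrN [X in _ * X]normc_def/= expr0n add0r expr1n.
  by rewrite sqrtr1 mulr1.
by congr (`|_|%:C <= _) => /=; ring.
Qed.

Lemma Cintegral_Fubini (F : G * G -> R[i]^o) : continuous F ->
  Cintegral mu (fun x : borel G => Cintegral mu (fun y : borel G => F (x, y))) =
  Cintegral mu (fun y : borel G => Cintegral mu (fun x : borel G => F (x, y))).
Proof.
move=> cF; rewrite /Cintegral/=; congr (_ +i* _).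
  apply: Fubini_part => //.
  - exact: continuous_Re.
  - exact: normc_ge_Re.
  - by move=> [? ?] [? ?].
  - by move=> f /Cintegrable_continuous[].
apply: Fubini_part => //.
- exact: continuous_Im.
- exact: normc_ge_Im.
- by move=> [? ?] [? ?].
- by move=> f /Cintegrable_continuous[].
Qed.

(** Invariance under inversion comes from integrating [f (x - y)] in both orders: after a
    translation the inner integral is that of [f (- y)] in one order and that of [f] in the
    other. *)
Lemma Cintegral_opp f : continuous f ->
  Cintegral mu (fun x : borel G => f (- x : G)) = Cintegral mu f.
Proof.
move=> cf; have := Cintegral_Fubini (continuous_diff cf) => /= E.
transitivity (Cintegral mu (fun x : borel G =>
    Cintegral mu (fun y : borel G => f (x - y : G)))).
  rewrite -[LHS]Cintegral_cst; congr Cintegral; apply/funext => x.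
  rewrite -(Cintegral_shift x (f := fun y => f (x - y))); last first.
    exact: continuous_flip.
  by congr Cintegral; apply/funext => y; rewrite opprD addrA subrr add0r.
rewrite E -[RHS]Cintegral_cst; congr Cintegral; apply/funext => y.
rewrite -(Cintegral_shift (- y) cf).
by congr Cintegral; apply/funext => x; rewrite addrC.
Qed.

Lemma Cintegral_flip f a : continuous f ->
  Cintegral mu (fun x : borel G => f (a - x : G)) = Cintegral mu f.
Proof.
move=> cf; rewrite -(Cintegral_shift a cf).
exact: (@Cintegral_opp (fun x => f (a + x)) (continuous_shift (a := a) cf)).
Qed.

End Haar_integral.

(** * The convolution algebra *)

Section continuous_functions.
Variables (R : realType) (G : topologicalZmodType).

Definition is_continuous : {pred G -> R[i]^o} := fun f => `[< continuous f >].

Fact is_continuous_submod : submod_closed is_continuous.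
Proof.
split=> [|a f g /asboolP cf /asboolP cg]; apply/asboolP.
  exact: (@continuous_cst R G 0).
have caf : continuous (fun x => a * f x : R[i]^o).
  exact: (continuousCM (@continuous_cst R G a) cf).
exact: (continuousCD caf cg).
Qed.

HB.instance Definition _ := GRing.isSubmodClosed.Build R[i] (G -> R[i]^o)
  is_continuous is_continuous_submod.

(** Continuous functions take the place of [L^2]: convolution does not leave them, and their values
    at points are meaningful, above all the value at [0]. *)
Record cfun := CFunPred {
  cfun_fun :> G -> R[i]^o ; _ : cfun_fun \in is_continuous }.

HB.instance Definition _ := [isSub for cfun_fun].
HB.instance Definition _ := [Choice of cfun by <:].
HB.instance Definition _ := [SubChoice_isSubLmodule of cfun by <:].

Implicit Types f g h : cfun.

Lemma cfun_continuous f : continuous f.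
Proof. by apply/asboolP; case: f. Qed.

Fact cfun_subproof (f : G -> R[i]^o) : continuous f -> f \in is_continuous.
Proof. by move=> cf; apply/asboolP. Qed.

Definition CFun (f : G -> R[i]^o) (cf : continuous f) : cfun :=
  CFunPred (cfun_subproof cf).

Lemma cfunP f g : (forall x, f x = g x) -> f = g.
Proof. by move=> fg; apply: val_inj; apply/funext. Qed.

Lemma cfunE0 x : (0 : cfun) x = 0. Proof. by []. Qed.
Lemma cfunED f g x : (f + g) x = f x + g x. Proof. by []. Qed.
Lemma cfunEN f x : (- f) x = - f x. Proof. by []. Qed.
Lemma cfunEB f g x : (f - g) x = f x - g x. Proof. by []. Qed.
Lemma cfunEZ a f x : (a *: f) x = a * f x. Proof. by []. Qed.

Lemma cfunE_sum (I : Type) (s : seq I) (F : I -> cfun) x :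
  (\sum_(i <- s) F i) x = \sum_(i <- s) F i x.
Proof.
elim: s => [|i s IH]; first by rewrite !big_nil.
by rewrite !big_cons cfunED IH.
Qed.


Definition cconst a : cfun := CFun (@continuous_cst R G a).
Definition cmul f g : cfun :=
  CFun (continuousCM (@cfun_continuous f) (@cfun_continuous g)).
Definition cconj f : cfun := CFun (continuousCJ (@cfun_continuous f)).
Definition cshift a f : cfun :=
  CFun (continuous_shift (a := a) (@cfun_continuous f)).
Definition cflip a f : cfun :=
  CFun (continuous_flip (a := a) (@cfun_continuous f)).
(** The involution of the convolution algebra: convolution by [adj f] is the Hilbert space adjoint
    of convolution by [f]. *)
Definition adj f : cfun := CFun (continuousCJ (continuous_opp_arg (@cfun_continuous f))).

Lemma cconstE a x : cconst a x = a. Proof. by []. Qed.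
Lemma cmulE f g x : cmul f g x = f x * g x. Proof. by []. Qed.
Lemma cconjE f x : cconj f x = (f x)^*. Proof. by []. Qed.
Lemma cshiftE a f x : cshift a f x = f (a + x). Proof. by []. Qed.
Lemma cflipE a f x : cflip a f x = f (a - x). Proof. by []. Qed.
Lemma adjE f x : adj f x = (f (- x))^*. Proof. by []. Qed.

Definition cfunE := (cfunE0, cfunED, cfunEB, cfunEN, cfunEZ, cfunE_sum,
  cconstE, cmulE, cconjE, cshiftE, cflipE, adjE).

Lemma adjK f : adj (adj f) = f.
Proof. by apply: cfunP => x; rewrite !cfunE opprK conjCK. Qed.

Lemma adjD f g : adj (f + g) = adj f + adj g.
Proof. by apply: cfunP => x; rewrite !cfunE rmorphD. Qed.

Lemma adjB f g : adj (f - g) = adj f - adj g.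
Proof. by apply: cfunP => x; rewrite !cfunE rmorphB. Qed.

Lemma adjZ a f : adj (a *: f) = a^* *: adj f.
Proof. by apply: cfunP => x; rewrite !cfunE rmorphM. Qed.

End continuous_functions.

Section convolution.
Variables (R : realType) (G : topologicalZmodType).
Hypothesis G_compact : compact [set: G].
Variable mu : probability (borel G) R.
Hypothesis mu_haar : translation_invariant mu.

Local Notation A := (cfun R G).
Implicit Types f g h : A.

Definition mean (f : A) : R[i] := Cintegral mu (f : borel G -> R[i]).

Let integrable_cfun f : Cintegrable mu (f : borel G -> R[i]).
Proof. exact: (Cintegrable_continuous G_compact mu (@cfun_continuous _ _ f)). Qed.

Lemma eq_mean f g : (forall x, f x = g x) -> mean f = mean g.
Proof. by move=> /cfunP ->. Qed.

Lemma meanD f g : mean (f + g) = mean f + mean g.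
Proof. exact: (CintegralD (integrable_cfun f) (integrable_cfun g)). Qed.

Lemma meanZ a f : mean (a *: f) = a * mean f.
Proof. exact: (CintegralZ a (integrable_cfun f)). Qed.

Lemma meanB f g : mean (f - g) = mean f - mean g.
Proof. by rewrite -scaleN1r meanD meanZ mulN1r. Qed.

Lemma mean_conj f : mean (cconj f) = (mean f)^*.
Proof. exact: (Cintegral_conj (integrable_cfun f)). Qed.

Lemma mean_cst a : mean (cconst G a) = a.
Proof. exact: Cintegral_cst. Qed.

Lemma mean_ge0 f : (forall x, 0 <= f x) -> 0 <= mean f.
Proof. move=> f0; exact: (Cintegral_ge0 mu (f := f : borel G -> _) f0). Qed.

Lemma mean_shift a f : mean (cshift a f) = mean f.
Proof. exact: (Cintegral_shift G_compact mu_haar a (@cfun_continuous _ _ f)). Qed.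

Lemma mean_flip a f : mean (cflip a f) = mean f.
Proof. exact: (Cintegral_flip G_compact mu_haar a (@cfun_continuous _ _ f)). Qed.

Definition dot f g : R[i] := mean (cmul f (cconj g)).

Lemma dotDl f g h : dot (f + g) h = dot f h + dot g h.
Proof. by rewrite /dot -meanD; apply: eq_mean => x; rewrite !cfunE mulrDl. Qed.

Lemma dotZl a f h : dot (a *: f) h = a * dot f h.
Proof. by rewrite /dot -meanZ; apply: eq_mean => x; rewrite !cfunE mulrA. Qed.

Lemma dotBl f g h : dot (f - g) h = dot f h - dot g h.
Proof. by rewrite -scaleN1r dotDl dotZl mulN1r. Qed.

Lemma dotC f g : dot g f = (dot f g)^*.
Proof.
rewrite /dot -mean_conj; apply: eq_mean => x.
by rewrite !cfunE rmorphM/= conjCK mulrC.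
Qed.

Lemma dotDr f g h : dot h (f + g) = dot h f + dot h g.
Proof. by rewrite dotC dotDl rmorphD/= -!dotC. Qed.

Lemma dotZr a f h : dot h (a *: f) = a^* * dot h f.
Proof. by rewrite dotC dotZl rmorphM/= -!dotC. Qed.

Lemma dotBr f g h : dot h (f - g) = dot h f - dot h g.
Proof. by rewrite dotC dotBl rmorphB/= -!dotC. Qed.

Lemma dot_ge0 f : 0 <= dot f f.
Proof. by apply: mean_ge0 => x; rewrite !cfunE; exact: mul_conjC_ge0. Qed.

Lemma dot_real f : (dot f f)^* = dot f f.
Proof. by rewrite -dotC. Qed.

Lemma dot0l f : dot 0 f = 0.
Proof. by rewrite -(scale0r 0) dotZl mul0r. Qed.

Lemma dot_norm_le (M : R[i]) f : (forall x, `|f x| ^+ 2 <= M) -> dot f f <= M.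
Proof.
move=> fM; rewrite -(mean_cst M) -subr_ge0 -meanB.
by apply: mean_ge0 => x; rewrite !cfunE subr_ge0 -normCK.
Qed.

Lemma CauchySchwarz f g : `|dot f g| ^+ 2 <= dot f f * dot g g.
Proof.
set a := dot f g; set F := dot f f; set B := dot g g.
(* This is the square norm of [b f - c g]. At this stage [dot] is only known to be semidefinite, so
   the coefficients are chosen according to which of [F] and [B] vanishes. *)
have H b c : 0 <= b * b^* * F - b * c^* * a - c * b^* * a^* + c * c^* * B.
  have := dot_ge0 (b *: f - c *: g).
  rewrite dotBl !dotBr !dotZl !dotZr (dotC f g) -/a -/F -/B.
  by congr (0 <= _); ring.
rewrite normCK.
have F0 : 0 <= F := dot_ge0 f; have B0 : 0 <= B := dot_ge0 g.
have Fr : F^* = F := dot_real f; have Br : B^* = B := dot_real g.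
have [B1|] := eqVneq B 0; last first.
  move=> Bn0; have := H B a; rewrite Br => h.
  rewrite -subr_ge0 -(pmulr_rge0 (x := B)) ?lt_def ?Bn0//.
  by move: h; congr (0 <= _); ring.
have [F1|] := eqVneq F 0; last first.
  move=> Fn0; have := H a^* F; rewrite Fr conjCK => h.
  rewrite -subr_ge0 -(pmulr_rge0 (x := F)) ?lt_def ?Fn0//.
  by move: h; congr (0 <= _); ring.
have := H 1 a; rewrite F1 B1 rmorph1 !mulr0 !mul1r mulr1 add0r addr0 => h.
rewrite -oppr_ge0 -(pmulr_rge0 (x := 2%:R)) ?ltr0n//.
by move: h; congr (0 <= _); ring.
Qed.

Fact conv_continuous f g :
  continuous (fun x => mean (cmul f (cflip x g)) : R[i]^o).
Proof.
move=> x.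
pose F (z : G * G) := f z.2 * g (z.1 - z.2).
have cF : continuous (F : _ -> R[i]^o).
  apply: (@continuousCM _ _ (fun z : G * G => f z.2) (fun z => g (z.1 - z.2))).
    exact: (continuousC_snd (@cfun_continuous _ _ f)).
  exact: (continuous_diff (@cfun_continuous _ _ g)).
apply/(@cvgrPdist_le _ R[i]^o) => e e0.
have := compact_near_uniform G_compact x cF e0.
apply: filterS => x' Hx'; rewrite -meanB.
set h := _ - _.
have hE y : `|h y| ^+ 2 <= e ^+ 2.
  have -> : h y = - (F (x', y) - F (x, y)) by rewrite /h cfunE opprB.
  by rewrite normrN lerXn2r ?nnegrE ?normr_ge0 ?ltW// Hx'.
(* Pairing with the constant [1] bounds the modulus of a mean by a quadratic mean. *)
have h1 : `|mean h| ^+ 2 <= e ^+ 2.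
  have := CauchySchwarz h (cconst G 1).
  have -> : dot h (cconst G 1) = mean h.
    by apply: eq_mean => y; rewrite !cfunE conjC1 mulr1.
  have -> : dot (cconst G 1) (cconst G 1) = 1.
    by rewrite -[RHS](mean_cst 1); apply: eq_mean => y; rewrite !cfunE conjC1 mulr1.
  by rewrite mulr1 => /le_trans; apply; exact: dot_norm_le.
by rewrite -(ler_pXn2r (n := 2))// ?nnegrE ?normr_ge0 ?ltW.
Qed.

Definition conv f g : A := CFun (@conv_continuous f g).

Lemma convE f g x : conv f g x = mean (cmul f (cflip x g)). Proof. by []. Qed.

Lemma convDl f g h : conv (f + g) h = conv f h + conv g h.
Proof.
apply: cfunP => x; rewrite cfunE !convE -meanD; apply: eq_mean => y.
by rewrite !cfunE mulrDl.
Qed.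

Lemma convZl a f g : conv (a *: f) g = a *: conv f g.
Proof.
apply: cfunP => x; rewrite cfunE !convE -meanZ; apply: eq_mean => y.
by rewrite !cfunE mulrA.
Qed.

Lemma convC f g : conv f g = conv g f.
Proof.
apply: cfunP => x; rewrite !convE -(mean_flip x (cmul f (cflip x g))).
by apply: eq_mean => y; rewrite !cfunE subKr mulrC.
Qed.

Lemma convDr f g h : conv h (f + g) = conv h f + conv h g.
Proof. by rewrite convC convDl !(convC h). Qed.

Lemma convZr a f g : conv f (a *: g) = a *: conv f g.
Proof. by rewrite convC convZl !(convC f). Qed.

Lemma convBl f g h : conv (f - g) h = conv f h - conv g h.
Proof. by rewrite -scaleN1r convDl convZl scaleN1r. Qed.

Lemma convBr f g h : conv h (f - g) = conv h f - conv h g.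
Proof. by rewrite convC convBl !(convC h). Qed.

Lemma convA f g h : conv f (conv g h) = conv (conv f g) h.
Proof.
apply: cfunP => x; rewrite !convE.
pose F (z : G * G) := (f z.2 * g (z.1 - z.2)) * h (x - z.1) : R[i]^o.
have cF : continuous F.
  apply: (@continuousCM _ _ (fun z : G * G => f z.2 * g (z.1 - z.2))
    (fun z => h (x - z.1))).
    apply: (@continuousCM _ _ (fun z : G * G => f z.2) (fun z => g (z.1 - z.2))).
      exact: (continuousC_snd (@cfun_continuous _ _ f)).
    exact: (continuous_diff (@cfun_continuous _ _ g)).
  exact: (continuousC_fst (continuous_flip (a := x) (@cfun_continuous _ _ h))).
have := Cintegral_Fubini G_compact mu cF.
rewrite /F/= => E; transitivity (Cintegral mu (fun y : borel G =>
    Cintegral mu (fun z : borel G => f y * g (z - y : G) * h (x - z : G)))).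
  congr Cintegral; apply/funext => y.
  transitivity (f y * mean (cmul g (cflip (x - y) h))); first by [].
  rewrite -meanZ -(mean_shift (- y)).
  transitivity (mean (f y *: cmul (cshift (- y) g) (cflip x h))).
    apply: eq_mean => z; rewrite !cfunE; congr (_ * (_ * h _)).
    by rewrite opprD opprK addrA subrK.
  congr Cintegral; apply/funext => z; rewrite !cfunE mulrA.
  by congr (_ * g _ * _); rewrite addrC.
rewrite -E; congr Cintegral; apply/funext => z.
transitivity (mean (cmul f (cflip z g)) * h (x - z)); last by [].
rewrite mulrC -meanZ; congr Cintegral; apply/funext => y.
by rewrite !cfunE mulrC.
Qed.

(** The value at [0] is the trace of the convolution algebra, and [dot] is its trace form. *)
Lemma conv0E f g : conv f g 0 = dot f (adj g).
Proof.
rewrite convE; apply: eq_mean => y; congr (_ * _).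
by rewrite !cfunE conjCK sub0r.
Qed.

Lemma adj_conv f g : adj (conv f g) = conv (adj f) (adj g).
Proof.
apply: cfunP => x; rewrite adjE !convE -mean_conj -(mean_flip 0).
apply: eq_mean => y; rewrite !cfunE rmorphM/= !sub0r; congr (_ * (g _)^*).
by rewrite opprK opprD opprK.
Qed.

(** Cauchy-Schwarz at each point, since translations and reflections preserve the mean. This gain of
    regularity makes uniform estimates out of [L^2] ones. *)
Lemma conv_le f g x : `|conv f g x| ^+ 2 <= dot f f * dot g g.
Proof.
have -> : conv f g x = dot f (cconj (cflip x g)).
  by rewrite convE; apply: eq_mean => y; rewrite !cfunE conjCK.
apply: le_trans (CauchySchwarz _ _) _; apply: ler_wpM2l; first exact: dot_ge0.
rewrite le_eqVlt; apply/orP; left; apply/eqP.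
rewrite /dot -(mean_flip x (cmul g _)); apply: eq_mean => y.
by rewrite !cfunE conjCK mulrC.
Qed.

Lemma dot_conv_le f g : dot (conv f g) (conv f g) <= dot f f * dot g g.
Proof. by apply: dot_norm_le => x; exact: conv_le. Qed.

(* Finitely many translates of [U] cover [G], so [U] has positive measure. *)
Lemma dot_support (U : set G) : nbhs (0 : G) U ->
  exists2 m : R, 0 < m & forall f (c : R), 0 <= c ->
    (forall x, U x -> c%:C <= `|f x| ^+ 2) -> (c * m)%:C <= dot f f.
Proof.
move=> nU; pose V : set (borel G) := U^°.
have oV : open V by exact: open_interior.
have mV : measurable (V : set (borel G)) by exact: measurable_open.
exists (fine (mu V)).
  rewrite fine_gt0//; apply/andP; split; last first.
    by apply: (@le_lt_trans _ _ 1%E); [exact: probability_le1|exact: ltry].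
  rewrite lt0e measure_ge0 andbT; apply/eqP => V0.
  pose W (x : G) := [set y | V (- x + y)].
  have oW x : open (W x).
    have H : continuous (fun y : G => - x + y).
      move=> y; apply: (@continuous_comp _ _ _ (fun y => (- x, y))
          (fun z : G * G => z.1 + z.2)).
        by apply: cvg_pair => /=; [exact: cvg_cst|exact: cvg_id].
      exact: add_continuous.
    by move/continuousP : H; exact.
  have nW x : nbhs x (W x).
    apply: open_nbhs_nbhs; split; first exact: oW.
    by rewrite /W /= addNr; exact: nbhs_singleton (nbhs_interior nU).
  have [s Hs] := compact_finite_cover G_compact nW.
  have mW x : measurable (W x : set (borel G)) by exact: measurable_open.
  have W0 x : mu (W x) = 0%E.
    rewrite -V0 -(mu_haar x mV); congr (mu _).
    apply/seteqP; split=> [y Vy|y [z Vz <-]].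
      by exists (- x + y) => //; rewrite addrA subrr add0r.
    by rewrite /W /= addrA addNr add0r.
  have nC (t : seq G) : mu.-negligible [set y : borel G | exists2 x, x \in t & W x y].
    elim: t => [|x t IH].
      by apply: (@negligibleS _ _ _ mu set0) => [y []//|]; exact: negligible_set0.
    apply: negligibleS (negligibleU ((negligibleP mu (mW x)).2 (W0 x)) IH).
    move=> y [z]; rewrite inE => /predU1P[->|zt] Wzy; first by left.
    by right; exists z.
  have nT : mu.-negligible [set: borel G].
    by apply: negligibleS (nC s) => y _; exact: Hs.
  have := etrans (esym (probability_setT mu)) ((negligibleP mu measurableT).1 nT).
  by move/eqP; apply/negP; rewrite onee_neq0.
move=> f c c0 fc.
pose h : G -> R := fun x => complex.Re (`|f x| ^+ 2).
have hE x : `|f x| ^+ 2 = (h x)%:C.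
  by apply/esym/RRe_real/ger0_real; rewrite exprn_ge0.
have hE' x : f x * (f x)^* = (h x)%:C by rewrite -hE normCK.
have [ih _] := integrable_cfun (cmul f (cconj f)).
have {}ih : mu.-integrable [set: borel G] (EFin \o h).
  apply: eq_integrable ih => // x _; congr EFin.
  by rewrite /= hE'.
have -> : dot f f = (\int[mu]_x h x)%:C.
  rewrite /dot /mean /Cintegral/=; congr (_ +i* _).
    by apply: eq_Rintegral => x _; rewrite hE'.
  under eq_Rintegral do rewrite hE'/=.
  by rewrite Rintegral_cst// mul0r.
rewrite lecR.
have -> : c * fine (mu V) = \int[mu]_x (c * \1_V x).
  rewrite RintegralZl//; last exact: integrable_indic.
  congr (_ * _); rewrite /Rintegral integral_indic//; last first.
    by rewrite setIT.
apply: le_Rintegral => //.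
  have := integrableZl measurableT c (integrable_indic mu mV).
  by apply: eq_integrable.
move=> x _; rewrite indicE; case: (boolP (x \in V)) => xV; last first.
  by rewrite mulr0 -ler0c -hE exprn_ge0.
rewrite mulr1 -lecR -hE; apply: fc.
by apply: interior_subset; rewrite inE in xV.
Qed.

Lemma dot_eq0 f : dot f f = 0 -> f = 0.
Proof.
move=> f0; apply: cfunP => a; rewrite cfunE.
apply: contrapT => /eqP fa.
(* The lower bound [dot_support] concerns neighbourhoods of [0], so the point [a] where [f] does not
   vanish is moved there; near it the modulus stays above half its value. *)
pose g := cshift a f.
have g0 : dot g g = 0 by rewrite -f0 -[RHS](mean_shift a); exact: eq_mean.
have e0 : 0 < `|f a| / 2 by rewrite divr_gt0 ?normr_gt0.
pose U := [set x | `|g 0 - g x| < `|f a| / 2].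
have nU : nbhs (0 : G) U.
  have := @cfun_continuous _ _ g (0 : G).
  by move/(@cvgrPdist_lt _ R[i]^o); exact.
have [m m0 /(_ g)] := dot_support nU.
pose c := complex.Re (`|f a| / 2); move=> /(_ (c ^+ 2)).
have cE : c%:C = `|f a| / 2 by apply/RRe_real/ger0_real/ltW.
move=> /(_ (sqr_ge0 c)) H; suff : (c ^+ 2 * m)%:C <= 0.
  rewrite -(rmorph0 (real_complex R)) lecR; apply/negP.
  by rewrite -ltNge mulr_gt0// exprn_gt0// -ltcR cE.
rewrite -g0; apply: H => x Ux.
rewrite rmorphXn/= cE lerXn2r ?nnegrE ?normr_ge0 ?(ltW e0)//.
have h1 : `|f a| <= `|g 0 - g x| + `|g x|.
  have {1}-> : f a = (g 0 - g x) + g x by rewrite subrK /g cfunE addr0.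
  exact: ler_normD.
have h2 : `|g 0 - g x| < `|f a| / 2 by [].
by have := lerB h1 (ltW h2); rewrite {1}(splitr `|f a|) addrK addrAC subrr add0r.
Qed.

End convolution.

(** * Power iteration and idempotents *)

Section uniform_limits.
Variables (R : realType) (G : topologicalZmodType).
Local Notation A := (cfun R G).
Implicit Types (v : nat -> A) (f g : A).

Definition ucvg v f := forall e : R, 0 < e ->
  exists N, forall n, (N <= n)%N -> forall x, `|v n x - f x| <= e%:C.

Lemma cauchy_real (u : nat -> R) :
  (forall e : R, 0 < e -> exists N, forall n k, (N <= n)%N -> (N <= k)%N ->
    `|u n - u k| <= e) ->
  exists l, forall e : R, 0 < e -> exists N, forall n, (N <= n)%N ->
    `|u n - l| <= e.
Proof.
move=> cu; have : cvg (u @ \oo).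
  apply/cauchy_cvgP/cauchy_exP => e e0.
  have [N HN] := cu _ (divr_gt0 e0 (ltr0n R 2)).
  exists (u N); exists N => // n /= Nn.
  rewrite /ball/=; apply: (le_lt_trans (HN _ _ (leqnn N) Nn)).
  by rewrite ltr_pdivrMr// ltr_pMr// ltr1n.
move=> /cvg_ex[l ul]; exists l => e e0.
have /cvgrPdist_le/(_ _ e0)[N _ HN] := ul.
by exists N => n Nn; rewrite distrC; exact: HN.
Qed.

Lemma normc_le_Re_Im (z : R[i]) :
  `|z| <= (`|complex.Re z| + `|complex.Im z|)%:C.
Proof.
rewrite {1}(complexE z); apply: le_trans (ler_normD _ _) _.
rewrite normrM [X in _ + X * _ <= _](_ : _ = 1); last first.
  by rewrite normc_def/= expr0n add0r expr1n sqrtr1.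
rewrite mul1r rmorphD/= !normc_def/= !expr0n !addr0 !sqrtr_sqr.
exact: lexx.
Qed.

Lemma cfun_complete v :
  (forall e : R, 0 < e -> exists N, forall n k, (N <= n)%N -> (N <= k)%N ->
    forall x, `|v n x - v k x| <= e%:C) ->
  exists f, ucvg v f.
Proof.
move=> cv.
have cRe x : exists l, forall e : R, 0 < e -> exists N, forall n, (N <= n)%N ->
    `|complex.Re (v n x) - l| <= e.
  apply: cauchy_real => e /cv[N HN]; exists N => n k Nn Nk.
  have := HN _ _ Nn Nk x; move=> /(le_trans (normc_ge_Re _)); rewrite lecR.
  by case: (v n x) (v k x) => [? ?] [? ?].
have cIm x : exists l, forall e : R, 0 < e -> exists N, forall n, (N <= n)%N ->
    `|complex.Im (v n x) - l| <= e.
  apply: cauchy_real => e /cv[N HN]; exists N => n k Nn Nk.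
  have := HN _ _ Nn Nk x; move=> /(le_trans (normc_ge_Im _)); rewrite lecR.
  by case: (v n x) (v k x) => [? ?] [? ?].
have [a Ha] := choice cRe; have [b Hb] := choice cIm.
pose f x : R[i]^o := a x +i* b x.
have vf x (e : R) : 0 < e -> exists N, forall n, (N <= n)%N ->
    `|v n x - f x| <= e%:C.
  move=> e0; have e2 : 0 < e / 2 by rewrite divr_gt0.
  have [N HN] := Ha x _ e2; have [M HM] := Hb x _ e2.
  exists (maxn N M) => n; rewrite geq_max => /andP[/HN h1 /HM h2].
  apply: le_trans (normc_le_Re_Im _) _; rewrite lecR [e]splitr.
  move: h1 h2; rewrite /f; case: (v n x) => p q /= h1 h2.
  exact: lerD.
have uf (e : R) : 0 < e -> exists N, forall n, (N <= n)%N -> forall x,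
    `|v n x - f x| <= e%:C.
  move=> e0; have e2 : 0 < e / 2 by rewrite divr_gt0.
  have [N HN] := cv _ e2; exists N => n Nn x.
  (* The intermediate index [M] may depend on [x]; the bound [N] does not, which makes the
     convergence uniform. *)
  have [M HM] := vf x _ e2.
  have -> : v n x - f x = (v n x - v (maxn N M) x) + (v (maxn N M) x - f x).
    by rewrite addrA subrK.
  apply: le_trans (ler_normD _ _) _.
  rewrite [e]splitr rmorphD; apply: lerD.
    by apply: HN => //; exact: leq_maxl.
  by apply: HM; exact: leq_maxr.
have cf : continuous f.
  move=> x; apply/(@cvgrPdist_le _ R[i]^o) => e e0.
  have eE : e = (complex.Re e)%:C by apply/esym/RRe_real/gtr0_real.
  have e30 : 0 < complex.Re e / 3.
    by rewrite divr_gt0//; move: e0; rewrite {1}eE -(rmorph0 (real_complex R)) ltcR.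
  have [N /(_ N (leqnn N)) HN] := uf _ e30.
  have /(@cvgrPdist_le _ R[i]^o) := @cfun_continuous _ _ (v N) x.
  move=> /(_ (complex.Re e / 3)%:C) /(_ _)/= H.
  have e3 : 0 < (complex.Re e / 3)%:C :> R[i].
    by rewrite -(rmorph0 (real_complex R)) ltcR.
  have := H e3; apply: filterS => y Hy.
  have -> : f x - f y = (v N x - v N y) + (v N y - f y) - (v N x - f x).
    by rewrite opprB; ring.
  apply: le_trans (ler_normB _ _) _.
  rewrite eE (_ : complex.Re e = complex.Re e / 3 + complex.Re e / 3 +
    complex.Re e / 3); last by field.
  rewrite !rmorphD; apply: lerD; last exact: HN.
  by apply: le_trans (ler_normD _ _) _; apply: lerD.
by exists (CFun cf).
Qed.

Lemma ucvg_unique v f g : ucvg v f -> ucvg v g -> f = g.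
Proof.
move=> vf vg; apply: cfunP => x; apply/eqP; rewrite -subr_eq0 -normr_le0.
apply/ler_addgt0Pr => e e0; rewrite add0r.
have eE : e = (complex.Re e)%:C by apply/esym/RRe_real/gtr0_real.
have e20 : 0 < complex.Re e / 2.
  by rewrite divr_gt0//; move: e0; rewrite {1}eE -(rmorph0 (real_complex R)) ltcR.
have [N HN] := vf _ e20; have [M HM] := vg _ e20.
have h1 := HN _ (leq_maxl N M) x; have h2 := HM _ (leq_maxr N M) x.
rewrite -(subrKA (v (maxn N M) x)) eE [complex.Re e]splitr rmorphD.
by apply: le_trans (ler_normD _ _) _; apply: lerD => //; rewrite distrC.
Qed.

Lemma ucvg_cst f : ucvg (fun=> f) f.
Proof.
move=> e e0; exists 0%N => n _ x; rewrite subrr normr0.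
by rewrite -(rmorph0 (real_complex R)) lecR ltW.
Qed.

Lemma ucvg_scale a v f : ucvg v f -> ucvg (fun n => a *: v n) (a *: f).
Proof.
move=> vf e e0.
have aE : `|a| = (complex.Re `|a|)%:C by apply/esym/RRe_real/ger0_real/normr_ge0.
set b := complex.Re `|a| in aE.
have b0 : 0 <= b by rewrite -lecR -aE rmorph0 normr_ge0.
have e20 : 0 < e / (b + 1) by rewrite divr_gt0// ltr_wpDl.
have [N HN] := vf _ e20; exists N => n Nn x.
rewrite !cfunE -mulrBr normrM aE.
apply: le_trans (ler_wpM2l _ (HN _ Nn x)) _.
  by rewrite -aE normr_ge0.
rewrite -rmorphM lecR mulrCA ger_pMr// ler_pdivrMr ?mul1r ?lerDl//.
by rewrite ltr_wpDl.
Qed.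

Lemma ucvg_sub (s : nat -> nat) v f : (forall n, (n <= s n)%N) -> ucvg v f ->
  ucvg (fun n => v (s n)) f.
Proof.
move=> sn vf e /vf[N HN]; exists N => n Nn; apply: HN.
exact: leq_trans Nn (sn n).
Qed.

Lemma ucvg_adj v f : ucvg v f -> ucvg (fun n => adj (v n)) (adj f).
Proof.
move=> vf e /vf[N HN]; exists N => n Nn x; rewrite !cfunE -rmorphB norm_conjC.
exact: HN.
Qed.

Hypothesis G_compact : compact [set: G].
Variable mu : probability (borel G) R.
Hypothesis mu_haar : translation_invariant mu.

Lemma ucvg_conv h v f : ucvg v f ->
  ucvg (fun n => conv G_compact mu h (v n)) (conv G_compact mu h f).
Proof.
move=> vf e e0.
have BE : dot mu h h = (complex.Re (dot mu h h))%:C.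
  by apply/esym/RRe_real/ger0_real/dot_ge0.
set b := complex.Re _ in BE.
have b0 : 0 <= b by rewrite -lecR -BE rmorph0; exact: dot_ge0.
have e20 : 0 < e / (b + 1) by rewrite divr_gt0// ltr_wpDl.
have [N HN] := vf _ e20; exists N => n Nn x.
rewrite -cfunEB -(convBr G_compact mu_haar).
rewrite -(ler_pXn2r (n := 2))// ?nnegrE ?normr_ge0//; last first.
  by rewrite -(rmorph0 (real_complex R)) lecR ltW.
apply: le_trans (conv_le G_compact mu_haar _ _ _) _.
have h1 : dot mu (v n - f) (v n - f) <= ((e / (b + 1)) ^+ 2)%:C.
  apply: (dot_norm_le G_compact) => y; rewrite rmorphXn/= lerXn2r ?nnegrE//.
    by rewrite -(rmorph0 (real_complex R)) lecR ltW.
  exact: HN.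
apply: le_trans (ler_wpM2l (dot_ge0 mu h) h1) _.
rewrite BE -rmorphM -rmorphXn lecR.
rewrite exprMn mulrCA ger_pMr ?exprn_gt0// exprVn.
by rewrite ler_pdivrMr ?exprn_gt0 ?ltr_wpDl// mul1r; nra.
Qed.

End uniform_limits.

(* For [c n = ||h^(n+1)||^2] (convolution powers), [l] is the square of the norm
   of the convolution operator by [h].  The last hypothesis is what keeps the
   normalized sequence from vanishing in the limit. *)
Lemma logconvex_growth (R : realType) (c : nat -> R) :
  (forall n, 0 < c n) -> (forall n, c n.+1 ^+ 2 <= c n * c n.+2) ->
  (forall n, c n.+1 <= c 0%N * c n) ->
  (forall n k, c (n.+1 + k)%N ^+ 2 <= c n.*2.+1 * c k ^+ 2) ->
  exists l : R, [/\ 0 < l, c 1%N <= l * c 0%N,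
    forall n, 1 <= c n / l ^+ n.+1 & cvg ((fun n => c n / l ^+ n.+1) @ \oo)].
Proof.
move=> c_gt0 c_logconvex c_le c_sq.
(* Log-convexity means that these ratios increase; their limit is the growth rate [l]. *)
pose r n := c n.+1 / c n.
have r_gt0 n : 0 < r n by rewrite divr_gt0.
have r_nondecreasing : nondecreasing_seq r.
  apply/nondecreasing_seqP => n; rewrite /r ler_pdivrMr// mulrAC ler_pdivlMr//.
  by rewrite -expr2 mulrC c_logconvex.
have r_le n : r n <= c 0%N by rewrite ler_pdivrMr.
pose l := limn r.
have r_cvg : r @ \oo --> l.
  apply: nondecreasing_is_cvgn => //.
  by exists (c 0%N) => _ [n _ <-]; exact: r_le.
have r_le_l n : r n <= l.
  by apply: nondecreasing_cvgn_le => //; apply: cvgP r_cvg.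
have l_gt0 : 0 < l by exact: lt_le_trans (r_gt0 0%N) (r_le_l 0%N).
have c_pow_le k n : r k ^+ n * c k <= c (n + k)%N.
  elim: n => [|n IH]; first by rewrite expr0 mul1r.
  rewrite exprS -mulrA; apply: le_trans (ler_wpM2l (ltW (r_gt0 k)) IH) _.
  by rewrite -ler_pdivlMr// addSn; apply: r_nondecreasing; exact: leq_addl.
(* From index [k] on, [c] grows at least by the factor [r k] at each step. In the last hypothesis
   the factor [c k ^+ 2] then cancels, and [k] can go to infinity with [n] fixed. *)
have l_pow_le n : l ^+ (n.+1).*2 <= c n.*2.+1.
  have H k : r k ^+ (n.+1).*2 <= c n.*2.+1.
    have := le_trans (_ : (r k ^+ n.+1 * c k) ^+ 2 <= _) (c_sq n k).
    rewrite lerXn2r ?nnegrE ?c_pow_le ?mulr_ge0 ?exprn_ge0 ?(ltW (r_gt0 _)) ?(ltW (c_gt0 _))//.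
    move=> /(_ isT).
    by rewrite exprMn -exprM muln2 ler_pM2r ?exprn_gt0.
  have rX : (fun k => r k ^+ (n.+1).*2) @ \oo --> l ^+ (n.+1).*2.
    exact: (@continuous_cvg _ _ _ _ _ r (fun x => x ^+ (n.+1).*2) l
      (@exprn_continuous R _ l) r_cvg).
  by apply: (cvgr_to_le rX); apply: nearW.
have a_nonincreasing : nonincreasing_seq (fun n => c n / l ^+ n.+1).
  apply/nonincreasing_seqP => n; rewrite [in leLHS]exprS invfM mulrA.
  rewrite ler_wpM2r ?invr_ge0 ?exprn_ge0 ?(ltW l_gt0)//.
  by rewrite ler_pdivrMr// mulrC -ler_pdivrMr//; exact: r_le_l.
(* The lower bound is known at odd indices only; a nonincreasing sequence inherits it from the later
   index [n.*2.+1]. *)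
have a_ge1 n : 1 <= c n / l ^+ n.+1.
  apply: (le_trans (y := c n.*2.+1 / l ^+ n.*2.+2)).
    by rewrite ler_pdivlMr ?exprn_gt0// mul1r; exact: l_pow_le.
  by apply: a_nonincreasing; rewrite -addnn; lia.
exists l; split=> //; first by have := r_le_l 0%N; rewrite /r ler_pdivrMr.
apply: nonincreasing_is_cvgn => //.
by exists 1 => _ [n _ <-]; exact: a_ge1.
Qed.

Section spectral_projection.
Variables (R : realType) (G : topologicalZmodType).
Hypothesis G_compact : compact [set: G].
Variable mu : probability (borel G) R.
Hypothesis mu_haar : translation_invariant mu.

Local Notation A := (cfun R G).
Local Notation "f ** g" := (conv G_compact mu f g) (at level 40, left associativity).
Local Notation dot := (dot mu).
Definition sqnorm (f : A) : R := complex.Re (dot f f).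

Lemma sqnormE (f : A) : dot f f = (sqnorm f)%:C.
Proof. by apply/esym/RRe_real/ger0_real/dot_ge0. Qed.

Lemma sqnorm_ge0 (f : A) : 0 <= sqnorm f.
Proof. by rewrite -lecR rmorph0 -sqnormE dot_ge0. Qed.

Lemma sqnorm_gt0 (f : A) : f != 0 -> 0 < sqnorm f.
Proof.
move=> f0; rewrite lt_neqAle sqnorm_ge0 andbT eq_sym.
apply: contra f0 => /eqP f0; apply/eqP; apply: (dot_eq0 G_compact mu_haar).
by rewrite sqnormE f0.
Qed.

Variable h : A.
Hypotheses (h_adj : adj h = h) (h_neq0 : h != 0).

(** [cpow n] is the power of exponent [n.+1]: the algebra need not have a unit, so the powers start
    at [h]. *)
Fixpoint cpow n : A := if n is m.+1 then h ** cpow m else h.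

Lemma cpow_adj n : adj (cpow n) = cpow n.
Proof. by elim: n => //= n IH; rewrite (adj_conv G_compact mu_haar) h_adj IH. Qed.

Lemma conv_cpow i j : cpow i ** cpow j = cpow (i + j).+1.
Proof. by elim: i => //= i IH; rewrite -(convA G_compact mu_haar) IH. Qed.

Lemma dot_cpow i j : dot (cpow i) (cpow j) = cpow (i + j).+1 0.
Proof. by rewrite -conv_cpow (conv0E G_compact) cpow_adj. Qed.

(** As [h] is self-adjoint, the inner product of two powers depends only on the sum of the
    exponents; when this sum is even it is a square norm. *)
Lemma dot_cpowE i j n : (i + j = n.*2)%N ->
  dot (cpow i) (cpow j) = (sqnorm (cpow n))%:C.
Proof. by move=> ijn; rewrite dot_cpow ijn -addnn -dot_cpow sqnormE. Qed.

Lemma sqr_Re_dot_le (f g : A) (x : R) :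
  dot f g = x%:C -> x ^+ 2 <= sqnorm f * sqnorm g.
Proof.
move=> fgx; have := CauchySchwarz G_compact mu f g.
rewrite fgx !sqnormE -rmorphM normc_def/= expr0n addr0 sqrtr_sqr -rmorphXn lecR.
by rewrite real_normK ?num_real.
Qed.

Lemma sqnorm_conv_le (f g : A) : sqnorm (f ** g) <= sqnorm f * sqnorm g.
Proof.
rewrite -lecR rmorphM/= -!sqnormE; exact: (dot_conv_le G_compact mu_haar).
Qed.

Lemma cpow_growth : exists l : R, [/\ 0 < l,
  sqnorm (cpow 1) <= l * sqnorm h,
  forall n, 1 <= sqnorm (cpow n) / l ^+ n.+1
  & cvg ((fun n => sqnorm (cpow n) / l ^+ n.+1) @ \oo)].
Proof.
have logconvex n : sqnorm (cpow n.+1) ^+ 2 <= sqnorm (cpow n) * sqnorm (cpow n.+2).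
  by apply: sqr_Re_dot_le; apply: dot_cpowE; rewrite -addnn; lia.
apply: (logconvex_growth (c := fun n => sqnorm (cpow n))).
- have c0 : 0 < sqnorm (cpow 0) by exact: sqnorm_gt0.
  (* The power [h ** h] takes at [0] the value [sqnorm h], which is positive; log-convexity carries
     positivity from there to all further powers. *)
  have c1 : 0 < sqnorm (cpow 1).
    apply: sqnorm_gt0; apply/eqP => h1.
    have := dot_cpow 0 0; rewrite h1 sqnormE cfunE.
    by move=> /(congr1 (@complex.Re R)) /= E; move: c0; rewrite /= E ltxx.
  move=> n; suff : 0 < sqnorm (cpow n) /\ 0 < sqnorm (cpow n.+1) by case.
  elim: n => [|n [IH1 IH2]]; first by split.
  split; first exact: IH2.
  have := lt_le_trans (exprn_gt0 2 IH2) (logconvex n).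
  by rewrite pmulr_rgt0.
- exact: logconvex.
- by move=> n; exact: sqnorm_conv_le.
(* The middle power is the inner product of [cpow n.*2.+1 ** cpow k] with [cpow k]; Cauchy-Schwarz
   and submultiplicativity give the bound. *)
- move=> n k; rewrite [X in _ <= _ * X]expr2 mulrA.
  have := @sqr_Re_dot_le (cpow n.*2.+1 ** cpow k) (cpow k)
    (sqnorm (cpow (n.+1 + k)%N)).
  move=> /(_ _)/le_trans; apply.
    by rewrite conv_cpow; apply: dot_cpowE; rewrite -!addnn; lia.
  by apply: ler_wpM2r; [exact: sqnorm_ge0|exact: sqnorm_conv_le].
Qed.

(* [e] is the limit of [(h ** h)^(n+1) / l^(n+1)], the orthogonal projection on the
   top eigenspace of convolution by [h ** h]. *)
Lemma top_projection : exists l : R, exists e : A,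
  [/\ 0 < l, e != 0, adj e = e, e ** e = e &
   [/\ h ** h ** e = l%:C *: e,
    sqnorm (h ** h) <= l * sqnorm h
    & forall p, p ** h = h -> p ** e = e]].
Proof.
have [l [l_gt0 l_ge a_ge1 a_cvg]] := cpow_growth.
pose a n := sqnorm (cpow n) / l ^+ n.+1.
(* [cpow n.*2.+1] is the power of exponent [2 n + 2], that is, the power [n + 1] of [h ** h]. *)
pose V n : A := (l ^+ n.+1)^-1%:C *: cpow n.*2.+1.
have conj_real (x : R) : (x%:C)^* = x%:C.
  by apply: conj_Creal; apply/complex_realP; exists x.
have dotV n k : dot (V n) (V k) = (a (n + k).+1)%:C.
  rewrite /V dotZl// dotZr// conj_real.
  rewrite (@dot_cpowE _ _ (n + k).+1); last by rewrite -!addnn; lia.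
  rewrite -!rmorphM; congr _%:C; rewrite /a mulrA -invfM -exprD mulrC.
  by rewrite addSn addnS addnC.
have VS n : cpow 1 ** V n = l%:C *: V n.+1.
  rewrite /V (convZr G_compact mu_haar) conv_cpow scalerA -rmorphM.
  congr (_%:C *: _); rewrite [in RHS]exprS invfM mulrA divff ?mul1r//.
  by rewrite gt_eqF.
have VV n k : V n ** V k = V (n + k).+1.
  rewrite /V (convZr G_compact mu_haar) (convZl G_compact) conv_cpow scalerA -rmorphM.
  congr (_%:C *: cpow _); first by rewrite -invfM -exprD addSn addnS addnC.
  by rewrite -!addnn; lia.
(* Inner products of the [V n] depend only on the sum of the indices and converge, so the sequence
   is Cauchy in [L^2]; one more convolution by [h ** h] makes it uniformly Cauchy. *)
have V_cauchy (e : R) : 0 < e -> exists N, forall n k, (N <= n)%N -> (N <= k)%N ->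
    forall x, `|V n x - V k x| <= e%:C.
  move=> e0; pose K := sqnorm (cpow 1) + 1.
  have K_gt0 : 0 < K by rewrite ltr_wpDl// sqnorm_ge0.
  (* Four terms [a _], each within [d] of the limit, give the square distance [4 * d]; the
     convolution multiplies it by less than [K], and the normalization by [l ^- 2]. *)
  pose d := (e * l) ^+ 2 / (4 * K).
  have d_gt0 : 0 < d by rewrite divr_gt0 ?exprn_gt0 ?mulr_gt0.
  have /cvg_ex[m am] := a_cvg.
  have /cvgrPdist_le/(_ _ d_gt0)[N _ HN] := am.
  have {}HN n : (N <= n)%N -> `|m - a n| <= d by move=> Nn; exact: HN.
  (* Indices are positive because [V n.+1] is [h ** h] applied to [V n], up to the factor [l]. *)
  exists N.+1 => -[//|n] [//|k] Nn Nk x.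
  have dVV : dot (V n - V k) (V n - V k) = (a (n + n).+1 + a (k + k).+1 -
      a (n + k).+1 - a (n + k).+1)%:C.
    rewrite dotBl// !dotBr// !dotV (addnC k n) !rmorphB !rmorphD; ring.
  have dle : dot (V n - V k) (V n - V k) <= (4 * d)%:C.
    rewrite dVV lecR.
    have := HN (n + n).+1; have := HN (k + k).+1; have := HN (n + k).+1.
    have Nnn : (N <= (n + n).+1)%N by lia.
    have Nkk : (N <= (k + k).+1)%N by lia.
    have Nnk : (N <= (n + k).+1)%N by lia.
    move=> /(_ Nnk) + /(_ Nkk) + /(_ Nnn).
    rewrite !ler_norml => /andP[? ?] /andP[? ?] /andP[? ?]; lra.
  have VE : V n.+1 x - V k.+1 x = l^-1%:C * (cpow 1 ** (V n - V k)) x.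
    rewrite (convBr G_compact mu_haar) !VS -scalerBr !cfunE mulrA -rmorphM.
    by rewrite mulVf ?gt_eqF// mul1r.
  rewrite -(ler_pXn2r (n := 2))// ?nnegrE ?normr_ge0//; last first.
    by rewrite -(rmorph0 (real_complex R)) lecR ltW.
  rewrite VE normrM exprMn.
  apply: le_trans (ler_wpM2l _ (conv_le G_compact mu_haar _ _ _)) _.
    by rewrite exprn_ge0.
  apply: le_trans (ler_wpM2l _ (ler_wpM2l (dot_ge0 _ _) dle)) _.
    by rewrite exprn_ge0.
  rewrite sqnormE normc_def/= expr0n addr0 sqrtr_sqr ger0_norm ?invr_ge0 ?(ltW l_gt0)//.
  rewrite -!rmorphXn -!rmorphM lecR.
  have K_neq0 : K != 0 by rewrite gt_eqF.
  have l_neq0 : l != 0 by rewrite gt_eqF.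
  have dE t : l^-1 ^+ 2 * (t * (4 * d)) = e ^+ 2 * (t / K).
    by rewrite /d; field; rewrite l_neq0 K_neq0.
  rewrite dE.
  by rewrite ler_piMr ?sqr_ge0// ler_pdivrMr// mul1r lerDl.
have [e Ve] := cfun_complete V_cauchy.
exists l, e; split => //.
(* The value of [V n] at [0] is [a n], which is at least [1], so the limit cannot vanish. *)
- apply/eqP => e0; have := Ve _ (divr_gt0 ltr01 (ltr0n R 2)).
  move=> [N /(_ N (leqnn N) 0)]; rewrite e0 cfunE subr0.
  rewrite cfunE -addnn -dot_cpow sqnormE -rmorphM normc_def/= expr0n addr0 sqrtr_sqr.
  rewrite lecR mulrC ger0_norm; last exact: (le_trans _ (a_ge1 _)).
  by move=> /(le_trans (a_ge1 _)); rewrite leNgt ltr_pdivrMr// mul1r ltr1n.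
- have := ucvg_adj Ve; rewrite (_ : (fun n => adj (V n)) = V).
    by move=> /(ucvg_unique Ve).
  by apply/funext => n; rewrite adjZ cpow_adj conj_real.
- have Ve' n : V n ** e = e.
    apply: (ucvg_unique (ucvg_conv G_compact mu_haar (V n) Ve)).
    rewrite (_ : (fun _ => _) = fun k => V (n + k).+1); last exact/funext.
    by apply: (ucvg_sub (s := fun k => (n + k).+1)) => // k; lia.
  apply: (ucvg_unique (ucvg_conv G_compact mu_haar e Ve)).
  rewrite (_ : (fun _ => _) = fun=> e); first exact: ucvg_cst.
  by apply/funext => n; rewrite (convC G_compact mu_haar) Ve'.
split.
- apply: (ucvg_unique (ucvg_conv G_compact mu_haar (h ** h) Ve)).
  rewrite (_ : (fun _ => _) = fun n => l%:C *: V n.+1); last first.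
    by apply/funext => n; rewrite -VS.
  by apply: ucvg_scale; apply: (ucvg_sub (s := S)).
- exact: l_ge.
- move=> p ph; apply: (ucvg_unique (ucvg_conv G_compact mu_haar p Ve)).
  rewrite (_ : (fun _ => _) = V)//; apply/funext => n.
  rewrite /V (convZr G_compact mu_haar); congr (_ *: _).
  by rewrite /= (convA G_compact mu_haar) ph.
Qed.

End spectral_projection.

(** * Characters from minimal idempotents *)

Section characters.
Variables (R : realType) (G : topologicalZmodType).

Definition cchar (chi : dual R G) : cfun R G := CFun (@char_continuous R G chi).

Lemma ccharE chi x : cchar chi x = chi x. Proof. by []. Qed.

Lemma charN (chi : dual R G) x : chi (- x) = (chi x)^*.
Proof.
apply: (mulfI (char_neq0 chi x)); rewrite -charD subrr char0.
by rewrite -normCK char_norm expr1n.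
Qed.

Lemma cchar_adj chi : adj (cchar chi) = cchar chi.
Proof. by apply: cfunP => x; rewrite adjE !ccharE charN conjCK. Qed.

Hypothesis G_compact : compact [set: G].
Variable mu : probability (borel G) R.
Hypothesis mu_haar : translation_invariant mu.

Local Notation A := (cfun R G).
Local Notation "f ** g" := (conv G_compact mu f g) (at level 40, left associativity).
Local Notation dot := (dot mu).
Local Notation sqnorm := (sqnorm mu).
Local Notation cA := (convA G_compact mu_haar).
Local Notation cC := (convC G_compact mu_haar).

Lemma conv_shift a (f g : A) : f ** cshift a g = cshift a (f ** g).
Proof.
apply: cfunP => x; rewrite cshiftE !convE; apply: eq_mean => y.
by rewrite !cfunE addrA.
Qed.

Lemma conv_cchar (f : A) chi : f ** cchar chi = dot f (cchar chi) *: cchar chi.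
Proof.
apply: cfunP => x; rewrite cfunEZ mulrC /dot -(meanZ G_compact) convE.
by apply: eq_mean => y; rewrite !cfunE !ccharE charD charN mulrCA.
Qed.

Definition idempotent_cfun (e : A) := adj e = e /\ e ** e = e.

Lemma idempotent_cfun0 (e : A) : idempotent_cfun e -> e 0 = (sqnorm e)%:C.
Proof. by case=> ea ee; rewrite -{1}ee conv0E ea sqnormE. Qed.

(* [sqnorm e = e 0] is the dimension of the range of convolution by [e]. *)
Lemma idempotent_sqnorm_ge1 (e : A) :
  idempotent_cfun e -> e != 0 -> 1 <= sqnorm e.
Proof.
move=> [ea ee] e0.
have : dot e e <= dot e e * dot e e.
  apply: (dot_norm_le G_compact) => x; rewrite -{1}ee.
  exact: (conv_le G_compact mu_haar).
rewrite sqnormE -rmorphM lecR.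
by rewrite ler_pMl// sqnorm_gt0.
Qed.

(* Every translate of [e] is a multiple of [e], so that [e / e 0] is
   multiplicative. *)
Lemma minimal_idempotent_character (e : A) :
  idempotent_cfun e -> e != 0 ->
  (forall g, adj g = g -> e ** g = g -> exists s : R[i], g = s *: e) ->
  exists chi : dual R G, e ** cchar chi = cchar chi.
Proof.
move=> ie e_neq0 e_min; have [ea ee] := ie.
have e0E := idempotent_cfun0 ie.
have e0_gt0 : 0 < sqnorm e by exact: sqnorm_gt0.
have e00 : e 0 != 0.
  by rewrite e0E -(rmorph0 (real_complex R)) (inj_eq (@complexI R)) gt_eqF.
have shiftE y : exists s : R[i], cshift y e = s *: e.
  pose T := cshift y e; pose T' := cshift (- y) e.
  have adjT : adj T = T'.
    apply: cfunP => x; rewrite !cfunE -{2}ea adjE; congr (e _)^*.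
    by rewrite opprD opprK.
  have adjT' : adj T' = T by rewrite -adjT adjK.
  have eT : e ** T = T by rewrite conv_shift ee.
  have eT' : e ** T' = T' by rewrite conv_shift ee.
  have conji : ('i%C : R[i])^* = - 'i%C by rewrite complexiE conjCi.
  (* Minimality applies to self-adjoint elements only, hence the passage through [T + T'] and
     ['i (T - T')], from which [T] is recovered. *)
  have [s1 s1E] : exists s : R[i], T + T' = s *: e.
    apply: e_min; first by rewrite adjD adjT adjT' addrC.
    by rewrite (convDr G_compact mu_haar) eT eT'.
  have [s2 s2E] : exists s : R[i], 'i%C *: (T - T') = s *: e.
    apply: e_min; first by rewrite adjZ adjB adjT adjT' conji scaleNr -scalerN opprB.
    by rewrite (convZr G_compact mu_haar) (convBr G_compact mu_haar) eT eT'.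
  exists ((s1 - 'i%C * s2) / 2).
  rewrite mulrC -scalerA scalerBl -scalerA -s1E -s2E scalerA.
  rewrite -expr2 sqr_i scaleN1r opprK addrACA subrr addr0.
  have -> : T + T = 2%:R *: T by rewrite scaler_nat mulr2n.
  by rewrite scalerA mulVf ?scale1r// pnatr_eq0.
pose w := (e 0)^-1 *: e.
have w0 : w 0 = 1 by rewrite cfunE mulVf.
have wD x y : w (x + y) = w x * w y.
  have [s sE] := shiftE x.
  have E z : w (x + z) = s * w z.
    have := congr1 (fun f : A => f z) sE; rewrite !cfunE => ->.
    by rewrite mulrCA.
  by rewrite E -[in w x](addr0 x) E w0 mulr1.
have wN x : w (- x) = (w x)^*.
  have eN : e (- x) = (e x)^* by rewrite -{1}ea adjE opprK.
  rewrite !cfunE rmorphM/= eN; congr (_ * _).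
  apply/esym/conj_Creal; rewrite realV e0E.
  by apply/complex_realP; eexists.
have wnorm x : `|w x| = 1.
  have : `|w x| ^+ 2 = 1 by rewrite normCK -wN -wD subrr w0.
  by move=> /eqP; rewrite sqrp_eq1 ?normr_ge0// => /eqP.
exists (Character (@cfun_continuous _ _ w) wnorm wD).
rewrite (_ : cchar _ = w); last exact: cfunP.
by rewrite /w (convZr G_compact mu_haar) ee.
Qed.

(* Induction on [e 0], which drops by at least [1] when a proper idempotent is
   split off.  If [h = g - s e] vanishes at [0] and [e] does not split, then
   [h ** h = l e] by [top_projection], and [(e + h / sqrt l) / 2] splits [e]. *)
Lemma idempotent_character (e : A) : idempotent_cfun e -> e != 0 ->
  exists chi : dual R G, e ** cchar chi = cchar chi.
Proof.
move=> ie e_neq0; have [k] : exists k : nat, sqnorm e <= k%:R.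
  exists (Num.bound (sqnorm e)); apply: ltW.
  exact: archi_boundP (sqnorm_ge0 _ _).
elim: k e ie e_neq0 => [|k IH] e ie e_neq0 ek.
  have := le_trans (idempotent_sqnorm_ge1 ie e_neq0) ek.
  by rewrite ler10.
have [ea ee] := ie.
have e00 : e 0 != 0.
  rewrite (idempotent_cfun0 ie) -(rmorph0 (real_complex R)) (inj_eq (@complexI R)).
  by rewrite gt_eqF// sqnorm_gt0.
have [[q [iq q0 qe eq]]|nosplit] :=
  pselect (exists q, [/\ idempotent_cfun q, q != 0, q != e & e ** q = q]).
  have [qa qq] := iq.
  have [|chi chiE] := IH q iq q0; last first.
    by exists chi; rewrite -{1}chiE cA eq chiE.
  have ip : idempotent_cfun (e - q).
    split; first by rewrite adjB ea qa.
    rewrite (convBl G_compact) !(convBr G_compact mu_haar) ee qq eq (cC q e) eq.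
    by rewrite subrr subr0.
  have p0 : e - q != 0 by rewrite subr_eq0 eq_sym.
  have := idempotent_sqnorm_ge1 ip p0.
  have : sqnorm (e - q) = sqnorm e - sqnorm q.
    apply: (@complexI R); rewrite rmorphB/= -!idempotent_cfun0//.
  by move=> ->; move: ek; rewrite -natr1; lra.
apply: minimal_idempotent_character => // g ga eg.
pose s := g 0 / e 0; pose h := g - s *: e.
have e0r : (e 0)^* = e 0 by rewrite -{2}ea adjE oppr0.
have g0r : (g 0)^* = g 0 by rewrite -{2}ga adjE oppr0.
have sr : s^* = s by rewrite /s rmorphM/= fmorphV/= e0r g0r.
have ha : adj h = h by rewrite /h adjB adjZ sr ea ga.
have h0 : h 0 = 0 by rewrite /h !cfunE /s divfK// subrr.
have eh : e ** h = h.
  by rewrite /h (convBr G_compact mu_haar) (convZr G_compact mu_haar) ee eg.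
have [h_eq0|h_neq0] := eqVneq h 0.
  by exists s; apply/eqP; rewrite -subr_eq0 -/h h_eq0.
exfalso.
have [l [p [l0 p0 pa pp [hhp _ /(_ _ eh) ep]]]] :=
  top_projection G_compact mu_haar ha h_neq0.
(* Since [e ** h = h], the top projection [p] satisfies [e ** p = p]; as [e] does not split, [p] is
   all of [e]. *)
have pe : p = e.
  apply: contrapT => /eqP pe; apply: nosplit; exists p; split => //.
have hh : h ** h = l%:C *: e by rewrite pe in hhp; rewrite -hhp -cA (cC h e) eh.
pose t := (Num.sqrt l)^-1%:C : R[i].
have tl : t * t * l%:C = 1.
  rewrite /t -!rmorphM -invfM -expr2 sqr_sqrtr ?ltW// mulVf ?gt_eqF//.
have tr : t^* = t by apply: conj_Creal; apply/complex_realP; eexists.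
pose q := 2^-1 *: (e + t *: h).
(* As [h] vanishes at [0], the value of [q] there is half that of [e]; this excludes both [q = 0]
   and [q = e]. *)
have q00 : q 0 = 2^-1 * e 0 by rewrite cfunEZ cfunED cfunEZ h0 mulr0 addr0.
have iq : idempotent_cfun q.
  split.
    rewrite /q adjZ adjD adjZ ea ha tr; congr (_ *: _).
    by apply: conj_Creal; rewrite realV realn.
  rewrite /q (convZl G_compact) (convZr G_compact mu_haar).
  rewrite (convDl G_compact) !(convDr G_compact mu_haar).
  rewrite !(convZl G_compact) !(convZr G_compact mu_haar) ee eh (cC h e) eh hh.
  rewrite !scalerA tl scale1r.
  have -> : e + t *: h + (t *: h + e) = 2%:R *: (e + t *: h).
    by rewrite [t *: h + e]addrC scaler_nat mulr2n.
  by rewrite scalerA -mulrA mulVf ?mulr1// pnatr_eq0.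
have eq : e ** q = q.
  by rewrite /q (convZr G_compact mu_haar) (convDr G_compact mu_haar)
    (convZr G_compact mu_haar) ee eh.
apply: nosplit; exists q; split => //.
  apply/eqP => q_eq0; move: q00; rewrite q_eq0 cfunE => /esym/eqP.
  by rewrite mulf_eq0 invr_eq0 pnatr_eq0 (negPf e00).
apply/eqP => q_eqe; move: q00; rewrite q_eqe -{1}[e 0]mul1r => /(mulIf e00).
by move=> /(congr1 (fun z => z * 2))/eqP; rewrite mulVf ?pnatr_eq0// mul1r -subr_eq0
  -[X in _ - X]/(1%:R) -natrB// oner_eq0.
Qed.

(** On a character in the range of the top projection, [h ** h] acts both as [l] and as the square
    of a Fourier coefficient of [h]. A single coefficient thus controls the norm of [h ** h]. *)
Lemma exists_character (h : A) : adj h = h -> h != 0 ->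
  exists (l : R) (chi : dual R G),
    dot h (cchar chi) ^+ 2 = l%:C /\ sqnorm (h ** h) <= l * sqnorm h.
Proof.
move=> ha h_neq0.
have [l [e [l0 e0 ea ee [hhe hl _]]]] := top_projection G_compact mu_haar ha h_neq0.
have [chi chiE] := idempotent_character (conj ea ee) e0.
exists l, chi; split => //.
have : h ** h ** cchar chi = l%:C *: cchar chi.
  by rewrite -{1}chiE cA hhe (convZl G_compact) chiE.
rewrite -cA !conv_cchar (convZr G_compact mu_haar) conv_cchar scalerA -expr2.
by move=> /(congr1 (fun f : A => f 0)); rewrite !cfunE !ccharE char0 !mulr1.
Qed.

End characters.

(** * Density of trigonometric polynomials *)

Section Fourier.
Variables (R : realType) (G : topologicalZmodType).
Hypothesis G_compact : compact [set: G].
Variable mu : probability (borel G) R.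
Hypothesis mu_haar : translation_invariant mu.

Local Notation A := (cfun R G).
Local Notation "f ** g" := (conv G_compact mu f g) (at level 40, left associativity).
Local Notation dot := (dot mu).
Local Notation sqnorm := (sqnorm mu).
Implicit Types (f g : A) (xi chi : dual R G) (F : {fset dual R G}).

Lemma dot_shift a f g : dot (cshift a f) (cshift a g) = dot f g.
Proof.
by rewrite /dot -[RHS](mean_shift G_compact mu_haar a); apply: eq_mean.
Qed.

Lemma dot_hermitianC f g : adj f = f -> adj g = g -> dot f g = dot g f.
Proof.
move=> fa ga.
by rewrite -{1}ga -(conv0E G_compact) (convC G_compact mu_haar) conv0E fa.
Qed.

Lemma cshift_cchar a xi : cshift a (cchar xi) = xi a *: cchar xi.
Proof. by apply: cfunP => x; rewrite !cfunE !ccharE charD. Qed.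

Lemma dot_shift_char a f xi :
  dot (cshift a f) (cchar xi) = xi a * dot f (cchar xi).
Proof.
rewrite -(dot_shift a f) cshift_cchar (dotZr G_compact) mulrA.
by rewrite -normCK char_norm expr1n mul1r.
Qed.

(** Translation by [a] multiplies the inner product by [xi a] and also by [chi a], so it vanishes
    unless the characters agree everywhere. *)
Lemma dot_cchar xi chi : dot (cchar xi) (cchar chi) = (xi == chi)%:R.
Proof.
have [->|xi_neq] := eqVneq xi chi.
  rewrite -[RHS](mean_cst mu (G := G) (1 : R[i])); apply: eq_mean => x.
  by rewrite !cfunE !ccharE -normCK char_norm expr1n.
apply/eqP/contraT => d_neq0; case/eqP: xi_neq; apply: char_ext => a.
have := dot_shift_char a (cchar xi) chi; rewrite cshift_cchar (dotZl G_compact).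
by move=> /(mulIf d_neq0).
Qed.

Definition Fourier_sum F f : A := \sum_(xi <- F) dot f (cchar xi) *: cchar xi.

Lemma Fourier_sumB F f g : Fourier_sum F (f - g) = Fourier_sum F f - Fourier_sum F g.
Proof.
rewrite /Fourier_sum -sumrB; apply: eq_bigr => xi _.
by rewrite (dotBl G_compact) scalerBl.
Qed.

Lemma Fourier_sum_shift F a f :
  Fourier_sum F (cshift a f) = cshift a (Fourier_sum F f).
Proof.
apply: cfunP => x; rewrite cshiftE !cfunE_sum; apply: eq_bigr => xi _.
by rewrite !cfunEZ !ccharE dot_shift_char charD; ring.
Qed.

Lemma dot_suml (I : Type) (s : seq I) (h : I -> A) g :
  dot (\sum_(i <- s) h i) g = \sum_(i <- s) dot (h i) g.
Proof.
elim: s => [|i s IH]; first by rewrite !big_nil (dot0l G_compact).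
by rewrite !big_cons (dotDl G_compact) IH.
Qed.

Lemma dot_Fourier_sum F f chi :
  dot (Fourier_sum F f) (cchar chi) = if chi \in F then dot f (cchar chi) else 0.
Proof.
rewrite dot_suml; case: ifPn => chiF; last first.
  rewrite big_seq big1// => xi xiF; rewrite (dotZl G_compact) dot_cchar.
  by case: eqP => [xichi|]; [rewrite -xichi xiF in chiF|rewrite mulr0].
rewrite (big_fsetD1 chi)//= (dotZl G_compact) dot_cchar eqxx mulr1.
rewrite big_seq big1 ?addr0// => xi; rewrite !inE => /andP[/negPf xichi _].
by rewrite (dotZl G_compact) dot_cchar xichi mulr0.
Qed.

Lemma dot_residue F f chi : dot (f - Fourier_sum F f) (cchar chi) =
  if chi \in F then 0 else dot f (cchar chi).
Proof.
by rewrite (dotBl G_compact) dot_Fourier_sum; case: ifP; rewrite ?subrr ?subr0.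
Qed.

Definition Fourier_energy F f : R :=
  \sum_(xi <- F) complex.Re (`|dot f (cchar xi)| ^+ 2).

Lemma Bessel_eq F f :
  sqnorm (f - Fourier_sum F f) = sqnorm f - Fourier_energy F f.
Proof.
apply: (@complexI R); rewrite rmorphB/= -!sqnormE.
set r := f - _.
have rS : dot r (Fourier_sum F f) = 0.
  rewrite (dotC G_compact) dot_suml big_seq big1 ?rmorph0// => xi xiF.
  by rewrite (dotZl G_compact) (dotC G_compact mu r) dot_residue xiF rmorph0 mulr0.
rewrite {2}/r (dotBr G_compact) rS subr0 /r (dotBl G_compact); congr (_ - _).
rewrite dot_suml rmorph_sum; apply: eq_bigr => xi _.
rewrite (dotZl G_compact) (dotC G_compact mu f) -normCK.
by apply/esym/RRe_real/ger0_real; rewrite exprn_ge0.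
Qed.

Lemma Re_sqr_norm_ge0 (z : R[i]) : 0 <= complex.Re (`|z| ^+ 2).
Proof.
by rewrite -lecR rmorph0 RRe_real ?exprn_ge0//; apply: ger0_real; rewrite exprn_ge0.
Qed.

Lemma Fourier_energy_le F f : Fourier_energy F f <= sqnorm f.
Proof. by rewrite -subr_ge0 -Bessel_eq sqnorm_ge0. Qed.

Lemma residue_le F f : sqnorm (f - Fourier_sum F f) <= sqnorm f.
Proof.
rewrite Bessel_eq gerBl; apply: sumr_ge0 => xi _; exact: Re_sqr_norm_ge0.
Qed.

(** If the energy of [F] is within [d] of the supremum over all finite sets, adding one more
    character gains at most [d]. This avoids enumerating the dual group. *)
Lemma Fourier_tail f (d : R) : 0 < d -> exists F : {fset dual R G},
  forall chi, chi \notin F -> complex.Re (`|dot f (cchar chi)| ^+ 2) <= d.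
Proof.
move=> d0; pose E := [set Fourier_energy F f | F in [set: {fset dual R G}]].
have E_sup : has_sup E.
  split; first by exists (Fourier_energy fset0 f); exists fset0.
  by exists (sqnorm f) => _ [F _ <-]; exact: Fourier_energy_le.
have [_ [F _ <-] HF] := sup_adherent d0 E_sup.
exists F => chi chiF.
have : Fourier_energy (chi |` F)%fset f <= sup E.
  by apply: ub_le_sup; [case: E_sup|exists (chi |` F)%fset].
rewrite {1}/Fourier_energy big_fsetU1//= -/(Fourier_energy F f).
by move: HF; lra.
Qed.

(* When [F] captures almost all the Fourier energy of [f], the residue [r] has
   uniformly small coefficients, hence [||r ** r||] is small by
   [exists_character].  As [r ** r] is equicontinuous at [0] independently of
   [F], its value [||r||^2] at [0] is small too. *)
Lemma hermitian_Fourier_dense f (e : R) : adj f = f -> 0 < e ->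
  exists F : {fset dual R G}, sqnorm (f - Fourier_sum F f) <= e.
Proof.
move=> fa e0; set T := sqnorm f.
have T0 : 0 <= T by exact: sqnorm_ge0.
have T1 : 0 < T + 1 by rewrite ltr_wpDl.
have TT : T <= (T + 1) ^+ 2.
  by rewrite -[leLHS]mul1r expr2 ler_pM// ?lerDl ?lerDr.
have e20 : 0 < e / 2 by rewrite divr_gt0.
(* Chosen so that [T * eta ^+ 2 <= (e / 2) ^+ 2], by [TT]; adding [1] covers the case [T = 0]. *)
pose eta := e / 2 / (T + 1).
have eta0 : 0 < eta by rewrite divr_gt0.
pose U := [set y : G | forall x, `|f (- y + x) - f x| < eta%:C].
have nU : nbhs (0 : G) U.
  pose K (z : G * G) : R[i]^o := f (- z.1 + z.2).
  have cK : continuous K.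
    move=> z; apply: (@continuous_comp _ _ _ (fun z : G * G => - z.1 + z.2));
      last exact: cfun_continuous.
    apply: (@continuous_comp _ _ _ (fun z : G * G => (- z.1, z.2))
      (fun z : G * G => z.1 + z.2)); last exact: add_continuous.
    apply: cvg_pair => /=; last exact: cvg_snd.
    by apply: continuous_comp; [exact: cvg_fst|exact: opp_continuous].
  have etaC : 0 < eta%:C :> R[i] by rewrite -(rmorph0 (real_complex R)) ltcR.
  have := compact_near_uniform G_compact (0 : G) cK etaC.
  by apply: filterS => y Hy x; have := Hy x; rewrite /K/= oppr0 add0r.
have [m m0 Hm] := dot_support G_compact mu_haar nU.
(* With this tail, [l * sqnorm r] is at most [(e / 2) ^+ 2 * m * T / (T + 1)], strictly below the
   lower bound that [dot_support] gives for [r ** r]. *)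
have [F HF] := Fourier_tail f (divr_gt0 (mulr_gt0 (exprn_gt0 2 e20) m0) T1).
exists F; rewrite leNgt; apply/negP => et.
set r := f - _ in et.
have ra : adj r = r.
  rewrite /r adjB fa; congr (_ - _); apply: cfunP => x.
  rewrite adjE !cfunE_sum rmorph_sum; apply: eq_bigr => xi _.
  rewrite !cfunEZ !ccharE rmorphM/= charN conjCK; congr (_ * _).
  by rewrite -(dotC G_compact) dot_hermitianC// cchar_adj.
have r_neq0 : r != 0.
  apply: contraTneq et => ->; rewrite -leNgt /sqnorm (dot0l G_compact) ltW//.
have [l [chi [chil lr]]] := exists_character G_compact mu_haar ra r_neq0.
have rT : sqnorm r <= T by exact: residue_le.
have l_le : l <= (e / 2) ^+ 2 * m / (T + 1).
  have : complex.Re (`|dot r (cchar chi)| ^+ 2) <= (e / 2) ^+ 2 * m / (T + 1).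
    rewrite dot_residue; case: ifPn => [_|]; last exact: HF.
    by rewrite normr0 expr0n/= ltW// divr_gt0// mulr_gt0// exprn_gt0.
  apply: le_trans; rewrite -normrX chil normc_def/= expr0n addr0 sqrtr_sqr.
  exact: ler_norm.
have lower : ((e / 2) ^+ 2 * m)%:C <= dot (r ** r) (r ** r).
  apply: Hm; first exact: sqr_ge0.
  move=> y Uy.
  have rrE z : (r ** r) z = dot r (cshift (- z) r).
    rewrite convE; apply: eq_mean => x; rewrite !cmulE cconjE cflipE cshiftE -{2}ra adjE; congr (_ * (r _)^*).
    by rewrite opprB addrC.
  have rr0 : (r ** r) 0 = (sqnorm r)%:C.
    rewrite rrE -sqnormE; congr dot; apply: cfunP => x.
    by rewrite cshiftE oppr0 add0r.
  pose D := (r ** r) y - (r ** r) 0.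
  have DE : D = dot r (cshift (- y) r - r).
    by rewrite /D (dotBr G_compact) -rrE rr0 sqnormE.
  (* Taking residues commutes with translations and does not increase norms, so [r] moves in [L^2]
     no more than [f] does; hence [U] and [m] could be fixed before [F]. *)
  have shr : cshift (- y) r - r =
      (cshift (- y) f - f) - Fourier_sum F (cshift (- y) f - f).
    rewrite Fourier_sumB Fourier_sum_shift /r.
    by apply: cfunP => x; rewrite !cfunE; ring.
  have D2 : `|D| ^+ 2 <= ((e / 2) ^+ 2)%:C.
    rewrite DE; apply: le_trans (CauchySchwarz G_compact mu _ _) _.
    rewrite !sqnormE -rmorphM lecR shr.
    have h1 : sqnorm (cshift (- y) f - f) <= eta ^+ 2.
      rewrite -lecR -sqnormE; apply: (dot_norm_le G_compact) => x.
      rewrite rmorphXn/= lerXn2r ?nnegrE ?normr_ge0//.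
        by rewrite -(rmorph0 (real_complex R)) lecR ltW.
      by apply: ltW; exact: Uy.
    have h2 := le_trans (residue_le F _) h1.
    have h3 := ler_pM (sqnorm_ge0 mu r) (sqnorm_ge0 mu _) rT h2.
    apply: le_trans h3 _; rewrite /eta expr_div_n mulrCA ler_piMr ?sqr_ge0//.
    by rewrite ler_pdivrMr ?exprn_gt0// mul1r.
  have D1 : `|D| <= (e / 2)%:C.
    have e2C : 0 <= (e / 2)%:C :> R[i] by rewrite ler0c ltW.
    rewrite -(ler_pXn2r (n := 2)) ?nnegrE ?normr_ge0//.
    by apply: le_trans D2 _; rewrite rmorphXn.
  rewrite rmorphXn/= lerXn2r ?nnegrE ?normr_ge0//.
    by rewrite -(rmorph0 (real_complex R)) lecR ltW.
  have h4 : `|(r ** r) 0| <= `|(r ** r) y| + `|D|.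
    have {1}-> : (r ** r) 0 = (r ** r) y - D by rewrite /D subKr.
    exact: ler_normB.
  have h5 : e%:C <= `|(r ** r) 0|.
    rewrite rr0 normc_def/= expr0n addr0 sqrtr_sqr lecR.
    by rewrite (le_trans (ltW et))// ler_norm.
  have := lerB (le_trans h5 h4) D1.
  rewrite addrK; apply: le_trans.
  by rewrite -rmorphB lecR {2}(splitr e) addrK.
move: lower; rewrite sqnormE lecR; apply/negP; rewrite -ltNge.
have r0 : 0 <= sqnorm r by exact: sqnorm_ge0.
apply: le_lt_trans lr _; apply: le_lt_trans (ler_wpM2r r0 l_le) _.
rewrite mulrAC ltr_pdivrMr// ltr_pM2l ?mulr_gt0 ?exprn_gt0//.
by apply: le_lt_trans rT _; rewrite ltrDl.
Qed.

End Fourier.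

(** * Passage from continuous functions to [L^1] *)

Section real_integrals.
Variables (d : measure_display) (T : measurableType d) (R : realType).
Variable P : probability T R.
Implicit Types f g h : T -> R.

Local Notation integr f := (P.-integrable [set: T] (EFin \o f)).

Lemma integr_cst (k : R) : integr (fun=> k).
Proof. exact: finite_measure_integrable_cst. Qed.

Lemma Rintegral_probability_cst (k : R) : \int[P]_x k = k.
Proof.
rewrite Rintegral_cst//; set m := fine _.
have -> : m = 1 by exact: (congr1 fine (probability_setT P)).
by rewrite mulr1.
Qed.

Lemma integrD f g : integr f -> integr g -> integr (fun x => f x + g x).
Proof. by move=> ig ih; have := integrableD measurableT ig ih. Qed.

Lemma integrB f g : integr f -> integr g -> integr (fun x => f x - g x).
Proof. by move=> ig ih; have := integrableB measurableT ig ih. Qed.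

Lemma integrZ (k : R) f : integr f -> integr (fun x => k * f x).
Proof. by move=> ih; have := integrableZl measurableT k ih. Qed.

Lemma integr_norm f : integr f -> integr (fun x => `|f x|).
Proof. exact: integrable_norm. Qed.

Lemma integr_measurable f : integr f -> measurable_fun [set: T] f.
Proof. by move=> /measurable_int/measurable_EFinP. Qed.

Lemma integr_bounded f (M : R) : measurable_fun [set: T] f ->
  (forall x, `|f x| <= M) -> integr f.
Proof.
move=> mf fM; apply: measurable_bounded_integrable => //.
  by apply: (@le_lt_trans _ _ 1%E); [exact: probability_le1|exact: ltry].
exists M; split; first exact: num_real.
by move=> y My x _ /=; exact: le_trans (fM x) (ltW My).
Qed.

Lemma integrM_bounded f g (M : R) : integr f -> measurable_fun [set: T] g ->
  (forall x, `|g x| <= M) -> integr (fun x => f x * g x).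
Proof.
move=> jf mg gM; have -> : EFin \o (fun x => f x * g x) =
    ((EFin \o f) \* (EFin \o g))%E by apply/funext.
apply: integrableMl => //.
exists M; split; first exact: num_real.
by move=> y My x _ /=; exact: le_trans (gM x) (ltW My).
Qed.

Lemma integr_sum (I : Type) (s : seq I) (F : I -> T -> R) :
  (forall i, integr (F i)) -> integr (fun x => \sum_(i <- s) F i x).
Proof.
move=> iF; elim: s => [|i s IH].
  have -> : (fun x => \sum_(i <- [::]) F i x) = (fun=> 0).
    by apply/funext => x; rewrite big_nil.
  exact: integr_cst.
have -> : (fun x => \sum_(j <- i :: s) F j x) =
    fun x => F i x + \sum_(j <- s) F j x.
  by apply/funext => x; rewrite big_cons.
exact: integrD.
Qed.

Lemma Rintegral_sum (I : Type) (s : seq I) (F : I -> T -> R) :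
  (forall i, integr (F i)) ->
  \int[P]_x (\sum_(i <- s) F i x) = \sum_(i <- s) \int[P]_x F i x.
Proof.
move=> iF; elim: s => [|i s IH].
  rewrite big_nil; under eq_Rintegral do rewrite big_nil.
  by rewrite Rintegral_cst// mul0r.
rewrite big_cons -IH -RintegralD//; last exact: integr_sum.
by apply: eq_Rintegral => x _; rewrite big_cons.
Qed.

Lemma Rintegral_triangle f g h : integr f -> integr g -> integr h ->
  \int[P]_x `|f x - h x| <= \int[P]_x `|f x - g x| + \int[P]_x `|g x - h x|.
Proof.
move=> jf jg jh; rewrite -RintegralD//; try exact/integr_norm/integrB.
apply: le_Rintegral => //.
- exact/integr_norm/integrB.
- by apply: integrD; exact/integr_norm/integrB.
- by move=> x _; rewrite -(subrKA (g x)) ler_normD.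
Qed.

Lemma bounded_cvg_L1 (f_ : nat -> T -> R) f (M : R) :
  (forall n, measurable_fun [set: T] (f_ n)) ->
  (forall n x, `|f_ n x| <= M) -> (forall x, f_ n x @[n --> \oo] --> f x) ->
  forall e : R, 0 < e -> exists n, \int[P]_x `|f x - f_ n x| <= e.
Proof.
move=> mf fM ff e e0.
have mlim : measurable_fun [set: T] f.
  by apply: (measurable_fun_cvg mf) => x _; exact: ff.
have h1 n : measurable_fun [set: T] (EFin \o f_ n) by exact/measurable_EFinP.
have h2 : measurable_fun [set: T] (EFin \o f) by exact/measurable_EFinP.
have h3 : {ae P, forall x, [set: T] x -> (EFin \o f_ n) x @[n --> \oo] --> (EFin \o f) x}.
  by apply: aeW => x _; apply: cvg_EFin; [exact: nearW|exact: ff].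
have h4 : {ae P, forall x n, [set: T] x -> (`|(EFin \o f_ n) x| <= (cst M%:E) x)%E}.
  by apply: aeW => x n _ /=; rewrite lee_fin.
have [_ dc _] := dominated_convergence measurableT h1 h2 h3 (integr_cst M) h4.
move: dc => /fine_cvgP[_ /cvgrPdist_le/(_ _ e0)[n _ /(_ n (leqnn n)) /= H]].
exists n; move: H; rewrite sub0r normrN; apply: le_trans.
rewrite /Rintegral; apply: le_trans (ler_norm _) _.
rewrite le_eqVlt; apply/orP; left; apply/eqP; congr (`|fine _|).
by apply: eq_integral => x _; rewrite distrC.
Qed.

End real_integrals.

Section trigonometric_polynomials.
Variables (R : realType) (G : topologicalZmodType).
Hypothesis G_compact : compact [set: G].
Variable mu : probability (borel G) R.
Hypothesis mu_haar : translation_invariant mu.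

Local Notation A := (cfun R G).
Local Notation sqnorm := (sqnorm mu).
Local Notation integr f := (mu.-integrable [set: borel G] (EFin \o f)).

Definition trigonometric (p : A) := exists s : seq (R[i] * dual R G),
  p = \sum_(z <- s) z.1 *: cchar z.2.

Lemma trigonometricD p q : trigonometric p -> trigonometric q ->
  trigonometric (p + q).
Proof. by move=> [s ->] [t ->]; exists (s ++ t); rewrite big_cat. Qed.

Lemma trigonometricZ a p : trigonometric p -> trigonometric (a *: p).
Proof.
move=> [s ->]; exists [seq (a * z.1, z.2) | z <- s].
by rewrite scaler_sumr big_map; apply: eq_bigr => z _; rewrite scalerA.
Qed.

Lemma trigonometric_Fourier_sum F (f : A) : trigonometric (Fourier_sum mu F f).
Proof.
exists [seq (dot mu f (cchar xi), xi) | xi <- F].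
by rewrite big_map.
Qed.

Lemma sqnormD_le (f g : A) : sqnorm (f + g) <= 2 * sqnorm f + 2 * sqnorm g.
Proof.
rewrite -lecR rmorphD !rmorphM/= -!sqnormE -subr_ge0.
have := dot_ge0 mu (f - g).
rewrite !(dotBl G_compact) !(dotBr G_compact) !(dotDl G_compact) !(dotDr G_compact).
by congr (0 <= _); rewrite rmorph_nat; ring.
Qed.

Lemma sqnormZ a (f : A) : (sqnorm (a *: f))%:C = `|a| ^+ 2 * (sqnorm f)%:C.
Proof.
rewrite -!sqnormE (dotZl G_compact) (dotZr G_compact) mulrA normCK; ring.
Qed.

Lemma trigonometric_dense (f : A) (e : R) : 0 < e ->
  exists2 p, trigonometric p & sqnorm (f - p) <= e.
Proof.
move=> e0; have e4 : 0 < e / 4 by rewrite divr_gt0.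
have herm (g : A) : adj g = g -> exists2 p, trigonometric p & sqnorm (g - p) <= e / 4.
  move=> ga; have [F HF] := hermitian_Fourier_dense G_compact mu_haar ga e4.
  by exists (Fourier_sum mu F g) => //; exact: trigonometric_Fourier_sum.
(* The real and imaginary parts of [f] for the involution [adj], not for pointwise conjugation. *)
pose f1 := 2^-1 *: (f + adj f); pose f2 := - ('i%C / 2) *: (f - adj f).
have conj2 : (2^-1 : R[i])^* = 2^-1 by apply: conj_Creal; rewrite realV realn.
have conji : ('i%C : R[i])^* = - 'i%C by rewrite complexiE conjCi.
have f1a : adj f1 = f1 by rewrite /f1 adjZ adjD adjK conj2 addrC.
have f2a : adj f2 = f2.
  rewrite /f2 adjZ adjB adjK rmorphN rmorphM/= conj2 conji mulNr opprK.
  by rewrite scaleNr -scalerN opprB.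
have fE : f = f1 + 'i%C *: f2.
  rewrite /f1 /f2 scalerA mulrN mulrA -expr2 sqr_i mulN1r opprK.
  rewrite -scalerDr addrACA subrr addr0.
  have -> : f + f = 2%:R *: f by rewrite scaler_nat mulr2n.
  by rewrite scalerA mulVf ?scale1r// pnatr_eq0.
have [p1 tp1 h1] := herm f1 f1a; have [p2 tp2 h2] := herm f2 f2a.
exists (p1 + 'i%C *: p2).
  by apply: trigonometricD => //; exact: trigonometricZ.
rewrite {1}fE opprD addrACA -scalerBr.
apply: le_trans (sqnormD_le _ _) _.
have -> : sqnorm ('i%C *: (f2 - p2)) = sqnorm (f2 - p2).
  apply: (@complexI R); rewrite sqnormZ.
  by rewrite normc_def/= expr0n add0r expr1n sqrtr1 expr1n mul1r.
by lra.
Qed.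

Lemma continuous_measurable_Re (p : A) :
  measurable_fun [set: borel G] (fun x => complex.Re (p x)).
Proof.
apply: continuous_borel_measurable => x.
by apply: continuous_comp; [exact: cfun_continuous|exact: continuous_Re].
Qed.

Lemma integr_Re (p : A) : integr (fun x => complex.Re (p x)).
Proof.
by have [] := Cintegrable_continuous G_compact mu (@cfun_continuous _ _ p).
Qed.

Lemma L1_le_sqnorm (f : A) :
  (\int[mu]_x `|complex.Re (f x)|) ^+ 2 <= sqnorm f.
Proof.
have cg : continuous (fun x => `|complex.Re (f x)|%:C : R[i]^o).
  move=> x; apply/(@cvgrPdist_le _ R[i]^o) => e e0.
  have /(@cvgrPdist_le _ R[i]^o)/(_ _ e0) := @cfun_continuous _ _ f x.
  apply: filterS => y; apply: le_trans; apply: le_trans (normc_ge_Re _).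
  rewrite -rmorphB normc_def/= expr0n addr0 sqrtr_sqr lecR.
  apply: le_trans (ler_dist_dist _ _) _.
  by case: (f x) (f y) => [? ?] [? ?].
pose g := CFun cg.
have gE : mean mu g = (\int[mu]_x `|complex.Re (f x)|)%:C.
  rewrite /mean /Cintegral/=; congr (_ +i* _).
  by rewrite Rintegral_cst// mul0r.
have : `|dot mu g (cconst G 1)| ^+ 2 <= (sqnorm f)%:C.
  apply: le_trans (CauchySchwarz G_compact mu _ _) _.
  have -> : dot mu (cconst G 1) (cconst G 1) = 1 :> R[i].
    by rewrite -[RHS](mean_cst mu (G := G) 1); apply: eq_mean => x;
      rewrite !cfunE conjC1 mulr1.
  rewrite mulr1 -sqnormE -subr_ge0 /dot -(meanB G_compact).
  apply: mean_ge0 => x; rewrite !cfunE subr_ge0 -!normCK.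
  rewrite lerXn2r ?nnegrE ?normr_ge0//.
  rewrite normc_def/= expr0n addr0 sqrtr_sqr normr_id.
  exact: normc_ge_Re.
have -> : dot mu g (cconst G 1) = mean mu g.
  by apply: eq_mean => x; rewrite !cfunE conjC1 mulr1.
rewrite gE normc_def/= expr0n addr0 sqrtr_sqr -rmorphXn lecR.
by rewrite real_normK ?num_real.
Qed.

Definition trig_approximable (r : G -> R) := forall e : R, 0 < e ->
  exists2 p, trigonometric p & \int[mu]_x `|r x - complex.Re (p x)| <= e.

Lemma trig_approximable_lim (r : G -> R) : integr r ->
  (forall e : R, 0 < e -> exists r', [/\ integr r', trig_approximable r' &
    \int[mu]_x `|r x - r' x| <= e]) -> trig_approximable r.
Proof.
move=> ir H e e0; have e2 : 0 < e / 2 by rewrite divr_gt0.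
have [r' [ir' /(_ _ e2)[p tp pE] rr']] := H _ e2.
exists p => //; rewrite [e]splitr.
apply: le_trans (Rintegral_triangle ir ir' (integr_Re p)) _.
exact: lerD.
Qed.

Lemma trig_approximableD (r r' : G -> R) : integr r -> integr r' ->
  trig_approximable r -> trig_approximable r' ->
  trig_approximable (fun x => r x + r' x).
Proof.
move=> ir ir' H H' e e0; have e2 : 0 < e / 2 by rewrite divr_gt0.
have [p tp pe] := H _ e2; have [p' tp' pe'] := H' _ e2.
exists (p + p'); first exact: trigonometricD.
rewrite [e]splitr; apply: le_trans (lerD pe pe').
have i1 := integr_norm (integrB ir (integr_Re p)).
have i2 := integr_norm (integrB ir' (integr_Re p')).
rewrite -RintegralD//; apply: le_Rintegral => //.
- exact/integr_norm/integrB/integr_Re/integrD.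
- exact: integrD.
- move=> x _; rewrite cfunE Re_add opprD addrACA; exact: ler_normD.
Qed.

Lemma trig_approximableZ (k : R) (r : G -> R) : integr r ->
  trig_approximable r -> trig_approximable (fun x => k * r x).
Proof.
move=> ir H e e0; have e2 : 0 < e / (`|k| + 1) by rewrite divr_gt0// ltr_wpDl.
have [p tp pe] := H _ e2.
exists (k%:C *: p); first exact: trigonometricZ.
have E x : `|k * r x - complex.Re ((k%:C *: p) x)| =
    `|k| * `|r x - complex.Re (p x)|.
  by rewrite cfunE -normrM mulrBr; case: (p x) => u v /=; rewrite mul0r subr0.
under eq_Rintegral do rewrite E.
rewrite RintegralZl//; last exact/integr_norm/integrB/integr_Re.
apply: le_trans (ler_wpM2l (normr_ge0 _) pe) _.
by rewrite mulrCA ger_pMr// ler_pdivrMr ?ltr_wpDl// mul1r lerDl.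
Qed.

Lemma trig_approximable_cfun (f : A) :
  trig_approximable (fun x => complex.Re (f x)).
Proof.
move=> e e0; have [p tp pe] := trigonometric_dense f (exprn_gt0 2 e0).
exists p => //; rewrite -(ler_pXn2r (n := 2)) ?nnegrE ?(ltW e0)//; last first.
  by apply: Rintegral_ge0 => x _.
apply: le_trans pe; apply: le_trans (L1_le_sqnorm _).
rewrite le_eqVlt; apply/orP; left; apply/eqP; congr (_ ^+ 2).
by apply: eq_Rintegral => x _; congr (`|_|); exact/esym/Re_sub.
Qed.

Lemma trig_approximable_continuous (f : G -> R) : continuous f ->
  trig_approximable f.
Proof.
move=> cf.
have cg : continuous (fun x => (f x)%:C : R[i]^o).
  move=> x; apply/(@cvgrPdist_le _ R[i]^o) => e e0.
  have eE : e = (complex.Re e)%:C by apply/esym/RRe_real/gtr0_real.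
  have e1 : 0 < complex.Re e by rewrite -ltcR -eE rmorph0.
  have /cvgrPdist_le/(_ _ e1) := cf x; apply: filterS => y.
  by rewrite -rmorphB normc_def/= expr0n addr0 sqrtr_sqr {2}eE lecR.
exact: (trig_approximable_cfun (CFun cg)).
Qed.

End trigonometric_polynomials.

Section distance_to_set.
Variables (R : realType) (T : topologicalType).

Lemma metrizable_closed_distance (C : set T) : metrizable R T -> closed C ->
  C !=set0 -> exists e : T -> R, [/\ continuous e, forall x, 0 <= e x,
    forall x, C x -> e x = 0 & forall x, ~ C x -> 0 < e x].
Proof.
move=> [d [d0 _ dC dtri dnbhs]] cC [c0 Cc0].
have d_ge0 x y : 0 <= d x y.
  have := dtri y x x; rewrite d0 (dC y x) => h; lra.
pose E x := [set d x c | c in C].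
have lbE x : lbound (E x) 0 by move=> _ [c _ <-].
have infE x : has_inf (E x).
  by split; [exists (d x c0); exists c0|exists 0].
pose e x := inf (E x).
have e_le x y : e x <= d x y + e y.
  rewrite addrC -lerBlDr; apply: lb_le_inf; first by case: (infE y).
  move=> _ [c Cc <-]; rewrite lerBlDr addrC.
  apply: le_trans (dtri y x c); apply: ge_inf; first by case: (infE x).
  by exists c.
exists e; split.
- move=> x; apply/cvgrPdist_le => r r0.
  have : nbhs x [set y | d x y < r] by rewrite dnbhs; exists r.
  apply: filterS => y /= dxy; rewrite ler_norml; apply/andP; split.
    have := e_le y x; rewrite dC; move: (ltW dxy); lra.
  by have := e_le x y; move: (ltW dxy); lra.
- by move=> x; apply: lb_le_inf; [case: (infE x)|exact: lbE].
- move=> x Cx; apply/le_anti/andP; split.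
    by rewrite -(d0 x); apply: ge_inf; [case: (infE x)|exists x].
  by apply: lb_le_inf; [case: (infE x)|exact: lbE].
- move=> x nCx.
  have : nbhs x (~` C) by apply: open_nbhs_nbhs; split => //; exact: closed_openC.
  rewrite dnbhs => -[r /= r0 rC]; apply: (lt_le_trans r0).
  apply: lb_le_inf; first by case: (infE x).
  by move=> _ [c Cc <-]; rewrite leNgt; apply/negP => /rC.
Qed.

End distance_to_set.

Section trigonometric_density.
Import HBSimple.
Variables (R : realType) (G : topologicalZmodType).
Hypothesis G_compact : compact [set: G].
Hypothesis G_metrizable : metrizable R G.
Variable mu : probability (borel G) R.
Hypothesis mu_haar : translation_invariant mu.

Local Notation integr f := (mu.-integrable [set: borel G] (EFin \o f)).
Local Notation tapp := (@trig_approximable R G mu).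

Lemma trig_approximable_bounded_cvg (f_ : nat -> G -> R) (f : G -> R) (M : R) :
  (forall n, measurable_fun [set: borel G] (f_ n)) ->
  (forall n x, `|f_ n x| <= M) -> (forall x, f_ n x @[n --> \oo] --> f x) ->
  (forall n, tapp (f_ n)) -> tapp f.
Proof.
move=> mf fM ff tf; apply: (trig_approximable_lim G_compact).
  apply: (@integr_bounded _ _ _ _ _ M).
    by apply: (measurable_fun_cvg mf) => x _; exact: ff.
  move=> x; apply: (cvgr_to_le (cvg_norm (ff x))); exact: nearW.
move=> e e0; have [n Hn] := bounded_cvg_L1 mu mf fM ff e0.
exists (f_ n); split => //; exact: integr_bounded (mf n) (fM n).
Qed.

Lemma trig_approximable_cst (k : R) : tapp (fun=> k).
Proof.
by apply: (trig_approximable_continuous G_compact mu_haar) => x; exact: cvg_cst.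
Qed.

(** With [e] the distance to [C], the functions [1 / (1 + n e)] are continuous, bounded by [1] and
    converge pointwise to the indicator. Metrizability provides [e]. *)
Lemma trig_approximable_closed (C : set G) : closed C -> tapp \1_C.
Proof.
move=> cC; have [C0|/set0P Cn0] := eqVneq C set0.
  rewrite (_ : \1_C = fun=> 0); first exact: trig_approximable_cst.
  by apply/funext => x; rewrite indicE C0 in_set0.
have [e [ce e_ge0 eC eNC]] := metrizable_closed_distance G_metrizable cC Cn0.
have ne_gt0 n x : 0 < 1 + n%:R * e x by rewrite ltr_pwDl// mulr_ge0.
pose f_ n x := (1 + n%:R * e x)^-1.
have cf n : continuous (f_ n).
  move=> x; apply: cvgV; first by rewrite gt_eqF.
  apply: cvgD; first exact: cvg_cst.
  by apply: cvgM; [exact: cvg_cst|exact: ce].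
apply: (@trig_approximable_bounded_cvg f_ _ 1).
- by move=> n; exact: continuous_borel_measurable.
- move=> n x; rewrite ger0_norm ?invr_ge0 ?(ltW (ne_gt0 _ _))//.
  by rewrite invf_le1// lerDl mulr_ge0.
- move=> x; rewrite indicE; have [xC|xC] := boolP (x \in C).
    rewrite (_ : (fun n => f_ n x) = fun=> 1); first exact: cvg_cst.
    by apply/funext => n; rewrite /f_ eC ?mulr0 ?addr0 ?invr1//; rewrite inE in xC.
  have ex0 : 0 < e x by apply: eNC => Cx; rewrite mem_set in xC.
  apply/cvgrPdist_le => r r0.
  near=> n; rewrite sub0r normrN ger0_norm ?invr_ge0 ?(ltW (ne_gt0 _ _))//.
  rewrite -[leRHS]invrK lef_pV2 ?posrE ?invr_gt0//.
  have h : r^-1 / e x <= n%:R by near: n; exact: nbhs_infty_ger.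
  by rewrite ler_wpDl// -ler_pdivrMr.
- by move=> n; exact: (trig_approximable_continuous G_compact mu_haar).
Unshelve. all: by end_near. Qed.

(** Open sets generate the Borel sets and are stable under intersection, so Dynkin's theorem reduces
    the claim to complements and disjoint countable unions. *)
Lemma trig_approximable_indic (B : set (borel G)) : measurable B -> tapp \1_B.
Proof.
move=> mB.
have ind_integr (D : set (borel G)) : measurable D -> integr (\1_D : G -> R).
  by move=> mD; exact: integrable_indic.
have compl (D : set (borel G)) : measurable D -> tapp \1_D -> tapp \1_(~` D).
  move=> mD tD.
  rewrite (_ : \1_(~` D) = fun x => 1 + -1 * \1_D x); last first.
    apply/funext => x; rewrite mulN1r !indicE in_setC.
    by case: (x \in D); rewrite ?subrr ?subr0.
  apply: (trig_approximableD G_compact).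
  - exact: integr_cst.
  - by apply: integrZ; exact: ind_integr.
  - exact: trig_approximable_cst.
  - by apply: (trig_approximableZ G_compact) => //; exact: ind_integr.
apply: (@dynkin_induction _ (borel G) (@open G) (fun D => tapp \1_D)) => //.
- by move=> C D oC oD; exact: openI.
- rewrite (_ : \1_[set: G] = fun=> 1); first exact: trig_approximable_cst.
  by apply/funext => x; rewrite indicE in_setT.
- move=> C oC; rewrite -(setCK C); apply: compl.
    by apply: measurableC; exact: measurable_open.
  by apply: trig_approximable_closed; exact: open_closedC.
move=> F mF tF HF.
pose f_ n (x : G) : R := \sum_(0 <= k < n) \1_(F k) x.
(* By disjointness at most one indicator is nonzero at [x]; the partial sums are [0] or [1], which
   provides the uniform bound. *)
have f_in k x : F k x -> forall n, f_ n x = (k < n)%:R.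
  move=> Fkx.
  have FE i : \1_(F i) x = (i == k)%:R :> R.
    rewrite indicE; congr (nat_of_bool _)%:R.
    apply/idP/eqP => [|->]; last by rewrite mem_set.
    rewrite inE => Fix; apply: (tF i k) => //.
    by exists x.
  elim=> [|n IH]; first by rewrite /f_ big_geq.
  rewrite /f_ big_nat_recr//= -/(f_ n x) IH FE -natrD; congr _%:R.
  by case: ltngtP => //; lia.
have f_out x : ~ (\bigcup_k F k) x -> forall n, f_ n x = 0.
  move=> nF n; rewrite /f_ big1// => i _; rewrite indicE memNset// => Fi.
  by apply: nF; exists i.
have f_cvg x : f_ n x @[n --> \oo] --> (\1_(\bigcup_k F k) x : R).
  have [[k _ Fkx]|nF] := pselect ((\bigcup_k F k) x); last first.
    rewrite indicE memNset//; apply: (@cvg_trans _ ((fun=> 0) @ \oo)).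
      by apply: near_eq_cvg; apply: nearW => n; rewrite f_out.
    exact: cvg_cst.
  rewrite indicE mem_set; last by exists k.
  apply: (@cvg_trans _ ((fun=> 1) @ \oo)); last exact: cvg_cst.
  apply: near_eq_cvg; exists k.+1 => // n /= kn.
  by rewrite (f_in k x Fkx) kn.
apply: (@trig_approximable_bounded_cvg f_ _ 1) => //.
- move=> n; apply: measurable_sum => k; exact: measurable_indic.
- move=> n x; have [[k _ Fkx]|nF] := pselect ((\bigcup_k F k) x).
    by rewrite (f_in k x Fkx); case: (k < n)%N; rewrite ?normr1 ?normr0.
  by rewrite f_out// normr0.
- move=> n; rewrite /f_; elim: n => [|n IH].
    rewrite (_ : (fun _ => _) = fun=> 0); first exact: trig_approximable_cst.
    by apply/funext => x; rewrite big_nil.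
  rewrite (_ : (fun _ => _) = fun x => \sum_(0 <= k < n) \1_(F k) x + \1_(F n) x);
    last by apply/funext => x; rewrite big_nat_recr.
  apply: (trig_approximableD G_compact) => //; last exact: ind_integr.
  by apply: integr_sum => k; exact: ind_integr.
Qed.

Lemma trig_approximable_integrable (f : G -> R) : integr f -> tapp f.
Proof.
move=> jf; apply: (trig_approximable_lim G_compact) => // e e0.
have [g_ [ig _ gf]] := approximation_sfun_integrable measurableT jf.
move: gf => /fine_cvgP[_ /cvgrPdist_le/(_ _ e0)[n _ /(_ n (leqnn n)) /= H]].
exists (g_ n); split => //; last first.
  move: H; rewrite sub0r normrN; apply: le_trans.
  exact: ler_norm.
have ind_integr (y : R) : integr (\1_(g_ n @^-1` [set y]) : G -> R).
  by apply: integrable_indic; exact: measurable_sfunP.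
rewrite (_ : (g_ n : G -> R) = fun x =>
  \sum_(y <- fset_set (range (g_ n))) y * \1_(g_ n @^-1` [set y]) x); last first.
  by apply/funext => x; rewrite fimfunE fsbig_finite//=.
elim: (enum_fset _) => [|y s IH].
  rewrite (_ : (fun _ => _) = fun=> 0); first exact: trig_approximable_cst.
  by apply/funext => x; rewrite big_nil.
rewrite (_ : (fun _ => _) = fun x => y * \1_(g_ n @^-1` [set y]) x +
   \sum_(z <- s) z * \1_(g_ n @^-1` [set z]) x); last first.
  by apply/funext => x; rewrite big_cons.
apply: (trig_approximableD G_compact) => //.
- exact: integrZ.
- by apply: integr_sum => z; exact: integrZ.
- apply: (trig_approximableZ G_compact) => //.
  by apply: trig_approximable_indic; exact: measurable_sfunP.
Qed.

End trigonometric_density.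

(** * From the coupling to the trace *)

Section linear_growth_modulus.
Variables (R : realType) (psi : R -> R).
Hypothesis psi_continuous : {within `[0, +oo[, continuous psi}.

Lemma continuous_max0 : continuous (fun x : R => Num.max 0 x).
Proof.
move=> x; apply/cvgrPdist_le => e e0; apply/nbhs_ballP; exists e => //= y xy.
apply: le_trans (ltW xy).
have h1 := ler_norm (x - y); have h2 := ler_norm (y - x); rewrite distrC in h2.
rewrite ler_norml /Num.max.
by case: ltP => hx; case: ltP => hy; apply/andP; split; lra.
Qed.

Lemma continuous_psi_max0 : continuous (fun x : R => psi (Num.max 0 x)).
Proof.
move=> x; apply/cvgrPdist_le => e e0.
have max_ge0 (y : R) : 0 <= Num.max 0 y by rewrite le_max lexx.
have m0 (y : R) : Num.max 0 y \in `[0, +oo[.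
  by rewrite in_itv/= andbT; exact: max_ge0.
have /subspace_continuousP/(_ (Num.max 0 x) (m0 x)) := psi_continuous.
move=> /cvgrPdist_le/(_ _ e0) H.
apply: (@filterS _ (nbhs x) _ _ _ _ (continuous_max0 H)) => y /= Hy.
exact: Hy (m0 y).
Qed.

Variable l : R.
Hypothesis psi_lim : psi x / x @[x --> +oo] --> l.

(* [max 0] only serves to extend [psi] continuously to the real line. *)
Let q (x : R) := psi (Num.max 0 x) / (1 + Num.max 0 x).

Let q_continuous : continuous q.
Proof.
move=> x; apply: cvgM; first exact: continuous_psi_max0.
apply: cvgV; first by rewrite gt_eqF// ltr_pwDl// le_max lexx.
by apply: cvgD; [exact: cvg_cst|exact: continuous_max0].
Qed.

Let q_lim (e : R) : 0 < e -> exists2 B : R, 0 < B &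
  forall x, B <= x -> `|q x - l| <= e.
Proof.
move=> e0; have e2 : 0 < e / 2 by rewrite divr_gt0.
move/cvgrPdist_le : psi_lim => /(_ _ e2)[B [_ HB]].
(* Beyond [B + 1] the ratio [psi x / x] is within [e / 2] of [l]; beyond the other bound, replacing
   [x] by [1 + x] in the denominator costs at most [e / 2]. *)
exists (Num.max (B + 1) (2 * `|l| / e + 1)).
  by rewrite lt_max; apply/orP; right; rewrite ltr_wpDl// divr_ge0 ?mulr_ge0 ?(ltW e0).
move=> x; rewrite ge_max => /andP[Bx lx].
have x0 : 0 < x.
  by apply: lt_le_trans lx; rewrite ltr_wpDl// divr_ge0 ?mulr_ge0 ?(ltW e0).
have := HB x (lt_le_trans _ Bx); rewrite ltrDl ltr01 => /(_ isT) h.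
have x1 : 0 < 1 + x by rewrite ltr_pwDl// ltW.
rewrite /q max_r ?(ltW x0)//.
have -> : psi x / (1 + x) - l = (psi x / x - l) * (x / (1 + x)) - l / (1 + x).
  by field; rewrite !gt_eqF.
apply: le_trans (ler_normB _ _) _; rewrite [leRHS]splitr; apply: lerD.
  rewrite normrM distrC; apply: le_trans (_ : e / 2 * 1 <= _); last by rewrite mulr1.
  apply: ler_pM => //; rewrite ger0_norm ?divr_ge0 ?(ltW x0) ?(ltW x1)//.
  by rewrite ler_pdivrMr// mul1r lerDr.
rewrite normrM normfV (ger0_norm (ltW x1)) ler_pdivrMr//.
have : 2 * `|l| / e <= x by apply: le_trans lx; rewrite lerDl.
rewrite ler_pdivrMr// => h2; lra.
Qed.

(** In the coordinate [1 / (1 + x)] the half-line becomes []0, 1]] and [q] extends continuously to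
    [0], so it is bounded and uniformly continuous. Pairs at small distance are covered by [e], all
    others by a multiple of the square distance, the quantity that convexity controls. *)
Lemma linear_growth_modulus (e : R) : 0 < e -> exists2 C : R, 0 <= C &
  forall s t : R, 0 <= s -> 0 <= t ->
    `|psi s / (1 + s) - psi t / (1 + t)| <=
      e + C * ((1 + s)^-1 - (1 + t)^-1) ^+ 2.
Proof.
move=> e0; have e2 : 0 < e / 2 by rewrite divr_gt0.
have [B B0 HB] := q_lim e2.
have B1 : 0 <= B + 1 by rewrite addr_ge0// ltW.
have [M [M0 qM]] : exists M : R, 0 <= M /\ forall x, 0 <= x -> `|q x| <= M.
  have cnq : {within `[0, B], continuous (fun x => `|q x|)}.
    by apply: continuous_subspaceT => x; apply: cvg_norm; exact: q_continuous.
  have [c _ Hc] := EVT_max (ltW B0) cnq.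
  exists (Num.max `|q c| (`|l| + e / 2)); split; first by rewrite le_max normr_ge0.
  move=> x x0; rewrite le_max; have [xB|xB] := leP x B.
    by rewrite Hc// in_itv/= x0.
  apply/orP; right; have := HB _ (ltW xB); move=> /(lerD (lexx `|l|)); apply: le_trans.
  by rewrite -{1}(subrK l (q x)) addrC ler_normD.
have [dl [dl0 Hdl]] : exists dl : R, 0 < dl /\ forall x y, 0 <= x <= B + 1 ->
    `|y - x| < dl -> `|q y - q x| <= e.
  have /compact_near_coveringP/(_ R (0 : R)^'+) := @segment_compact R 0 (B + 1).
  move=> /(_ (fun dl x => forall y, `|y - x| < dl -> `|q y - q x| <= e) _) H.
  have : \forall dl \near 0^'+, `[0, B + 1] `<=`
      (fun x => forall y, `|y - x| < dl -> `|q y - q x| <= e).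
    apply: H => x _; have := @q_continuous x.
    move=> /cvgrPdist_le/(_ _ e2)/nbhs_ballP[r /= r0 Hr].
    have r2 : 0 < r / 2 by rewrite divr_gt0.
    exists (ball x (r / 2), [set t | t < r / 2]) => /=.
      split; first exact: nbhsx_ballx.
      exact: nbhs_right_lt.
    move=> [x' t] /= [xx' tr] y yx'.
    have h1 := Hr x' _; have h2 := Hr y _.
    have {}h1 : `|q x - q x'| <= e / 2.
      by apply: h1; apply: lt_le_trans xx' _; rewrite ler_pdivrMr// ler_pMr// ler1n.
    have {}h2 : `|q x - q y| <= e / 2.
      apply: h2; rewrite /ball/= -(subrKA x'); apply: le_lt_trans (ler_normD _ _) _.
      rewrite [r]splitr; apply: ltrD; first exact: xx'.
      by rewrite distrC; exact: lt_trans yx' tr.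
    have -> : q y - q x' = (q x - q x') - (q x - q y).
      by rewrite opprB [RHS]addrC addrA subrK.
    by apply: le_trans (ler_normB _ _) _; rewrite [e]splitr lerD.
  move=> H1; have [dl [dl0 Hdl]] := filter_ex (filterI (nbhs_right_gt 0) H1).
  by exists dl; split => // x y xB; apply: Hdl; rewrite /= in_itv.
pose k := Num.min dl 1.
have k0 : 0 < k by rewrite lt_min dl0 ltr01.
have k1 : k <= 1 by rewrite ge_min lexx orbT.
have kdl : k <= dl by rewrite ge_min lexx.
(* A lower bound for the gap between [1 / (1 + t)] and [1 / (1 + s)] when [t < B] and [s - t >= k]:
   [(s - t) / (1 + s)] increases with [s], and at [s = t + k] it is at least [k / (2 + B)], as
   [k <= 1]. *)
pose c := k / (2 + B) ^+ 2.
have c0 : 0 < c by rewrite divr_gt0// exprn_gt0// ltr_pwDl// ltW.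
exists (2 * M / c ^+ 2); first by rewrite divr_ge0 ?sqr_ge0 ?mulr_ge0.
have C0 : 0 <= 2 * M / c ^+ 2 by rewrite divr_ge0 ?sqr_ge0 ?mulr_ge0.
have qE x : 0 <= x -> psi x / (1 + x) = q x by move=> x0; rewrite /q max_r.
move=> s t s0 t0; rewrite !qE//.
wlog st : s t s0 t0 / t <= s.
  move=> H; have [|/ltW] := leP t s; first exact: H.
  move=> /(H t s t0 s0); rewrite distrC.
  by rewrite -[X in _ + _ * X](sqrrN ((1 + t)^-1 - (1 + s)^-1)) opprB.
have sq_ge0 : 0 <= 2 * M / c ^+ 2 * ((1 + s)^-1 - (1 + t)^-1) ^+ 2.
  by rewrite mulr_ge0// sqr_ge0.
have [Bt|tB] := leP B t.
  apply: ler_wpDr => //.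
  have -> : q s - q t = (q s - l) - (q t - l) by rewrite opprB addrA subrK.
  apply: le_trans (ler_normB _ _) _; rewrite [e]splitr lerD// HB//.
  exact: le_trans Bt st.
have [stk|stk] := ltP (s - t) k.
  apply: ler_wpDr => //; apply: Hdl; first by rewrite t0 (le_trans (ltW tB))// lerDl.
  by rewrite ger0_norm ?subr_ge0//; exact: lt_le_trans stk kdl.
apply: ler_wpDl; first exact: ltW.
apply: (@le_trans _ _ (2 * M)).
  by apply: le_trans (ler_normB _ _) _; rewrite mulr_natl mulr2n lerD// qM.
rewrite -mulrA ler_peMr ?mulr_ge0// mulrC ler_pdivlMr ?exprn_gt0// mul1r.
rewrite -[leRHS](sqrrN ((1 + s)^-1 - (1 + t)^-1)) opprB.
rewrite lerXn2r ?nnegrE ?(ltW c0)//.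
  by rewrite subr_ge0 lef_pV2 ?posrE ?ltr_pwDl// lerD2l.
have t1 : 0 < 1 + t by rewrite ltr_pwDl.
have s1 : 0 < 1 + s by rewrite ltr_pwDl.
have -> : (1 + t)^-1 - (1 + s)^-1 = (s - t) / (1 + s) / (1 + t).
  by field; rewrite !gt_eqF.
have B2 : 0 < 2 + B by rewrite ltr_pwDl// ltW.
rewrite /c expr2 invfM mulrA; apply: ler_pM.
- by rewrite divr_ge0 ?(ltW k0) ?(ltW B2).
- by rewrite invr_ge0 ltW.
- rewrite ler_pdivrMr// mulrAC ler_pdivlMr//.
  have : 0 <= (s - t - k) * (1 + t) by rewrite mulr_ge0// ?subr_ge0// ltW.
  have : 0 <= (s - t) * (B - t) by rewrite mulr_ge0// subr_ge0// ltW.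
  have : 0 <= (s - t) * (1 - k) by rewrite mulr_ge0// subr_ge0.
  nra.
- by rewrite lef_pV2 ?posrE//; lra.
Qed.

Lemma measurable_fun_psi d (T : measurableType d) (f : T -> R) :
  measurable_fun [set: T] f -> (forall x, 0 <= f x) ->
  measurable_fun [set: T] (fun x => psi (f x)).
Proof.
move=> mf f0.
rewrite (_ : (fun x => psi (f x)) = (fun y => psi (Num.max 0 y)) \o f); last first.
  by apply/funext => x /=; rewrite max_r.
apply: measurableT_comp => //.
exact: continuous_measurable_fun continuous_psi_max0.
Qed.

End linear_growth_modulus.

Section coupling.
Variables (d : measure_display) (T : measurableType d) (R : realType).
Variables (P : probability T R) (sigma : T -> R) (n : nat).
Variables (lam : 'I_n -> R) (w : 'I_n -> T -> R).

Local Notation integr f := (P.-integrable [set: T] (EFin \o f)).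

Hypotheses (n_gt0 : (0 < n)%N) (sigma_int : integr sigma)
  (sigma_ge0 : forall x, 0 <= sigma x) (lam_ge0 : forall j, 0 <= lam j)
  (w_meas : forall j, measurable_fun [set: T] (w j))
  (w_ge0 : forall j x, 0 <= w j x)
  (w_sum : forall x, \sum_(j < n) w j x = 1)
  (w_mean : forall j, \int[P]_x w j x = n%:R^-1)
  (w_sigma : forall j, \int[P]_x (sigma x * w j x) = lam j / n%:R).
Variables (psi : R -> R) (eps C : R).
Hypotheses (psi_sigma : measurable_fun [set: T] (fun x => psi (sigma x)))
  (C_ge0 : 0 <= C)
  (psi_modulus : forall s t : R, 0 <= s -> 0 <= t ->
    `|psi s / (1 + s) - psi t / (1 + t)| <=
      eps + C * ((1 + s)^-1 - (1 + t)^-1) ^+ 2).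

Let w_le1 j x : `|w j x| <= 1.
Proof.
rewrite ger0_norm// -(w_sum x) (bigD1 j)//= lerDl.
by apply: sumr_ge0.
Qed.

Let iw j : integr (w j). Proof. exact: integr_bounded (w_meas j) (w_le1 j). Qed.

Let isw j : integr (fun x => sigma x * w j x).
Proof. exact: integrM_bounded sigma_int (w_meas j) (w_le1 j). Qed.

Let s1_gt0 x : 0 < 1 + sigma x. Proof. by rewrite ltr_pwDl. Qed.
Let l1_gt0 j : 0 < 1 + lam j. Proof. by rewrite ltr_pwDl. Qed.

(** The modulus at [t = 0] says that [psi] grows at most linearly. *)
Lemma integr_psi_sigma : integr (fun x => psi (sigma x)).
Proof.
have iB : integr (fun x => (`|psi 0| + eps + C) * (1 + sigma x)).
  by apply/integrZ/integrD => //; exact: integr_cst.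
apply: le_integrable iB => //; first exact/measurable_EFinP.
move=> x _ /=; rewrite lee_fin.
have := psi_modulus (sigma_ge0 x) (lexx 0); rewrite addr0 invr1 mulr1 => h.
have u1 : ((1 + sigma x)^-1 - 1) ^+ 2 <= 1.
  have h1 : 0 < (1 + sigma x)^-1 by rewrite invr_gt0.
  have h2 : (1 + sigma x)^-1 <= 1 by rewrite invf_le1// lerDl.
  by rewrite -sqrrN opprB expr_le1 ?subr_ge0// gerBl ltW.
have h3 : `|psi (sigma x) / (1 + sigma x)| <= `|psi 0| + eps + C.
  rewrite -(subrK (psi 0) (psi (sigma x) / (1 + sigma x))).
  apply: le_trans (ler_normD _ _) _; rewrite addrC -addrA lerD2l.
  by apply: le_trans h _; rewrite lerD2l ler_piMr.
apply: le_trans (ler_norm _).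
by rewrite -ler_pdivrMr// -[X in _ / X](gtr0_norm (s1_gt0 x)) -normf_div.
Qed.

(* Put [u = 1 / (1 + sigma)], [v_j = 1 / (1 + lam_j)].  Since [sigma - lam_j] has
   mean [0] against [w_j], the left-hand side is the sum over [j] of the
   integrals of [(1 + sigma) (q sigma - q lam_j) w_j]; moreover
   [(1 + sigma) (u - v_j)^2 = u - 2 v_j + v_j^2 (1 + sigma)] has the same mean as
   [u - v_j], and [v_j >= 2 u - u^2 (1 + lam_j)]. *)
Lemma coupling_estimate :
  `|\int[P]_x psi (sigma x) - n%:R^-1 * \sum_(j < n) psi (lam j)| <=
  eps * (1 + \int[P]_x sigma x)
  + C * \int[P]_x `|sigma x - \sum_(j < n) lam j * w j x|.
Proof.
pose q t := psi t / (1 + t).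
pose u x := (1 + sigma x)^-1; pose v j := (1 + lam j)^-1.
have u_meas : measurable_fun [set: T] u.
  rewrite (_ : u = (fun y => (1 + Num.max 0 y)^-1) \o sigma); last first.
    by apply/funext => x /=; rewrite max_r.
  apply: measurableT_comp; last exact: integr_measurable sigma_int.
  apply: continuous_measurable_fun => y.
  apply: cvgV; first by rewrite gt_eqF// ltr_pwDl// le_max lexx.
  by apply: cvgD; [exact: cvg_cst|exact: continuous_max0].
have u_gt0 x : 0 < u x by rewrite invr_gt0.
have u_le1 x : `|u x| <= 1 by rewrite gtr0_norm// invf_le1// lerDl.
have iu : integr u by exact: integr_bounded u_meas u_le1.
have us x : u x * (1 + sigma x) = 1 by rewrite mulVf// gt_eqF.
have vl j : v j * (1 + lam j) = 1 by rewrite mulVf// gt_eqF.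
have n0 : n%:R != 0 :> R by rewrite pnatr_eq0 -lt0n.
(* The subtracted weight [(1 + sigma) w_j] has mean [(1 + lam j) / n], which cancels the denominator
   of [q (lam j)]. *)
pose D x := psi (sigma x) - \sum_(j < n) q (lam j) * (w j x + sigma x * w j x).
have iws j : integr (fun x => w j x + sigma x * w j x) by exact: integrD.
have iS (k : 'I_n -> R) : integr (fun x => \sum_(j < n) k j * (w j x + sigma x * w j x)).
  by apply: integr_sum => j; exact: integrZ.
have mean_ws j : \int[P]_x (w j x + sigma x * w j x) = (1 + lam j) / n%:R.
  by rewrite RintegralD// w_mean w_sigma mulrDl mul1r.
have ID : \int[P]_x D x =
    \int[P]_x psi (sigma x) - n%:R^-1 * \sum_(j < n) psi (lam j).
  rewrite RintegralB//; last exact: integr_psi_sigma.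
  congr (_ - _); rewrite Rintegral_sum; last by move=> j; exact: integrZ.
  rewrite mulr_sumr; apply: eq_bigr => j _.
  rewrite RintegralZl// mean_ws /q mulrA divfK ?gt_eqF// mulrC.
  by [].
rewrite -ID.
have iD : integr D by apply: integrB => //; exact: integr_psi_sigma.
apply: le_trans (le_normr_Rintegral measurableT iD) _.
pose s x := \sum_(j < n) lam j * w j x.
have is_ : integr s by apply: integr_sum => j; exact: integrZ.
pose V x := \sum_(j < n) v j * w j x.
have iV : integr V by apply: integr_sum => j; exact: integrZ.
pose W x := \sum_(j < n) v j ^+ 2 * (w j x + sigma x * w j x).
have iW : integr W by exact: iS.
have IVW : \int[P]_x W x = \int[P]_x V x.
  rewrite Rintegral_sum; last by move=> j; exact: integrZ.
  rewrite Rintegral_sum; last by move=> j; exact: integrZ.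
  apply: eq_bigr => j _; rewrite !RintegralZl// mean_ws w_mean.
  by rewrite expr2 !mulrA -[v j * v j * _]mulrA vl mulr1.
have D_le x : `|D x| <= eps * (1 + sigma x) + C * (u x - V x - V x + W x).
  have -> : D x = \sum_(j < n) (q (sigma x) - q (lam j)) * (w j x * (1 + sigma x)).
    rewrite /D.
    have -> : psi (sigma x) = \sum_(j < n) q (sigma x) * (w j x * (1 + sigma x)).
      rewrite -mulr_sumr -mulr_suml w_sum mul1r /q divfK// gt_eqF//.
    rewrite -sumrB; apply: eq_bigr => j _; ring.
  apply: le_trans (ler_norm_sum _ _ _) _.
  have -> : eps * (1 + sigma x) + C * (u x - V x - V x + W x) =
      \sum_(j < n) (eps + C * (u x - v j) ^+ 2) * (w j x * (1 + sigma x)).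
    transitivity (\sum_(j < n) (eps * (1 + sigma x) * w j x +
        C * (u x * w j x - v j * w j x - v j * w j x +
          v j ^+ 2 * (w j x + sigma x * w j x)))).
      rewrite big_split/= -mulr_sumr w_sum mulr1; congr (_ + _).
      rewrite -mulr_sumr; congr (_ * _).
      by rewrite big_split/= !sumrB -mulr_sumr w_sum mulr1.
    apply: eq_bigr => j _.
    have -> : (eps + C * (u x - v j) ^+ 2) * (w j x * (1 + sigma x)) =
        eps * (1 + sigma x) * w j x + C * (u x * (u x * (1 + sigma x)) * w j x -
        v j * (u x * (1 + sigma x)) * w j x - v j * (u x * (1 + sigma x)) * w j x +
        v j ^+ 2 * (w j x + sigma x * w j x)) by ring.
    by rewrite us !mulr1.
  apply: ler_sum => j _; rewrite normrM [X in _ * X]ger0_norm; last first.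
    by rewrite mulr_ge0// ltW.
  by apply: ler_wpM2r; [rewrite mulr_ge0// ltW|exact: psi_modulus].
have uV_le x : u x - V x <= `|sigma x - s x|.
  (* The first factor of each summand is the tangent to [1 / (1 + t)] at [t = sigma x], taken at
     [lam j]; by convexity it lies below [v j]. *)
  have h : \sum_(j < n) (u x + u x - u x ^+ 2 * (1 + lam j)) * w j x <= V x.
    apply: ler_sum => j _; apply: ler_wpM2r => //.
    rewrite -subr_ge0.
    have -> : v j - (u x + u x - u x ^+ 2 * (1 + lam j)) =
        (1 + lam j) * (u x - v j) ^+ 2.
      have -> : (1 + lam j) * (u x - v j) ^+ 2 = u x ^+ 2 * (1 + lam j) -
          u x * (v j * (1 + lam j)) - u x * (v j * (1 + lam j)) +
          v j * (v j * (1 + lam j)) by ring.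
      by rewrite vl; ring.
    by rewrite mulr_ge0 ?sqr_ge0// ltW.
  have E : \sum_(j < n) (u x + u x - u x ^+ 2 * (1 + lam j)) * w j x =
      u x + u x - u x ^+ 2 - u x ^+ 2 * s x.
    rewrite /s mulr_sumr.
    transitivity (\sum_(j < n) ((u x + u x - u x ^+ 2) * w j x - u x ^+ 2 * (lam j * w j x))).
      by apply: eq_bigr => j _; ring.
    by rewrite sumrB; congr (_ - _); rewrite -mulr_sumr w_sum mulr1.
  have u1 : u x <= 1 by have := u_le1 x; rewrite gtr0_norm.
  have u2 : u x ^+ 2 <= 1 by apply: exprn_ile1 => //; exact: ltW.
  apply: (@le_trans _ _ (u x ^+ 2 * (s x - sigma x))).
    rewrite -subr_ge0; move: h; rewrite E -subr_ge0.
    have e2 : u x ^+ 2 * sigma x = u x - u x ^+ 2.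
      by rewrite -[X in X - _ ^+ 2]mulr1 -(us x); ring.
    by rewrite mulrBr e2; congr (0 <= _); ring.
  apply: le_trans (ler_norm _) _; rewrite normrM distrC ger0_norm ?sqr_ge0//.
  by rewrite ler_piMl.
have iR : integr (fun x => u x - V x - V x + W x).
  by apply: integrD => //; apply: integrB => //; exact: integrB.
have i1s : integr (fun x => 1 + sigma x) by apply: integrD => //; exact: integr_cst.
apply: (@le_trans _ _ (\int[P]_x (eps * (1 + sigma x) + C * (u x - V x - V x + W x)))).
  apply: le_Rintegral => //; first exact: integr_norm.
  by apply: integrD; exact: integrZ.
rewrite RintegralD//; try exact: integrZ.
rewrite !RintegralZl//; apply: lerD.
  by rewrite RintegralD//; [rewrite Rintegral_probability_cst|exact: integr_cst].
apply: ler_wpM2l => //.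
rewrite RintegralD//; last by apply: integrB => //; exact: integrB.
rewrite RintegralB//; last exact: integrB.
rewrite IVW subrK.
apply: le_Rintegral => //; first exact: integrB.
by apply/integr_norm/integrB.
Qed.

End coupling.

(** * Spectrum of the Toeplitz operator *)

Section eigenbasis.
Import passmx.
Variables (F : fieldType) (V : vectType F) (n : nat).
Variables (E : 'I_n -> V) (T : 'End(V)) (m : 'I_n -> F).
Hypotheses (TE : forall j, T (E j) = m j *: E j)
  (E_free : forall u : 'I_n -> F, \sum_j u j *: E j = 0 -> forall j, u j = 0)
  (E_span : forall v, exists u : 'I_n -> F, v = \sum_j u j *: E j).

Lemma lfun_trace_eigenbasis : lfun_trace T = \sum_j m j.
Proof.
rewrite /lfun_trace; set b := vbasis {:V}.
have bP : basis_of {:V} b := vbasisP _.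
set A := mxof b b T.
(* The change of basis is formally rectangular; freeness and spanning provide its one-sided
   inverses, so [n] need not first be identified with the dimension. *)
pose B : 'M[F]_(n, \dim {:V}) := \matrix_j rVof b (E j).
have BE (u : 'rV_n) : u *m B = rVof b (\sum_j u 0 j *: E j).
  rewrite linear_sum mulmx_sum_row; apply: eq_bigr => j _.
  by rewrite linearZ/= rowK.
have B_free : row_free B.
  apply/inj_row_free => u; rewrite BE => /eqP.
  rewrite rVof_eq0// => /eqP/E_free u0.
  by apply/rowP => j; rewrite u0 mxE.
have B_full : row_full B.
  apply/row_fullP; have /choice[u uE] v := E_span v.
  exists (\matrix_(i, j) u b`_i j).
  apply/row_matrixP => i; rewrite row_mul BE row1 -(rVofE bP) [in RHS](uE b`_i).
  by congr (rVof _ _); apply: eq_bigr => j _; rewrite !mxE.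
have BA : B *m A = diag_mx (\row_j m j) *m B.
  apply/row_matrixP => j; rewrite !row_mul rowK -rVof_app// TE linearZ/=.
  by rewrite row_diag_mx mxE -scalemxAl -rowE rowK.
rewrite -(mulmx1 A) -(mulVpmx B_full) mulmxA mxtrace_mulC mulmxA BA.
rewrite -mulmxA (mulmxVp B_free) mulmx1 mxtrace_diag.
by apply: eq_bigr => j _; rewrite mxE.
Qed.

(** In coordinates, [v] in the image has entries [(m j - b) u j], and [v] in the kernel forces
    [(m j - b) ^+ 2 u j = 0]; hence [v = 0]. This absence of a nilpotent part is what the functional
    calculus requires. *)
Lemma eigenbasis_leigenspace b :
  (leigenspace T b :&: limg (T - b *: \1%VF) = 0)%VS.
Proof.
apply/eqP; rewrite -subv0; apply/subvP => v /memv_capP[].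
rewrite memv_ker add_lfunE opp_lfunE scale_lfunE id_lfunE => /eqP Tv /memv_imgP[w _ vw].
have [u uE] := E_span w.
have TbE (c : 'I_n -> F) : (T - b *: \1%VF) (\sum_j c j *: E j) =
    \sum_j ((m j - b) * c j) *: E j.
  rewrite linear_sum; apply: eq_bigr => j _.
  rewrite linearZ/= add_lfunE opp_lfunE scale_lfunE id_lfunE TE -scalerBl scalerA.
  by rewrite mulrC.
have vE : v = \sum_j ((m j - b) * u j) *: E j by rewrite vw uE TbE.
have := TbE (fun j => (m j - b) * u j).
rewrite -vE add_lfunE opp_lfunE scale_lfunE id_lfunE Tv => /esym/E_free H.
rewrite memv0 vE big1// => j _; apply/eqP; rewrite scaler_eq0; apply/orP; left.
have /eqP := H j; rewrite mulf_eq0 => /orP[/eqP ->|//].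
by rewrite mul0r.
Qed.

End eigenbasis.

Lemma trace_fun_calculus (F : closedFieldType) (V : vectType F) (n : nat)
    (E : 'I_n -> V) (T : 'End(V)) (m : 'I_n -> F) (psi : F -> F) :
  (forall j, T (E j) = m j *: E j) ->
  (forall u : 'I_n -> F, \sum_j u j *: E j = 0 -> forall j, u j = 0) ->
  (forall v, exists u : 'I_n -> F, v = \sum_j u j *: E j) ->
  lfun_trace (fun_calculus psi T) = \sum_j psi (m j).
Proof.
move=> TE Ef Es; apply: (lfun_trace_eigenbasis _ Ef Es) => j.
by apply: fun_calculus_eigenvector => // b; exact: (eigenbasis_leigenspace TE Ef Es b).
Qed.

(** The rows of [P] are left eigenvectors. Both unitarity relations are recorded: the one on rows
    gives the integrals of the weights, the one on columns their sum at each point. *)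
Lemma hermitian_diagonalization (R : realType) (n : nat)
    (M : 'I_n -> 'I_n -> R[i]) : (forall i k, (M i k)^* = M k i) ->
  exists (d : 'I_n -> R) (P : 'I_n -> 'I_n -> R[i]),
  [/\ forall j k, \sum_i P j i * (P k i)^* = (j == k)%:R,
      forall i k, \sum_j (P j i)^* * P j k = (i == k)%:R
    & forall j k, \sum_i P j i * M i k = (d j)%:C * P j k].
Proof.
move=> Mherm; pose A : 'M[R[i]]_n := \matrix_(i, k) M i k.
have Aherm : A \is hermsymmx.
  apply/is_hermitianmxP; rewrite expr0 scale1r; apply/matrixP => i k.
  by rewrite !mxE Mherm.
have /orthomx_spectralP AE := hermitian_normalmx Aherm.
have /mxOverP dR := hermitian_spectral_diag_real Aherm.
set P := spectralmx A in AE; set D := spectral_diag A in AE dR.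
have PU : P \is unitarymx := spectral_unitarymx A.
have PA : P *m A = diag_mx D *m P.
  by have := congr1 (mulmx P) AE; rewrite !mulmxA (mulmxV (spectral_unit A)) mul1mx.
exists (fun j => complex.Re (D 0 j)), (fun j i => P j i); split.
- move=> j k; have /unitarymxP/matrixP/(_ j k) := PU; rewrite !mxE => <-.
  by apply: eq_bigr => i _; rewrite !mxE.
- move=> i k; have := PU; rewrite -trmxC_unitary => /unitarymxP/matrixP/(_ i k).
  rewrite !mxE => <-; apply: eq_bigr => j _.
  by rewrite !mxE conjCK.
- move=> j k; have /matrixP/(_ j k) := PA; rewrite mul_diag_mx !mxE.
  rewrite RRe_real//; move=> <-.
  by apply: eq_bigr => i _; rewrite mxE.
Qed.

Section Toeplitz_spectrum.
Variables (R : realType) (G : topologicalZmodType).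
Hypothesis G_compact : compact [set: G].
Variable mu : probability (borel G) R.
Hypothesis mu_haar : translation_invariant mu.
Variable Gamma : {fset dual R G}.
Variable rho : G -> R.

Local Notation A := (cfun R G).
Local Notation dot := (dot mu).
Local Notation integr f := (mu.-integrable [set: borel G] (EFin \o f)).
Local Notation n := #|{: Gamma}|.

Hypothesis rho_int : integr rho.

Definition nth_char (i : 'I_n) : dual R G := val (enum_val i).

Lemma nth_char_inj : injective nth_char.
Proof. by move=> i j /val_inj/enum_val_inj. Qed.

(** The Fourier coefficient of [rho] at the quotient of [nth_char k] by [nth_char i]; the order of
    the indices makes the operator act on row vectors from the right. *)
Definition toeplitz_coef (i k : 'I_n) : R[i] := Cintegral mu (fun x : borel G =>
  (rho x)%:C * nth_char i x * (nth_char k x)^*).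

Lemma Cintegrable_mul_cfun (f : A) :
  Cintegrable mu (fun x : borel G => (rho x)%:C * f x).
Proof.
have [M _ fM] := compact_continuous_bounded G_compact (@cfun_continuous _ _ f).
exact: (Cintegrable_mul_continuous rho_int (@cfun_continuous _ _ f) fM).
Qed.

Lemma Cintegral_real d (T : measurableType d) (P : {measure set T -> \bar R})
  (h : T -> R) : Cintegral P (fun x => (h x)%:C) = (\int[P]_x h x)%:C.
Proof. by rewrite /Cintegral/= Rintegral_cst// mul0r. Qed.

Lemma toeplitz_coef_conj i k : (toeplitz_coef i k)^* = toeplitz_coef k i.
Proof.
have /Cintegral_conj := Cintegrable_mul_cfun
  (cmul (cchar (nth_char i)) (cconj (cchar (nth_char k)))).
rewrite /toeplitz_coef => E.
transitivity ((Cintegral mu (fun x : borel G => (rho x)%:C *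
    cmul (cchar (nth_char i)) (cconj (cchar (nth_char k))) x))^*).
  by congr (_^*); congr Cintegral; apply/funext => x; rewrite !cfunE !ccharE mulrA.
rewrite -E; congr Cintegral; apply/funext => x.
rewrite !cfunE !ccharE !rmorphM/= conjCK conj_Creal; last first.
  by apply/complex_realP; eexists.
by rewrite [in RHS]mulrAC mulrA.
Qed.

Lemma Cintegral_mul_sum (I J : Type) (s : seq I) (t : seq J) (a : I -> J -> R[i])
    (F : I -> J -> A) :
  Cintegral mu (fun x : borel G =>
    (rho x)%:C * \sum_(i <- s) \sum_(j <- t) a i j * F i j x) =
  \sum_(i <- s) \sum_(j <- t) a i j *
    Cintegral mu (fun x : borel G => (rho x)%:C * F i j x).
Proof.
have i1 i j : Cintegrable mu (fun x : borel G => a i j * ((rho x)%:C * F i j x)).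
  by apply: CintegrableZ; exact: Cintegrable_mul_cfun.
transitivity (Cintegral mu (fun x : borel G =>
    \sum_(i <- s) \sum_(j <- t) a i j * ((rho x)%:C * F i j x))).
  congr Cintegral; apply/funext => x; rewrite mulr_sumr; apply: eq_bigr => i _.
  by rewrite mulr_sumr; apply: eq_bigr => j _; rewrite mulrCA.
rewrite Cintegral_sum; last by move=> i; exact: Cintegrable_sum.
apply: eq_bigr => i _; rewrite Cintegral_sum//; apply: eq_bigr => j _.
by rewrite CintegralZ//; exact: Cintegrable_mul_cfun.
Qed.

Lemma toeplitz_char_comb (u : 'rV[R[i]]_n) :
  toeplitz mu Gamma rho (char_comb u) =
  char_comb (\row_k \sum_i u 0 i * toeplitz_coef i k).
Proof.
rewrite toeplitzE// /char_proj (reindex (enum_val : 'I_n -> Gamma))/=; last first.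
  exact/onW_bij/enum_val_bij.
apply: eq_bigr => k _; congr (_ *: _); rewrite mxE.
have := @Cintegral_mul_sum 'I_n unit (enum 'I_n) [:: tt] (fun i _ => u 0 i)
  (fun i _ => cmul (cchar (nth_char i)) (cconj (cchar (nth_char k)))).
rewrite !big_enum/= => E; transitivity (\sum_(i < n) \sum_(j <- [:: tt]) u 0 i *
   Cintegral mu (fun x : borel G => (rho x)%:C *
     cmul (cchar (nth_char i)) (cconj (cchar (nth_char k))) x)); last first.
  apply: eq_bigr => i _; rewrite big_seq1; congr (_ * _).
  by congr Cintegral; apply/funext => x; rewrite !cfunE !ccharE mulrA.
rewrite -E; congr Cintegral; apply/funext => x.
rewrite char_combE (reindex (enum_val : 'I_n -> Gamma))/=; last exact/onW_bij/enum_val_bij.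
rewrite -mulrA mulr_suml big_enum/=; congr (_ * _); apply: eq_bigr => i _.
by rewrite big_seq1 enum_valK mulrA.
Qed.

Lemma sum_char_comb (I : finType) (a : I -> R[i]) (P : I -> 'I_n -> R[i]) :
  \sum_j a j *: char_comb (\row_i P j i) = char_comb (\row_i \sum_j a j * P j i).
Proof.
rewrite /char_comb; under eq_bigr do rewrite scaler_sumr.
rewrite exchange_big/=; apply: eq_bigr => i _.
rewrite mxE scaler_suml; apply: eq_bigr => j _.
by rewrite mxE scalerA.
Qed.

(** Stated for any nonnegative integrable symbol: besides [sigma], auxiliary symbols are fed into it
    to show that the smoothing is positive and preserves integrals. *)
Lemma toeplitz_spectrum (n_gt0 : (0 < n)%N) (rho_ge0 : forall x, 0 <= rho x) :
  exists (d : 'I_n -> R) (w : 'I_n -> G -> R),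
  [/\ forall j, 0 <= d j,
      forall j, measurable_fun [set: borel G] (w j),
      forall j x, 0 <= w j x,
      forall x, \sum_j w j x = 1 &
  [/\ forall j, \int[mu]_x w j x = n%:R^-1,
      forall j, \int[mu]_x (rho x * w j x) = d j / n%:R,
      forall x, (\sum_j d j * w j x)%:C = n%:R^-1 *
        \sum_i \sum_k toeplitz_coef i k * ((nth_char i x)^* * nth_char k x)
    & forall psi : R -> R,
        lfun_trace (fun_calculus (on_real_part psi) (toeplitz mu Gamma rho)) =
        (\sum_j psi (d j))%:C]].
Proof.
have [d [P [PPt PtP PM]]] := hermitian_diagonalization toeplitz_coef_conj.
pose e j : A := \sum_i P j i *: cchar (nth_char i).
have eE j x : e j x = \sum_i P j i * nth_char i x.
  by rewrite cfunE_sum; apply: eq_bigr => i _; rewrite cfunEZ.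
have n0 : n%:R != 0 :> R by rewrite pnatr_eq0 -lt0n.
pose w j x : R := complex.Re (`|e j x| ^+ 2) / n%:R.
have wE j x : e j x * (e j x)^* = (n%:R * w j x)%:C.
  rewrite mulrCA divff// mulr1 -normCK.
  by apply/esym/RRe_real/ger0_real; rewrite exprn_ge0.
have eeE j x : e j x * (e j x)^* =
    \sum_i \sum_k P j i * (P j k)^* * (nth_char i x * (nth_char k x)^*).
  rewrite eE rmorph_sum mulr_suml; apply: eq_bigr => i _.
  rewrite mulr_sumr; apply: eq_bigr => k _.
  by rewrite rmorphM/= mulrACA.
have eeE' j x : (e j x)^* * e j x =
    \sum_i \sum_k (P j i)^* * P j k * ((nth_char i x)^* * nth_char k x).
  rewrite eE rmorph_sum mulr_suml; apply: eq_bigr => i _.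
  rewrite mulr_sumr; apply: eq_bigr => k _.
  by rewrite rmorphM/= mulrACA.
have coefE i k : \sum_j (P j i)^* * ((d j)%:C * P j k) = toeplitz_coef i k.
  under eq_bigr do rewrite -PM mulr_sumr.
  rewrite exchange_big/= (bigD1 i)//= [X in _ + X]big1 ?addr0.
    have := PtP i i; rewrite eqxx => E.
    by under eq_bigr do rewrite mulrA; rewrite -mulr_suml E mul1r.
  move=> l /negPf li; have := PtP i l; rewrite eq_sym li => E.
  by under eq_bigr do rewrite mulrA; rewrite -mulr_suml E mul0r.
have w_ge0 j x : 0 <= w j x by rewrite divr_ge0// Re_sqr_norm_ge0.
have char1 i x : nth_char i x * (nth_char i x)^* = 1.
  by rewrite -normCK char_norm expr1n.
have nC (k : nat) : k%:R = (k%:R : R)%:C :> R[i] by rewrite rmorph_nat.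
(* By unitarity, the sum of the [|e j x| ^+ 2] equals that of the [|nth_char i x| ^+ 2], namely
   [n]. *)
have w_sum x : \sum_j w j x = 1.
  apply: (mulfI n0); rewrite mulr1 mulr_sumr; apply: (@complexI R).
  rewrite rmorph_sum/=; under eq_bigr do rewrite -wE eeE.
  rewrite exchange_big/=; under eq_bigr do rewrite exchange_big/=.
  transitivity (\sum_(i < n) (1 : R[i])); last first.
    by rewrite sumr_const card_ord -nC.
  apply: eq_bigr => i _; rewrite (bigD1 i)//= [X in _ + X]big1 ?addr0.
    rewrite -mulr_suml char1 mulr1.
    transitivity (\sum_j (P j i)^* * P j i); last by rewrite PtP eqxx.
    by apply: eq_bigr => j _; rewrite mulrC.
  move=> k /negPf ki; rewrite -mulr_suml.
  have := PtP k i; rewrite ki => E.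
  by under eq_bigr do rewrite mulrC; rewrite E mul0r.
have w_meas j : measurable_fun [set: borel G] (w j).
  apply: measurable_funM; last exact: measurable_cst.
  apply: eq_measurable_fun (continuous_measurable_Re (cmul (e j) (cconj (e j)))) => x _.
  by rewrite !cfunE -normCK.
have w_le1 j x : `|w j x| <= 1.
  by rewrite ger0_norm// -(w_sum x) (bigD1 j)//= lerDl sumr_ge0.
have iw j : integr (w j) by exact: integr_bounded (w_meas j) (w_le1 j).
have irw j : integr (fun x => rho x * w j x).
  exact: integrM_bounded rho_int (w_meas j) (w_le1 j).
have w_mean j : \int[mu]_x w j x = n%:R^-1.
  apply: (mulfI n0); rewrite divff//; apply: (@complexI R).
  rewrite -RintegralZl//.
  rewrite -Cintegral_real.
  transitivity (dot (e j) (e j)).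
    by congr Cintegral; apply/funext => x; rewrite -wE.
  rewrite (dot_suml G_compact).
  transitivity (\sum_i P j i * (P j i)^*); last by rewrite PPt eqxx.
  apply: eq_bigr => i _; rewrite (dotZl G_compact); congr (_ * _).
  rewrite (dotC G_compact) (dot_suml G_compact) rmorph_sum/= (bigD1 i)//= big1 ?addr0.
    by rewrite (dotZl G_compact) (dot_cchar G_compact mu_haar) eqxx mulr1.
  move=> k /negPf ki; rewrite (dotZl G_compact) (dot_cchar G_compact mu_haar).
  by rewrite (inj_eq nth_char_inj) ki mulr0 rmorph0.
have w_rho j : \int[mu]_x (rho x * w j x) = d j / n%:R.
  apply: (mulfI n0); rewrite mulrCA divff// mulr1; apply: (@complexI R).
  rewrite -RintegralZl//.
  rewrite -Cintegral_real.
  transitivity (Cintegral mu (fun x : borel G => (rho x)%:C *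
    \sum_(i < n) \sum_(k < n) (P j i * (P j k)^*) *
      cmul (cchar (nth_char i)) (cconj (cchar (nth_char k))) x)).
    congr Cintegral; apply/funext => x.
    have -> : n%:R * (rho x * w j x) = rho x * (n%:R * w j x) by rewrite mulrCA.
    by rewrite rmorphM; congr (_ * _); rewrite -eeE wE.
  rewrite (Cintegral_mul_sum _ _ (fun i k => P j i * (P j k)^*)
    (fun i k => cmul (cchar (nth_char i)) (cconj (cchar (nth_char k))))).
  rewrite exchange_big/=.
  transitivity (\sum_k (d j)%:C * (P j k * (P j k)^*)); last first.
    by rewrite -mulr_sumr PPt eqxx mulr1.
  apply: eq_bigr => k _; rewrite mulrA -PM mulr_suml; apply: eq_bigr => i _.
  rewrite mulrAC; congr (_ * _ * _).
  by congr Cintegral; apply/funext => x; rewrite /= mulrA.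
exists d, w; split => //.
(* Positivity of the spectrum is read off from the weights: [d j / n] is the integral of a
   nonnegative function. *)
- move=> j; have : 0 <= d j / n%:R.
    by rewrite -w_rho; apply: Rintegral_ge0 => x _; rewrite mulr_ge0.
  by rewrite pmulr_lge0// invr_gt0 ltr0n.
split => //.
- move=> x; apply: (mulfI (_ : n%:R != 0 :> R[i])); first by rewrite pnatr_eq0 -lt0n.
  rewrite mulrA divff ?mul1r; last by rewrite pnatr_eq0 -lt0n.
  transitivity (\sum_j (d j)%:C * \sum_i \sum_k
      (P j i)^* * P j k * ((nth_char i x)^* * nth_char k x)).
    rewrite nC -rmorphM mulr_sumr rmorph_sum; apply: eq_bigr => j _.
    have -> : n%:R * (d j * w j x) = d j * (n%:R * w j x) by rewrite mulrCA.
    by rewrite rmorphM; congr (_ * _); rewrite -eeE' [RHS]mulrC wE.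
  under eq_bigr do rewrite mulr_sumr.
  rewrite exchange_big/=; apply: eq_bigr => i _.
  under eq_bigr do rewrite mulr_sumr.
  rewrite exchange_big/=; apply: eq_bigr => k _.
  rewrite -(coefE i k) mulr_suml; apply: eq_bigr => j _.
  ring.
- move=> psi; rewrite (trace_fun_calculus (E := fun j => char_comb (\row_i P j i))
    (m := fun j => (d j)%:C)).
  + by rewrite rmorph_sum.
  + move=> j; rewrite toeplitz_char_comb /char_comb scaler_sumr.
    apply: eq_bigr => k _; rewrite scalerA !mxE -PM; congr (_ *: _).
    by apply: eq_bigr => i _; rewrite mxE.
  + move=> u; rewrite sum_char_comb => H k.
    have {}H i : \sum_j u j * P j i = 0.
      have c0 : char_comb (0 : 'rV[R[i]]_n) = 0.
        by rewrite /char_comb big1// => l _; rewrite mxE scale0r.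
      have /rowP/(_ i) := char_comb_inj (etrans H (esym c0)).
      by rewrite !mxE.
    transitivity (\sum_i (\sum_j u j * P j i) * (P k i)^*); last first.
      by rewrite big1// => i _; rewrite H mul0r.
    under eq_bigr do rewrite mulr_suml.
    rewrite exchange_big/= (bigD1 k)//= [X in _ + X]big1 ?addr0.
      under eq_bigr do rewrite -mulrA.
      by rewrite -mulr_sumr PPt eqxx mulr1.
    move=> j /negPf jk; under eq_bigr do rewrite -mulrA.
    by rewrite -mulr_sumr PPt jk mulr0.
  + move=> v; have [c cE] := char_comb_surj v.
    exists (fun j => \sum_i c 0 i * (P j i)^*).
    rewrite sum_char_comb -cE; congr char_comb; apply/rowP => k; rewrite mxE.
    under [RHS]eq_bigr do rewrite mulr_suml.
    rewrite exchange_big/= (bigD1 k)//= [X in _ + X]big1 ?addr0.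
      under eq_bigr do rewrite -mulrA.
      by rewrite -mulr_sumr PtP eqxx mulr1.
    move=> i /negPf ik; under eq_bigr do rewrite -mulrA.
    by rewrite -mulr_sumr PtP ik mulr0.
Qed.

End Toeplitz_spectrum.

(** * Smoothing by Fejer kernels *)

Section smoothed_symbol.
Variables (R : realType) (G : topologicalZmodType).
Hypothesis G_compact : compact [set: G].
Variable mu : probability (borel G) R.
Hypothesis mu_haar : translation_invariant mu.

Local Notation A := (cfun R G).
Local Notation integr f := (mu.-integrable [set: borel G] (EFin \o f)).

Section one_set.
Variable Gamma : {fset dual R G}.
Local Notation n := #|{: Gamma}|.
Hypothesis n_gt0 : (0 < n)%N.
Implicit Types r : G -> R.

(* The convolution of [r] with the Fejer kernel of [Gamma]. *)
Definition smoothed_symbol r x : R[i] := n%:R^-1 * \sum_(i < n) \sum_(k < n)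
  toeplitz_coef mu r i k * ((nth_char i x)^* * nth_char k x).

Lemma toeplitz_coefD r r' (i k : 'I_n) : integr r -> integr r' ->
  toeplitz_coef mu (fun x => r x + r' x) i k =
  toeplitz_coef mu r i k + toeplitz_coef mu r' i k.
Proof.
move=> jr jr'; pose F := cmul (cchar (nth_char i)) (cconj (cchar (nth_char k))).
rewrite /toeplitz_coef -CintegralD.
- by congr Cintegral; apply/funext => x; rewrite rmorphD/= !mulrDl.
- have := Cintegrable_mul_cfun G_compact jr F.
  by congr Cintegrable; apply/funext => x; rewrite /= mulrA.
- have := Cintegrable_mul_cfun G_compact jr' F.
  by congr Cintegrable; apply/funext => x; rewrite /= mulrA.
Qed.

Lemma smoothed_symbolD r r' x : integr r -> integr r' ->
  smoothed_symbol (fun x => r x + r' x) x =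
  smoothed_symbol r x + smoothed_symbol r' x.
Proof.
move=> jr jr'; rewrite /smoothed_symbol -mulrDr; congr (_ * _).
rewrite -big_split/=; apply: eq_bigr => i _.
rewrite -big_split/=; apply: eq_bigr => k _.
by rewrite toeplitz_coefD// mulrDl.
Qed.

Lemma smoothed_symbolN r x : integr r ->
  smoothed_symbol (fun x => -1 * r x) x = - smoothed_symbol r x.
Proof.
move=> jr; have jN : integr (fun x => -1 * r x) by exact: integrZ.
apply/eqP; rewrite -addr_eq0 addrC -smoothed_symbolD//.
rewrite /smoothed_symbol big1 ?mulr0// => i _; rewrite big1// => k _.
rewrite /toeplitz_coef (_ : (fun _ => _) = fun=> 0).
  by rewrite (Cintegral_cst mu) mul0r.
by apply/funext => y; rewrite mulN1r subrr !mul0r.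
Qed.

(** The spectral form [sum_j d_j w_j] displays the sign directly, without computing with the
    kernel. *)
Lemma smoothed_symbol_ge0 r x : integr r -> (forall y, 0 <= r y) ->
  0 <= smoothed_symbol r x.
Proof.
move=> jr r0; have [d [w [d0 _ w0 _ [_ _ wS _]]]] :=
  toeplitz_spectrum G_compact mu_haar jr n_gt0 r0.
by rewrite /smoothed_symbol -wS ler0c; apply: sumr_ge0 => j _; rewrite mulr_ge0.
Qed.

Lemma Rintegral_smoothed_symbol r : integr r -> (forall y, 0 <= r y) ->
  integr (fun x => complex.Re (smoothed_symbol r x)) /\
  \int[mu]_x complex.Re (smoothed_symbol r x) = \int[mu]_x r x.
Proof.
move=> jr r0; have [d [w [d0 w_meas w0 w_sum [w_mean w_r wS _]]]] :=
  toeplitz_spectrum G_compact mu_haar jr n_gt0 r0.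
have w_le1 j x : `|w j x| <= 1.
  by rewrite ger0_norm// -(w_sum x) (bigD1 j)//= lerDl sumr_ge0.
have iw j : integr (w j) by exact: integr_bounded (w_meas j) (w_le1 j).
have E : (fun x => complex.Re (smoothed_symbol r x)) = fun x => \sum_j d j * w j x.
  by apply/funext => x; rewrite /smoothed_symbol -wS.
rewrite E; split; first by apply: integr_sum => j; exact: integrZ.
rewrite Rintegral_sum; last by move=> j; exact: integrZ.
transitivity (\sum_j \int[mu]_x (r x * w j x)).
  by apply: eq_bigr => j _; rewrite RintegralZl// w_mean w_r.
rewrite -Rintegral_sum; last first.
  by move=> j; exact: integrM_bounded jr (w_meas j) (w_le1 j).
by apply: eq_Rintegral => x _; rewrite -mulr_sumr w_sum mulr1.
Qed.

(** The Fejer kernel multiplies the character [chi] by [1 - escape chi / n], as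
    [smoothed_symbol_trigonometric] shows. *)
Definition escape (chi : dual R G) : nat :=
  \sum_(i < n) ((chi * nth_char i)%g \notin Gamma).

Lemma nth_charP (chi : dual R G) : chi \in Gamma -> exists k : 'I_n, nth_char k = chi.
Proof.
move=> chiG; exists (enum_rank [` chiG]%fset).
by rewrite /nth_char enum_rankK.
Qed.

Lemma nth_char_in (k : 'I_n) : nth_char k \in Gamma.
Proof. exact: valP. Qed.

Lemma smoothed_symbol_trigonometric (q : A) (s : seq (R[i] * dual R G)) x :
  (forall x, q x = (complex.Re (q x))%:C) ->
  q = \sum_(z <- s) z.1 *: cchar z.2 ->
  smoothed_symbol (fun x => complex.Re (q x)) x - q x =
  - \sum_(z <- s) z.1 * z.2 x * ((escape z.2)%:R / n%:R).
Proof.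
move=> qR qE.
have n0 : n%:R != 0 :> R[i] by rewrite pnatr_eq0 -lt0n.
have coefE (i k : 'I_n) : toeplitz_coef mu (fun x => complex.Re (q x)) i k =
    \sum_(z <- s) z.1 * ((z.2 * nth_char i)%g == nth_char k)%:R.
  transitivity (dot mu (cmul q (cchar (nth_char i))) (cchar (nth_char k))).
    by congr Cintegral; apply/funext => y; rewrite -qR.
  have -> : cmul q (cchar (nth_char i)) =
      \sum_(z <- s) z.1 *: cchar (z.2 * nth_char i)%g.
    apply: cfunP => y; rewrite cmulE qE !cfunE_sum mulr_suml.
    by apply: eq_bigr => z _; rewrite !cfunEZ !ccharE mulrA.
  rewrite (dot_suml G_compact); apply: eq_bigr => z _.
  by rewrite (dotZl G_compact) (dot_cchar G_compact mu_haar).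
(* For given [i] and [z], orthogonality leaves at most one [k], the index of [z.2 * nth_char i], and
   it exists exactly when this product lies in [Gamma]. *)
have rowE (i : 'I_n) : \sum_(k < n) toeplitz_coef mu (fun x => complex.Re (q x)) i k *
      ((nth_char i x)^* * nth_char k x) =
    \sum_(z <- s) z.1 * z.2 x * ((z.2 * nth_char i)%g \in Gamma)%:R.
  under eq_bigr do rewrite coefE mulr_suml.
  rewrite exchange_big/=; apply: eq_bigr => z _.
  have [zG|zG] := boolP ((z.2 * nth_char i)%g \in Gamma).
    have [k0 k0E] := nth_charP zG.
    rewrite (bigD1 k0)//= k0E eqxx big1 ?addr0 ?mulr1.
      congr (_ * _); transitivity ((nth_char i x)^* * (z.2 x * nth_char i x)); first by [].
      by rewrite mulrCA [X in _ * X]mulrC -normCK char_norm expr1n mulr1.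
    move=> k /negPf kk0; rewrite -k0E (inj_eq (@nth_char_inj _ _ Gamma)) eq_sym kk0.
    by rewrite mulr0 mul0r.
  rewrite mulr0 big1// => k _; case: eqP => [E|_]; last by rewrite mulr0 mul0r.
  by rewrite E nth_char_in in zG.
rewrite /smoothed_symbol; under eq_bigr do rewrite rowE.
rewrite exchange_big/= mulr_sumr qE cfunE_sum -sumrB -sumrN; apply: eq_bigr => z _.
rewrite cfunEZ ccharE -mulr_sumr.
have -> : \sum_(i < n) ((z.2 * nth_char i)%g \in Gamma)%:R = n%:R - (escape z.2)%:R :> R[i].
  have nE : n%:R = \sum_(i < n) (1 : R[i]) by rewrite sumr_const card_ord.
  rewrite nE /escape natr_sum -sumrB.
  by apply: eq_bigr => i _; case: (_ \in _); rewrite ?subr0 ?subrr.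
by field.
Qed.

Lemma escape_le (chi : dual R G) :
  (escape chi <= #|` symdiff (translate chi Gamma) Gamma|)%N.
Proof.
rewrite /escape -big_mkcond/= sum1_card cardE.
rewrite -(size_map (fun i => (chi * nth_char i)%g)); apply: uniq_leq_size.
  rewrite map_inj_uniq ?enum_uniq// => i j /mulgI; exact: (@nth_char_inj _ _ Gamma).
move=> _ /mapP[i + ->]; rewrite mem_enum => iG.
rewrite /symdiff inE; apply/orP; left; rewrite in_fsetD; apply/andP; split.
  exact: iG.
by apply/imfsetP; exists (nth_char i) => //; exact: nth_char_in.
Qed.

End one_set.

(** Positivity on [|r| + r] and [|r| - r] bounds the smoothing of [r] by that of [|r|], which has
    the same integral as [|r|]. *)
Lemma smoothed_symbol_L1_le (Gamma : {fset dual R G}) (r : G -> R) :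
  (0 < #|{: Gamma}|)%N -> integr r ->
  integr (fun x => complex.Re (smoothed_symbol Gamma r x)) /\
  \int[mu]_x `|complex.Re (smoothed_symbol Gamma r x)| <= \int[mu]_x `|r x|.
Proof.
move=> n_gt0 jr; set S := smoothed_symbol Gamma.
have jabs := integr_norm jr.
have jN : integr (fun x => -1 * r x) by exact: integrZ.
have ip : integr (fun x => `|r x| + r x) by exact: integrD.
have im : integr (fun x => `|r x| + -1 * r x) by exact: integrD.
have p0 x : 0 <= `|r x| + r x by have := ler_norm (- r x); rewrite normrN; lra.
have m0 x : 0 <= `|r x| + -1 * r x by rewrite mulN1r subr_ge0 ler_norm.
have [iSa ISa] := Rintegral_smoothed_symbol n_gt0 jabs (fun x => normr_ge0 _).
have [iSp _] := Rintegral_smoothed_symbol n_gt0 ip p0.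
have Sp x : S (fun y => `|r y| + r y) x = S (fun y => `|r y|) x + S r x.
  exact: smoothed_symbolD.
have Sm x : S (fun y => `|r y| + -1 * r y) x =
    S (fun y => `|r y|) x + S (fun y => -1 * r y) x.
  exact: smoothed_symbolD.
have SN x : S (fun y => -1 * r y) x = - S r x by exact: smoothed_symbolN.
have iSr : integr (fun x => complex.Re (S r x)).
  have := integrB iSp iSa; congr (mu.-integrable _ (EFin \o _)).
  by apply/funext => x; rewrite -/S Sp Re_add addrAC subrr add0r.
split; first exact: iSr.
rewrite -ISa; apply: le_Rintegral; [by []|exact: integr_norm|exact: iSa|].
move=> x _; rewrite ler_norml; apply/andP; split.
  have := smoothed_symbol_ge0 n_gt0 x ip p0; rewrite -/S Sp.
  by rewrite lecE/= Re_add => /andP[_]; lra.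
have := smoothed_symbol_ge0 n_gt0 x im m0; rewrite -/S Sm SN.
rewrite lecE/= Re_add => /andP[_].
by case: (S r x) => a b /=; lra.
Qed.

(** The conjugate of a character is its inverse, so real parts stay trigonometric; a real
    approximant is needed because symbols are real. *)
Lemma trigonometric_real_part (p : A) : trigonometric p ->
  exists2 q, trigonometric q & forall x, q x = (complex.Re (p x))%:C.
Proof.
move=> [s ->]; exists (\sum_(z <- s) ((z.1 / 2) *: cchar z.2 +
    (z.1^* / 2) *: cchar (char_inv z.2))).
  rewrite big_split/=; apply: trigonometricD.
    by exists [seq (z.1 / 2, z.2) | z <- s]; rewrite big_map.
  by exists [seq (z.1^* / 2, char_inv z.2) | z <- s]; rewrite big_map.
move=> x; rewrite !cfunE_sum.
rewrite (_ : complex.Re _ = \sum_(z <- s) complex.Re (z.1 * z.2 x)); last first.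
  elim: s => [|z s IH]; first by rewrite !big_nil.
  by rewrite !big_cons Re_add IH.
rewrite rmorph_sum; apply: eq_bigr => z _.
rewrite !cfunE !ccharE (_ : char_inv z.2 x = (z.2 x)^*); last exact: charN.
transitivity ((complex.Re (z.1 * z.2 x))%:C); last by [].
rewrite ReJ_add (_ : conjc (z.1 * z.2 x) = z.1^* * (z.2 x)^*); first by ring.
exact: (rmorphM Num.conj).
Qed.

Hypothesis G_metrizable : metrizable R G.

(** Three errors of [e / 3]: replacing [r] by a real trigonometric polynomial [q], smoothing [q],
    where the Folner ratios weighted by its coefficients bound the change, and returning to [r]
    under the smoothing, where the contraction property applies. *)
Lemma smoothed_symbol_cvg (Gamma : nat -> {fset dual R G}) (r : G -> R) :
  (forall N, Gamma N != fset0) -> Folner Gamma -> integr r ->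
  forall e : R, 0 < e -> exists N0, forall N, (N0 <= N)%N ->
    \int[mu]_x `|r x - complex.Re (smoothed_symbol (Gamma N) r x)| <= e.
Proof.
move=> Gamma0 GF jr e e0.
have n_gt0 N : (0 < #|{: Gamma N}|)%N by rewrite -cardfE cardfs_gt0.
have e3 : 0 < e / 3 by rewrite divr_gt0.
have [p tp pe] := trig_approximable_integrable G_compact G_metrizable mu_haar jr e3.
have [q [s qs] qp] := trigonometric_real_part tp.
have qR x : q x = (complex.Re (q x))%:C by rewrite qp.
have qr : \int[mu]_x `|r x - complex.Re (q x)| <= e / 3.
  by under eq_Rintegral do rewrite qp/=.
have iq := integr_Re G_compact mu q.
pose b (z : R[i] * dual R G) N : R := complex.Re `|z.1| *
  (#|` symdiff (translate z.2 (Gamma N)) (Gamma N)|%:R / #|` Gamma N|%:R).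
have B_cvg t : (\sum_(z <- t) b z N) @[N --> \oo] --> (0 : R).
  elim: t => [|z t IH].
    rewrite (_ : (fun _ => _) = fun=> 0); first exact: cvg_cst.
    by apply/funext => N; rewrite big_nil.
  rewrite (_ : (fun _ => _) = fun N => b z N + \sum_(z <- t) b z N); last first.
    by apply/funext => N; rewrite big_cons.
  rewrite -[X in _ --> X](addr0 0) -[X in _ --> X + _](mulr0 (complex.Re `|z.1|)).
  by apply: cvgD IH; apply: cvgM; [exact: cvg_cst|exact: GF].
have /cvgrPdist_le/(_ _ e3)[N0 _ HN0] := B_cvg s; exists N0 => N /HN0/=.
rewrite sub0r normrN => BN.
have diff_le x : `|complex.Re (q x) - complex.Re (smoothed_symbol (Gamma N)
    (fun x => complex.Re (q x)) x)| <= e / 3.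
  apply: le_trans (le_trans (ler_norm _) BN).
  rewrite distrC -lecR.
  rewrite -Re_sub; apply: le_trans (normc_ge_Re _) _.
  rewrite (smoothed_symbol_trigonometric (n_gt0 N) _ qR qs) normrN.
  apply: le_trans (ler_norm_sum _ _ _) _; rewrite rmorph_sum.
  apply: ler_sum => z _; rewrite !normrM char_norm mulr1 rmorphM/=.
  have -> : (complex.Re `|z.1|)%:C = `|z.1|.
    by apply/RRe_real/ger0_real/normr_ge0.
  apply: ler_wpM2l => //; rewrite ger0_norm ?invr_ge0// ger0_norm//.
  rewrite fmorph_div !rmorph_nat -cardfE ler_wpM2r ?invr_ge0// ler_nat.
  exact: escape_le.
have iqr : integr (fun x => complex.Re (q x) + -1 * r x).
  by apply: integrD => //; exact: integrZ.
have [iS IS] := smoothed_symbol_L1_le (n_gt0 N) iqr.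
have [iSr _] := smoothed_symbol_L1_le (n_gt0 N) jr.
have [iSq _] := smoothed_symbol_L1_le (n_gt0 N) iq.
apply: le_trans (Rintegral_triangle jr iq iSr) _.
rewrite (_ : e = e / 3 + (e / 3 + e / 3)); last by field.
apply: lerD => //.
apply: le_trans (Rintegral_triangle iq iSq iSr) _.
apply: lerD.
  apply: (@le_trans _ _ (\int[mu]_x (e / 3))).
    apply: le_Rintegral => //; [exact/integr_norm/integrB|exact: integr_cst].
  by rewrite Rintegral_probability_cst.
have jN : integr (fun x => -1 * r x) by exact: integrZ.
have SD x : smoothed_symbol (Gamma N) (fun y => complex.Re (q y) + -1 * r y) x =
    smoothed_symbol (Gamma N) (fun y => complex.Re (q y)) x -
    smoothed_symbol (Gamma N) r x.
  by rewrite smoothed_symbolD// smoothed_symbolN.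
apply: le_trans qr.
have -> : \int[mu]_x `|complex.Re (smoothed_symbol (Gamma N)
      (fun y => complex.Re (q y)) x) - complex.Re (smoothed_symbol (Gamma N) r x)| =
    \int[mu]_x `|complex.Re (smoothed_symbol (Gamma N)
      (fun y => complex.Re (q y) + -1 * r y) x)|.
  by apply: eq_Rintegral => x _; rewrite SD Re_sub.
apply: le_trans IS _; rewrite le_eqVlt; apply/orP; left; apply/eqP.
by apply: eq_Rintegral => x _; rewrite mulN1r distrC.
Qed.

End smoothed_symbol.

Theorem theorem1p2 (R : realType) (G : topologicalZmodType)
    (G_compact : compact [set: G])
    (G_metrizable : metrizable R G)
    (mu : probability (borel G) R)
    (mu_haar : translation_invariant mu)
    (Gamma : nat -> {fset dual R G})
    (Gamma_neq0 : forall N, Gamma N != fset0)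
    (Gamma_Folner : Folner Gamma)
    (sigma : G -> R)
    (sigma_L1 : mu.-integrable [set: borel G] (EFin \o sigma))
    (sigma_ge0 : forall x, 0 <= sigma x)
    (psi : R -> R)
    (psi_continuous : {within `[0, +oo[, continuous psi})
    (psi_lim : exists l : R, psi x / x @[x --> +oo] --> l) :
  ((#|` Gamma N|%:R^-1
      * lfun_trace (fun_calculus (on_real_part psi) (toeplitz mu (Gamma N) sigma)) : R[i]^o)
    @[N --> \oo] --> ((\int[mu]_x psi (sigma x))%:C : R[i]^o)).
Proof.
have [l psi_l] := psi_lim.
apply/(@cvgrPdist_le _ R[i]^o) => e' e'0.
have eE : e' = (complex.Re e')%:C by apply/esym/RRe_real/gtr0_real.
move: (complex.Re e') eE => e eE; have e0 : 0 < e by rewrite -ltcR -eE rmorph0.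
rewrite {}eE {e' e'0}; have e2 : 0 < e / 2 by rewrite divr_gt0.
set I := \int[mu]_x sigma x.
have I0 : 0 <= I by apply: Rintegral_ge0 => x _.
have I1 : 0 < 1 + I by rewrite ltr_pwDl.
(* The coupling error [eps * (1 + I)] becomes [e / 2]. The constant [C] depends on [psi] and this
   [eps] but not on [N], so the [L^1] tolerance [e / 2 / (C + 1)] can be fixed before [N]. *)
have eps0 : 0 < e / 2 / (1 + I) by rewrite divr_gt0.
have [C C0 psiC] := linear_growth_modulus psi_continuous psi_l eps0.
have C1 : 0 < C + 1 by rewrite ltr_wpDl.
have d0 : 0 < e / 2 / (C + 1) by rewrite divr_gt0.
have [N0 HN0] := smoothed_symbol_cvg G_compact mu_haar G_metrizable Gamma_neq0
  Gamma_Folner sigma_L1 d0.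
exists N0 => // N /= /HN0 symbol_le.
have n_gt0 : (0 < #|{: Gamma N}|)%N by rewrite -cardfE cardfs_gt0.
have [d [w [d_ge0 w_meas w_ge0 w_sum [w_mean w_sigma wS ->]]]] :=
  toeplitz_spectrum G_compact mu_haar sigma_L1 n_gt0 sigma_ge0.
have psi_meas : measurable_fun [set: borel G] (fun x => psi (sigma x)).
  by apply: (measurable_fun_psi psi_continuous) => //; exact: integr_measurable sigma_L1.
have := coupling_estimate n_gt0 sigma_L1 sigma_ge0 d_ge0 w_meas w_ge0 w_sum w_mean
  w_sigma psi_meas C0 psiC.
rewrite -/I divfK ?gt_eqF// => est.
rewrite cardfE -[X in X^-1](rmorph_nat (real_complex R)) -fmorphV -rmorphM -rmorphB.
rewrite normc_def/= expr0n addr0 sqrtr_sqr lecR.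
apply: le_trans est _; rewrite [leRHS]splitr lerD2l.
have -> : \int[mu]_x `|sigma x - \sum_j d j * w j x| =
    \int[mu]_x `|sigma x - complex.Re (smoothed_symbol mu (Gamma N) sigma x)|.
  by apply: eq_Rintegral => x _; rewrite /smoothed_symbol -wS.
apply: le_trans (ler_wpM2l C0 symbol_le) _.
by rewrite mulrCA ger_pMr// ler_pdivrMr// mul1r lerDl.
Qed.
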